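(* Fix an integer $d$. Let $R$ be the class of permutations whose expanded decomposition tree has all prime nodes of arity smaller than $d$. Then the following problem can be solved in polynomial time: given $\sigma\in R$ and an arbitrary permutation $\tau$, compute a longest common pattern of $\sigma$ and $\tau$.
   Context: A permutation $\pi$ is a pattern of $\sigma$ if some subsequence of $\sigma$ is order-isomorphic to $\pi$; a longest common pattern of $\sigma$ and $\tau$ is a permutation of maximum length that is a pattern of both. A common interval of $\sigma=\sigma_1\cdots\sigma_k$ is a factor $\sigma_j\cdots\sigma_l$ whose set of values is an interval of integers; it is strong if it overlaps no other common interval ($I,J$ overlap if $I\setminus J$, $J\setminus I$, $I\cap J$ are all nonempty). Strong intervals ordered by inclusion form an ordered tree with leaves $\sigma_1,\dots,\sigma_k$ (the common interval decomposition tree), each internal node being the union of its children. An internal node with children $V_1,\dots,V_m$ is linear if every union of consecutive children is a common interval, and prime if no union $V_p\cup\dots\cup V_q$ with $p<q$, $(p,q)\ne(1,m)$, is a common interval; nodes of arity $2$ are considered linear. Linear nodes are labeled $+$ or $-$ according as the children's value intervals increase or decrease left to right. The expanded decomposition tree replaces each linear node with children $V_1,\dots,V_m$ and sign $s$ by the left comb $(\cdots((V_1,V_2),V_3),\dots,V_m)$ of $m-1$ binary nodes of sign $s$, and keeps prime nodes with their children. *)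

(* Defs.v *)
From mathcomp Require Import all_boot.
Set Implicit Arguments. Unset Strict Implicit. Unset Printing Implicit Defensive.

Definition is_perm (s : seq nat) : bool := perm_eq s (iota 0 (size s)).

Definition order_iso (a b : seq nat) : bool :=
  (size a == size b) &&
  all (fun i => all (fun j => (nth 0 a i < nth 0 a j) == (nth 0 b i < nth 0 b j))
                    (iota 0 (size a))) (iota 0 (size a)).

Definition is_pattern (pi sigma : seq nat) : Prop :=
  is_perm pi /\ exists u : seq nat, subseq u sigma /\ order_iso u pi.

Definition longest_common_pattern (sigma tau pi : seq nat) : Prop :=
  is_pattern pi sigma /\ is_pattern pi tau /\
  forall pi', is_pattern pi' sigma -> is_pattern pi' tau -> size pi' <= size pi.

(* A factor sigma_j ... sigma_l is represented by the pair of (0-based)    *)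
(* positions (j, l); as a set it is the set of positions {j,...,l}.        *)

Definition rng := (nat * nat)%type.

Definition in_rng (I : rng) (x : nat) : bool := (I.1 <= x) && (x <= I.2).

Definition ranges (n : nat) : seq rng :=
  [seq (i, j) | i <- iota 0 n, j <- iota i (n - i)].

Definition factor (s : seq nat) (I : rng) : seq nat :=
  [seq nth 0 s k | k <- iota I.1 (I.2 - I.1).+1].

Definition seq_min (f : seq nat) : nat := foldr minn (head 0 f) f.
Definition seq_max (f : seq nat) : nat := foldr maxn 0 f.

Definition is_int_set (f : seq nat) : bool :=
  all (fun v => v \in f) (iota (seq_min f) (seq_max f - seq_min f).+1).

Definition common_interval (s : seq nat) (I : rng) : bool :=
  (I.1 <= I.2) && (I.2 < size s) && is_int_set (factor s I).

Definition overlap (I J : rng) : bool :=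
  let X := iota 0 (maxn I.2 J.2).+1 in
  has (fun x => in_rng I x && ~~ in_rng J x) X &&
  has (fun x => in_rng J x && ~~ in_rng I x) X &&
  has (fun x => in_rng I x && in_rng J x) X.

Definition strong_interval (s : seq nat) (I : rng) : bool :=
  common_interval s I &&
  all (fun J => common_interval s J ==> ~~ overlap I J) (ranges (size s)).

Definition subr (J I : rng) : bool := (I.1 <= J.1) && (J.2 <= I.2).
Definition psubr (J I : rng) : bool := subr J I && (J != I).

Definition tree_child (s : seq nat) (I J : rng) : bool :=
  strong_interval s J && psubr J I &&
  ~~ has (fun K => strong_interval s K && psubr J K && psubr K I) (ranges (size s)).

Definition children (s : seq nat) (I : rng) : seq rng :=
  sort (fun a b : rng => a.1 <= b.1) (filter (tree_child s I) (ranges (size s))).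

Definition union_pos (Vs : seq rng) : seq nat :=
  flatten [seq iota V.1 (V.2 - V.1).+1 | V <- Vs].

Definition common_set (s : seq nat) (P : seq nat) : bool :=
  has (fun I => common_interval s I &&
                all (fun x => x \in P) (iota I.1 (I.2 - I.1).+1) &&
                all (in_rng I) P) (ranges (size s)).

Definition internal_node (s : seq nat) (I : rng) : bool :=
  strong_interval s I && (I.1 < I.2).

(* prime node: no union V_p u ... u V_q (p < q, (p,q) <> (first,last)) of
   consecutive children is a common interval; nodes of arity 2 are linear *)
Definition prime_node (s : seq nat) (I : rng) : bool :=
  let cs := children s I in
  let m := size cs in
  internal_node s I && (2 < m) &&
  all (fun p => all (fun q => ((p == 0) && (q == m.-1)) ||
                              ~~ common_set s (union_pos (take (q - p).+1 (drop p cs))))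
                    (iota p.+1 (m - p.+1)))
      (iota 0 m).

Definition arity (s : seq nat) (I : rng) : nat := size (children s I).

(* The class R: permutations whose expanded decomposition tree has all prime
   nodes of arity < d.  The expanded tree keeps the prime nodes of the
   decomposition tree (with their arity) and all its other nodes are binary
   linear nodes, so its prime nodes are exactly the prime nodes above. *)
Definition in_R (d : nat) (s : seq nat) : Prop :=
  is_perm s /\ forall I : rng, prime_node s I -> arity s I < d.

Inductive isym := I1 | Iend | Isep.

Inductive dir := DL | DR | DS.

Unset Implicit Arguments.
Record TM := {
  st : finType;
  gam : finType;
  blank : gam;
  inp : isym -> gam;
  inp_inj : injective inp;
  inp_nb : forall x, inp x != blank;
  q0 : st;
  halt : pred st;
  delta : st -> gam -> st * gam * dir
}.
Set Implicit Arguments.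

(* configuration: state, tape left of head (nearest first), symbol under head,
   tape right of head; the tape is two-way infinite, blank elsewhere *)
Definition config (M : TM) := (st M * seq (gam M) * gam M * seq (gam M))%type.

Definition tm_step (M : TM) (c : config M) : config M :=
  let '(q, l, a, r) := c in
  if halt M q then c else
  let '(q', b, dm) := delta M q a in
  match dm with
  | DS => (q', l, b, r)
  | DL => match l with
          | [::] => (q', [::], blank M, b :: r)
          | x :: l' => (q', l', x, b :: r)
          end
  | DR => match r with
          | [::] => (q', b :: l, blank M, [::])
          | x :: r' => (q', b :: l, x, r')
          end
  end.
Arguments tm_step : clear implicits.

Definition tm_init (M : TM) (w : seq isym) : config M :=
  let w' := map (inp M) w in (q0 M, [::], head (blank M) w', behead w').
Arguments tm_init : clear implicits.

Definition tm_run (M : TM) (t : nat) (w : seq isym) : config M :=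
  iter t (tm_step M) (tm_init M w).

Arguments tm_run : clear implicits.

Definition tm_output (M : TM) (c : config M) : seq (gam M) :=
  let '(_, _, a, r) := c in take (find (pred1 (blank M)) (a :: r)) (a :: r).

Definition tm_state (M : TM) (c : config M) : st M :=
  let '(q, _, _, _) := c in q.

Arguments tm_output : clear implicits.
Arguments tm_state : clear implicits.

Definition halts_with (M : TM) (w : seq isym) (t : nat) (o : seq isym) : Prop :=
  halt M (tm_state M (tm_run M t w)) /\ tm_output M (tm_run M t w) = map (inp M) o.

Definition enc_nat (x : nat) : seq isym := rcons (nseq x I1) Iend.
Definition enc_perm (s : seq nat) : seq isym := flatten (map enc_nat s).
Definition enc_pair (s t : seq nat) : seq isym := enc_perm s ++ Isep :: enc_perm t.

(* Main.v *)
Require Import Defs.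
From mathcomp Require Import all_boot.
From mathcomp Require Import zify.
From Stdlib Require Import FunctionalExtensionality.
Set Implicit Arguments. Unset Strict Implicit. Unset Printing Implicit Defensive.

(** A box is a product of an interval of positions and an interval of values. For a box of
    [sigma], a box of [tau] and a size [v], record whether some common pattern of size [v]
    occurs inside both boxes. Cutting the positions and the values of both boxes into [K]
    intervals and choosing a permutation [rho] of the [K] pieces yields smaller pairs of boxes,
    any occurrences in which assemble into an occurrence in the large pair; so the recurrence
    is sound for all permutations. It is complete for [sigma] in the class when [K] is at
    least [d] and [2]: a common interval with at least two elements is either the
    concatenation of two common intervals, or a prime node whose children, fewer than [d],
    are its maximal proper common intervals. For fixed [K] the table is polynomial, and
    saturating it takes nested bounded loops only, so that the running time of the machine
    is polynomial by the shape of the program. *)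

(** The decomposition tree is never computed: it occurs only in the proof of completeness, and the
    structure of [tau] does not occur at all. Completeness rests on the fact that disjoint common
    intervals are comparable both in position and in value, through any of their elements. A common
    pattern, paired element by element, carries both orders over to [tau], so the elements matched
    with different pieces can be separated there by straight cuts, which the program finds by
    exhaustive search. Missing pieces are padded with empty ones up to [K]. The pieces of an
    interval are shorter than it, so the length of [sigma] bounds the number of rounds needed. The
    size [v] belongs to the key so that entries are booleans; each entry also carries the set of
    positions used in [sigma], from which the pattern is printed without backtracking.

    Time is controlled through two intermediate languages, in both of which a loop is bounded by a
    quantity that cannot change while it runs. The lower one has pointers, which are marks on the
    tape; the upper one has arrays, whose addresses are computed by such loops again. *)

Definition upd (A : eqType) (B : Type) (f : A -> B) (x : A) (b : B) : A -> B :=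
  fun y => if y == x then b else f y.

Lemma upd_id (A : eqType) (B : Type) (f : A -> B) x : upd f x (f x) = f.
Proof. by apply: functional_extensionality => y; rewrite /upd; case: eqP => [->|]. Qed.

Lemma upd_upd (A : eqType) (B : Type) (f : A -> B) x b b' : upd (upd f x b) x b' = upd f x b'.
Proof. by apply: functional_extensionality => y; rewrite /upd; case: eqP. Qed.

Lemma upd_same (A : eqType) (B : Type) (f : A -> B) x b : upd f x b x = b.
Proof. by rewrite /upd eqxx. Qed.

Lemma upd_other (A : eqType) (B : Type) (f : A -> B) x b y : y != x -> upd f x b y = f y.
Proof. by rewrite /upd => /negbTE->. Qed.

(** * Composable one-tape machines *)

Section Fragments.
Variable G : finType.

(** [None] means leaving the fragment, after the symbol has been written and the head moved.
    Sequential composition therefore only redirects exits and costs no step of its own. *)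
Record fragment := Fragment {
  fstate : finType;
  fstart : fstate;
  fstep : fstate -> G -> option fstate * G * dir }.

Definition move (m : dir) (h : nat) := match m with DL => h.-1 | DR => h.+1 | DS => h end.
Definition can_move (m : dir) (h : nat) := if m is DL then 0 < h else true.

(** Tapes are total functions on the naturals. [can_move] forbids a left move from position 0, so
    only one half of the two-way infinite tape is used and the position of the head is a natural
    number. *)
Inductive runs (M : fragment) :
    fstate M -> nat -> (nat -> G) -> nat -> nat -> (nat -> G) -> Prop :=
| Runs_exit q h f b m : fstep q (f h) = (None, b, m) -> can_move m h ->
    runs q h f 1 (move m h) (upd f h b)
| Runs_step q q' h f b m t h' f' : fstep q (f h) = (Some q', b, m) -> can_move m h ->
    runs q' (move m h) (upd f h b) t h' f' -> runs q h f t.+1 h' f'.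

Definition exec (M : fragment) h f n h' f' :=
  exists2 t, t <= n & runs (fstart M) h f t h' f'.

Lemma exec_le M h f n n' h' f' : exec M h f n h' f' -> n <= n' -> exec M h f n' h' f'.
Proof. by case=> t le_tn r le_nn'; exists t => //; apply: leq_trans le_nn'. Qed.

Definition act (g : G -> G) (m : dir) : fragment :=
  @Fragment unit tt (fun _ a => (None, g a, m)).

Lemma exec_act g m h f : can_move m h -> exec (act g m) h f 1 (move m h) (upd f h (g (f h))).
Proof. by move=> ok; exists 1 => //; apply: Runs_exit. Qed.

Definition fseq (M1 M2 : fragment) : fragment :=
  @Fragment (fstate M1 + fstate M2)%type (inl (fstart M1)) (fun q a =>
    match q with
    | inl q1 => let: (o, b, m) := fstep q1 a in
        (Some (if o is Some q1' then inl q1' else inr (fstart M2)), b, m)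
    | inr q2 => let: (o, b, m) := fstep q2 a in (omap inr o, b, m)
    end).

Lemma exec_seq M1 M2 h f n1 h1 f1 n2 h2 f2 :
  exec M1 h f n1 h1 f1 -> exec M2 h1 f1 n2 h2 f2 -> exec (fseq M1 M2) h f (n1 + n2) h2 f2.
Proof.
case=> t1 le1 r1 [t2 le2 r2]; exists (t1 + t2); first exact: leq_add.
have {}r2 : runs (M := fseq M1 M2) (inr (fstart M2)) h1 f1 t2 h2 f2.
  elim: r2 => [q h3 f3 b m e ok|q q' h3 f3 b m t h' f' e ok _ IH].
    by apply: Runs_exit; rewrite /= ?e.
  by apply: (Runs_step _ _ IH); rewrite /= ?e.
rewrite [fstart (fseq _ _)]/=; elim: r1 r2 => [q h3 f3 b m e ok|q q' h3 f3 b m t h' f' e ok _ IH] r2.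
  by apply: (Runs_step _ _ r2); rewrite /= ?e.
by apply: (Runs_step _ _ (IH r2)); rewrite /= ?e.
Qed.

Definition fif (p : pred G) (M1 M2 : fragment) : fragment :=
  @Fragment (option (fstate M1 + fstate M2)) None (fun q a =>
    match q with
    | None => (Some (Some (if p a then inl (fstart M1) else inr (fstart M2))), a, DS)
    | Some (inl q1) => let: (o, b, m) := fstep q1 a in (omap (Some \o inl) o, b, m)
    | Some (inr q2) => let: (o, b, m) := fstep q2 a in (omap (Some \o inr) o, b, m)
    end).

Lemma exec_if (p : pred G) M1 M2 h f n h' f' :
  exec (if p (f h) then M1 else M2) h f n h' f' -> exec (fif p M1 M2) h f n.+1 h' f'.
Proof.
move=> e; suff [t le_tn r] : exists2 t, t <= n & runs (M := fif p M1 M2)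
    (Some (if p (f h) then inl (fstart M1) else inr (fstart M2))) h f t h' f'.
  by exists t.+1 => //; apply: Runs_step; [by []|by []|rewrite upd_id].
case: (p (f h)) e => -[t le_tn r]; exists t => //; elim: r => {t le_tn}
  [q h3 f3 b m e ok|q q' h3 f3 b m t h2 f2 e ok _ IH].
- by apply: Runs_exit; rewrite /= ?e.
- by apply: (Runs_step _ _ IH); rewrite /= ?e.
- by apply: Runs_exit; rewrite /= ?e.
- by apply: (Runs_step _ _ IH); rewrite /= ?e.
Qed.

Definition fwhile (p : pred G) (M : fragment) : fragment :=
  @Fragment (option (fstate M)) None (fun q a =>
    match q with
    | None => (if p a then Some (Some (fstart M)) else None, a, DS)
    | Some q => let: (o, b, m) := fstep q a in (Some o, b, m)
    end).

Lemma exec_while_stop (p : pred G) M h f : ~~ p (f h) -> exec (fwhile p M) h f 1 h f.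
Proof.
move=> np; exists 1 => //; have := @Runs_exit (fwhile p M) None h f (f h) DS.
by rewrite upd_id; apply; rewrite //= (negbTE np).
Qed.

Lemma exec_while (p : pred G) M h f n1 h1 f1 n2 h2 f2 :
  p (f h) -> exec M h f n1 h1 f1 -> exec (fwhile p M) h1 f1 n2 h2 f2 ->
  exec (fwhile p M) h f (n1 + n2).+1 h2 f2.
Proof.
move=> ph [t1 le1 r1] [t2 le2 r2]; exists (t1 + t2).+1; first by rewrite ltnS leq_add.
apply: Runs_step; rewrite /= ?ph //; rewrite upd_id /=.
elim: r1 r2 {ph} => [q h3 f3 b m e ok|q q' h3 f3 b m t h' f' e ok _ IH] r2.
  by apply: (Runs_step _ _ r2); rewrite /= ?e.
by apply: (Runs_step _ _ (IH r2)); rewrite /= ?e.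
Qed.

Variables (blk : G) (inpG : isym -> G).
Hypotheses (inpG_inj : injective inpG) (inpG_nb : forall x, inpG x != blk).

Definition machine (M : fragment) : TM :=
  @Build_TM (option (fstate M)) G blk inpG inpG_inj inpG_nb (Some (fstart M)) (pred1 None)
    (fun q a => if q is Some q' then fstep q' a else (None, a, DS)).

(* [nth blk] reads blanks beyond both ends of the finite tape halves, so nothing is
   required of their sizes. *)
Definition represents (M : fragment) (c : config (machine M)) q h (f : nat -> G) :=
  let: (q', l, a, r) := c in
  [/\ q' = q, a = f h, forall i, i < h -> nth blk l i = f (h.-1 - i)
    & forall i, nth blk r i = f (h.+1 + i)].

Lemma represents_step M (q : fstate M) c h f q' b m :
  represents c (Some q) h f -> fstep q (f h) = (q', b, m) -> can_move m h ->
  represents (tm_step (machine M) c) q' (move m h) (upd f h b).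
Proof.
case: c => [[[s l] a] r] [-> -> Hl Hr] e ok; rewrite /tm_step /= e.
case: m ok {e} => /= ok.
- case: h ok Hl Hr => // h _ Hl Hr.
  have H0 := Hl 0 (ltn0Sn h); rewrite /= subn0 in H0.
  have Hl' i : i < h -> nth blk (behead l) i = upd f h.+1 b (h.-1 - i).
    move=> lt_ih; rewrite nth_behead Hl // upd_other; last by lia.
    by congr (f _); lia.
  have Hr' i : nth blk (b :: r) i = upd f h.+1 b (h.+1 + i).
    case: i => [|i] /=; first by rewrite addn0 upd_same.
    by rewrite Hr upd_other ?addSnnS //; lia.
  by case: l Hl H0 Hl' => [|x l] Hl H0 Hl'; split; rewrite //= upd_other //; lia.
- have H0 := Hr 0; rewrite addn0 in H0.
  have Hl' i : i < h.+1 -> nth blk (b :: l) i = upd f h b (h - i).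
    case: i => [|i] lt_ih /=; first by rewrite subn0 upd_same.
    by rewrite upd_other ?Hl //; [congr (f _)|]; lia.
  have Hr' i : nth blk (behead r) i = upd f h b (h.+2 + i).
    by rewrite nth_behead Hr upd_other ?addSnnS //; lia.
  by case: r Hr H0 Hr' => [|x r] Hr H0 Hr'; split; rewrite //= upd_other //; lia.
- split=> //=.
  + by rewrite upd_same.
  + by move=> i lt_ih; rewrite upd_other ?Hl //; lia.
  + by move=> i; rewrite upd_other ?Hr //; lia.
Qed.

Lemma represents_runs M (q : fstate M) c h f t h' f' :
  represents c (Some q) h f -> runs q h f t h' f' ->
  represents (iter t (tm_step (machine M)) c) None h' f'.
Proof.
move=> rep r; elim: r c rep => [{}q {}h {}f b m e ok|{}q q' {}h {}f b m {}t {}h' {}f' e ok _ IH] c rep.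
  exact: represents_step rep e ok.
by rewrite iterSr; apply: IH; apply: represents_step rep e ok.
Qed.

Definition input_tape (w : seq isym) : nat -> G :=
  fun i => if i is i'.+1 then nth blk (map inpG w) i' else blk.

(** The first blank of [s] is the one behind [t], as no input symbol is blank. Cells further on are
    left free, since the machine leaves its working tracks there. *)
Lemma take_find_blank (s : seq G) (t : seq isym) :
  (forall i, nth blk s i = nth blk (map inpG t) i \/ i > size t) -> 
  nth blk s (size t) = blk ->
  take (find (pred1 blk) s) s = map inpG t.
Proof.
elim: s t => [|a s IH] [|x t] //= H E.
- by have [/eqP|//] := H 0; rewrite /= eq_sym (negbTE (inpG_nb x)).
- by rewrite E eqxx.
- have [/= ->|//] := H 0; rewrite (negbTE (inpG_nb x)) /= (IH t) // => i.
  exact: H i.+1.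
Qed.

Lemma machine_halts M w n h f o :
  exec M 1 (input_tape w) n h f ->
  (forall i, i < size o -> f (h + i) = nth blk (map inpG o) i) ->
  f (h + size o) = blk ->
  exists2 t, t <= n & halts_with (machine M) w t o.
Proof.
case=> t le_tn r Ho Hb; exists t => //.
have rep : represents (tm_init (machine M) w) (Some (fstart M)) 1 (input_tape w).
  rewrite /represents /tm_init /=; split=> //; first by move=> i _; rewrite nth_nil.
  by move=> i; rewrite nth_behead.
have := represents_runs rep r; rewrite /halts_with /tm_run.
case: (iter _ _ _) => [[[q l] a] r'] [-> ea _ er] /=; split=> //.
have nthE i : nth blk (a :: r') i = f (h + i).
  by case: i => [|i]; rewrite ?addn0 //= er addSnnS.
apply: (@take_find_blank (a :: r')); last by rewrite nthE.
move=> i; rewrite nthE; case: (ltngtP i (size o)) => [/Ho->|gt|->]; [by left|by right|left].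
by rewrite Hb nth_default // size_map.
Qed.

End Fragments.
(** * Pointers and bits on one tape *)

Record pstate := PState { ptr : nat -> nat; bits : nat -> nat -> bool }.

Inductive pcmd :=
| PSkip
| PSeq of pcmd & pcmd
| PSet of nat & nat & bool
| PIf of nat & nat & pcmd & pcmd
| PIfEq of nat & nat & pcmd & pcmd
| PInc of nat
| PReset of nat
| PFor of nat & nat & pcmd.

Definition loop (S : Type) (f : S -> nat -> S) (s : S) (n : nat) : S := foldl f s (iota 0 n.+1).
Arguments loop : simpl never.

Definition set_ptr s p i := PState (upd (ptr s) p i) (bits s).

(* [PFor p q c] runs [c] with pointer [p] at the positions [0], ..., [ptr q], both included. *)
Fixpoint psem (c : pcmd) (s : pstate) : pstate :=
  match c with
  | PSkip => s
  | PSeq c1 c2 => psem c2 (psem c1 s)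
  | PSet a p b => PState (ptr s) (upd (bits s) a (upd (bits s a) (ptr s p) b))
  | PIf a p c1 c2 => if bits s a (ptr s p) then psem c1 s else psem c2 s
  | PIfEq p q c1 c2 => if ptr s p == ptr s q then psem c1 s else psem c2 s
  | PInc p => set_ptr s p (ptr s p).+1
  | PReset p => set_ptr s p 0
  | PFor p q c => loop (fun s' i => psem c (set_ptr s' p i)) s (ptr s q)
  end.

(* [G] lists the pointers that must not move: only these may bound a loop. *)
Fixpoint pwf (G : seq nat) (c : pcmd) : bool :=
  match c with
  | PSeq c1 c2 | PIf _ _ c1 c2 | PIfEq _ _ c1 c2 => pwf G c1 && pwf G c2
  | PInc p | PReset p => p \notin G
  | PFor p q c => [&& q \in G, p \notin G & pwf (p :: G) c]
  | _ => true
  end.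

Fixpoint psize (c : pcmd) : nat :=
  match c with
  | PSkip => 0
  | PSeq c1 c2 => maxn (psize c1) (psize c2)
  | PSet a p _ => maxn a.+1 p.+1
  | PIf a p c1 c2 => maxn (maxn a.+1 p.+1) (maxn (psize c1) (psize c2))
  | PIfEq p q c1 c2 => maxn (maxn p.+1 q.+1) (maxn (psize c1) (psize c2))
  | PInc p | PReset p => p.+1
  | PFor p q c => maxn (maxn p.+1 q.+1) (psize c)
  end.

(** One measure serves twice: up to a factor it bounds the running time, and it bounds how far a
    pointer can advance, hence how far the head has to walk. *)
Fixpoint pcost (N : nat) (c : pcmd) : nat :=
  match c with
  | PSeq c1 c2 => pcost N c1 + pcost N c2
  | PIf _ _ c1 c2 | PIfEq _ _ c1 c2 => (pcost N c1 + pcost N c2).+1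
  | PFor p q c => N.+1 * (pcost N c).+2
  | _ => 1
  end.

(** [N] enters only through one factor per loop, so the degree is fixed by the program text. *)
Lemma pcost_poly c : exists a b, forall N, pcost N c <= a * N.+1 ^ b.
Proof.
have one : exists a b, forall N, 1 <= a * N.+1 ^ b by exists 1, 0.
have add c1 c2 : (exists a b, forall N, pcost N c1 <= a * N.+1 ^ b) ->
    (exists a b, forall N, pcost N c2 <= a * N.+1 ^ b) ->
    exists a b, forall N, (pcost N c1 + pcost N c2).+1 <= a * N.+1 ^ b.
  move=> [a1 [b1 H1]] [a2 [b2 H2]]; exists (a1 + a2 + 1), (b1 + b2) => N.
  rewrite -addn1 !mulnDl leq_add ?leq_add //.
  - by apply: leq_trans (H1 N) _; rewrite leq_mul // leq_pexp2l // leq_addr.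
  - by apply: leq_trans (H2 N) _; rewrite leq_mul // leq_pexp2l // leq_addl.
  - by rewrite mul1n expn_gt0.
elim: c => //= [c1 IH1 c2 IH2|_ _ c1 IH1 c2 IH2|_ _ c1 IH1 c2 IH2|_ _ c [a [b IH]]];
  try exact: add.
  have [a [b H]] := add _ _ IH1 IH2; exists a, b => N; exact: ltnW (H N).
exists (a + 2), b.+1 => N; rewrite expnS mulnCA leq_mul // -addn2 mulnDl leq_add //.
by rewrite -{1}[2]muln1 leq_mul // expn_gt0.
Qed.

Lemma psem_ptr G c s x : pwf G c -> x \in G -> ptr (psem c s) x = ptr s x.
Proof.
elim: c G s x => //= [c1 IH1 c2 IH2|a p c1 IH1 c2 IH2|p q c1 IH1 c2 IH2|p|p|p q c IH] G s x.
- by case/andP=> w1 w2 xG; rewrite (IH2 G) ?(IH1 G).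
- by case/andP=> w1 w2 xG; case: ifP => _; [apply: IH1 xG|apply: IH2 xG].
- by case/andP=> w1 w2 xG; case: ifP => _; [apply: IH1 xG|apply: IH2 xG].
- by move=> pG xG; apply: upd_other; apply: contraNneq pG => <-.
- by move=> pG xG; apply: upd_other; apply: contraNneq pG => <-.
- case/and3P=> _ pG wc xG; rewrite /loop; move: (iota _ _) => l; elim: l s => //= i l IHl s.
  rewrite IHl (IH (p :: G)) ?inE ?xG ?orbT //.
  by apply: upd_other; apply: contraNneq pG => <-.
Qed.

Lemma psem_ptr_le G N c s x : pwf G c -> (forall y, y \in G -> ptr s y <= N) ->
  ptr (psem c s) x <= ptr s x + pcost N c.
Proof.
elim: c G s x => //= [|c1 IH1 c2 IH2|a p b|a p c1 IH1 c2 IH2|p q c1 IH1 c2 IH2|p|p|p q c IH] G s x.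
- by move=> _ _; rewrite leq_addr.
- case/andP=> w1 w2 GN; have := IH1 G s x w1 GN.
  have := IH2 G (psem c1 s) x w2; set u := ptr _ x; set v := ptr _ x.
  move=> H1 H2; have: u <= v + pcost N c2.
    by apply: H1 => y yG; rewrite (psem_ptr _ w1) ?GN.
  by lia.
- by move=> _ _; rewrite leq_addr.
- case/andP=> w1 w2 GN; case: ifP => _.
    by have := IH1 G s x w1 GN; lia.
  by have := IH2 G s x w2 GN; lia.
- case/andP=> w1 w2 GN; case: ifP => _.
    by have := IH1 G s x w1 GN; lia.
  by have := IH2 G s x w2 GN; lia.
- by move=> _ _; rewrite /upd; case: eqP => [->|]; lia.
- by move=> _ _; rewrite /upd; case: eqP => [->|]; lia.
- case/and3P=> qG pG wc GN; have leN := GN q qG.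
  (* The maximum with [N] is there because the loop pointer is overwritten by values up to [N],
     whatever it was before. *)
  suff H l t : all (leq^~ N) l -> (forall y, y \in G -> ptr t y <= N) ->
      ptr (foldl (fun s' i => psem c (set_ptr s' p i)) t l) x <=
      maxn (ptr t x) N + size l * pcost N c.
    have lN : all (leq^~ N) (iota 0 (ptr s q).+1).
      by apply/allP=> i; rewrite mem_iota /= add0n ltnS => /leq_trans; apply.
    apply: leq_trans (H _ s lN GN) _.
    rewrite size_iota; have : (ptr s q).+1 * pcost N c <= N.+1 * pcost N c.
      by rewrite leq_mul2r ltnS leN orbT.
    by lia.
  elim: l t => [|i l IHl] t /=; first by lia.
  case/andP=> iN lN tN; set t' := psem c _.
  have wN y : y \in p :: G -> ptr (set_ptr t p i) y <= N.
    by rewrite inE /= /upd; case: eqP => //= _; apply: tN.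
  have t'x : ptr t' x <= maxn (ptr t x) N + pcost N c.
    by apply: leq_trans (IH _ _ _ wc wN) _; rewrite leq_add2r /= /upd; case: eqP; lia.
  have t'N y : y \in G -> ptr t' y <= N.
    by move=> yG; rewrite (psem_ptr _ wc) ?wN // inE yG orbT.
  have := IHl t' lN t'N; lia.
Qed.

Section CompileP.
Variable K : nat.

(** A flag singles out the leftmost cell; then come one mark per pointer and one bit per array. A
    pointer is thus a mark that occurs in a single cell. *)
Definition cellT : finType := (bool * K.-tuple bool * K.-tuple bool)%type.
Definition cell (h : bool) (m d : nat -> bool) : cellT :=
  (h, [tuple of mkseq m K], [tuple of mkseq d K]).
Definition is_home (g : cellT) : bool := g.1.1.
Definition mark (g : cellT) (x : nat) : bool := nth false g.1.2 x.
Definition datum (g : cellT) (a : nat) : bool := nth false g.2 a.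

Lemma mark_cell h m d x : x < K -> mark (cell h m d) x = m x.
Proof. by move=> ltxK; rewrite /mark /= nth_mkseq. Qed.

Lemma datum_cell h m d x : x < K -> datum (cell h m d) x = d x.
Proof. by move=> ltxK; rewrite /datum /= nth_mkseq. Qed.

Lemma eq_cell h m d m' d' : (forall x, x < K -> m x = m' x) ->
  (forall x, x < K -> d x = d' x) -> cell h m d = cell h m' d'.
Proof.
move=> em ed; congr (_, _, _); apply: val_inj; apply/eq_in_map => x; rewrite mem_iota /=.
- exact: em.
- exact: ed.
Qed.

Definition tape_of (s : pstate) (i : nat) : cellT :=
  cell (i == 0) (fun x => ptr s x == i) (bits s ^~ i).

Definition set_mark p b (g : cellT) := cell (is_home g) (upd (mark g) p b) (datum g).
Definition set_datum a b (g : cellT) := cell (is_home g) (mark g) (upd (datum g) a b).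

Definition go_home := fwhile (fun g => ~~ is_home g) (act id DL).
Definition find_ptr p := fwhile (fun g => ~~ mark g p) (act id DR).

Definition finc p := fseq (find_ptr p) (fseq (act (set_mark p false) DR)
  (fseq (act (set_mark p true) DS) go_home)).
Definition freset p := fseq (find_ptr p) (fseq (act (set_mark p false) DS)
  (fseq go_home (act (set_mark p true) DS))).

(** Every command starts and ends on the home cell. A loop tests for its end after the body, on the
    cell of [p], by looking for the mark of [q] there. In a program accepted by [pwf] the body moves
    neither [p] nor [q], so [p] advances cell by cell and the test succeeds exactly at the last
    turn. *)
Fixpoint pcompile (c : pcmd) : fragment cellT :=
  match c with
  | PSkip => act id DS
  | PSeq c1 c2 => fseq (pcompile c1) (pcompile c2)
  | PSet a p b => fseq (find_ptr p) (fseq (act (set_datum a b) DS) go_home)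
  | PIf a p c1 c2 => fseq (find_ptr p) (fif (fun g => datum g a)
      (fseq go_home (pcompile c1)) (fseq go_home (pcompile c2)))
  | PIfEq p q c1 c2 => fseq (find_ptr p) (fif (fun g => mark g q)
      (fseq go_home (pcompile c1)) (fseq go_home (pcompile c2)))
  | PInc p => finc p
  | PReset p => freset p
  | PFor p q c => fseq (freset p) (fseq (pcompile c) (fseq (find_ptr p)
      (fseq (fwhile (fun g => ~~ mark g q)
        (fseq go_home (fseq (finc p) (fseq (pcompile c) (find_ptr p))))) go_home)))
  end.

Lemma exec_go_home f h : (forall i, is_home (f i) = (i == 0)) ->
  exec go_home h f (h.*2).+1 0 f.
Proof.
move=> Hf; elim: h => [|h IH]; first by apply: exec_while_stop; rewrite Hf.
rewrite doubleS; apply: (@exec_while _ _ _ _ _ 1 h f _ _ _ _ _ IH); first by rewrite Hf.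
by rewrite -{2}(upd_id f h.+1); apply: exec_act.
Qed.

Lemma exec_find p s : p < K -> exec (find_ptr p) 0 (tape_of s) ((ptr s p).*2).+1 (ptr s p) (tape_of s).
Proof.
move=> pK; suff H j : j <= ptr s p ->
    exec (find_ptr p) (ptr s p - j) (tape_of s) (j.*2).+1 (ptr s p) (tape_of s).
  by have := H _ (leqnn _); rewrite subnn.
elim: j => [|j IH] lt_j.
  by rewrite subn0; apply: exec_while_stop; rewrite /tape_of mark_cell ?eqxx.
rewrite doubleS; apply: (@exec_while _ _ _ _ _ 1 _ _ _ _ _ _ _ (IH (ltnW lt_j))).
  by rewrite /tape_of mark_cell //; lia.
rewrite -{2}(upd_id (tape_of s) (ptr s p - j.+1)) -[ptr s p - j](_ : (ptr s p - j.+1).+1 = _).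
  exact: exec_act.
by lia.
Qed.

Lemma upd_tape_home s h g : is_home g = (h == 0) -> 
  forall i, is_home (upd (tape_of s) h g i) = (i == 0).
Proof. by move=> e i; rewrite /upd; case: eqP => [->|]. Qed.

Lemma exec_inc p s : p < K ->
  exec (finc p) 0 (tape_of s) ((ptr s p).*2.*2 + 6) 0 (tape_of (set_ptr s p (ptr s p).+1)).
Proof.
move=> pK.
rewrite (_ : _ + 6 = (ptr s p).*2.+1 + (1 + (1 + (ptr s p).+1.*2.+1))); last by lia.
apply: exec_seq (exec_find s pK) _; apply: exec_seq (exec_act _ _ _) _ => //=.
apply: exec_seq (exec_act _ _ _) _ => //=.
set f := upd _ _ _; set f' := tape_of _.
suff -> : f = f' by apply: exec_go_home.
apply: functional_extensionality => i; rewrite /f /f' /upd {f f'}.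
case: (eqVneq i (ptr s p).+1) => [->|ni].
  rewrite ifN; last by rewrite neq_ltn leqnn orbT.
  apply: eq_cell => x xK; rewrite /= /upd.
    by case: eqP => _; rewrite ?eqxx // /tape_of mark_cell.
  by rewrite /tape_of datum_cell.
case: eqP => [->|n2].
  apply: eq_cell => x xK; rewrite /= /upd.
    by case: (eqVneq x p) => _; [lia|rewrite /tape_of mark_cell].
  by rewrite /tape_of datum_cell.
by apply: eq_cell => x xK //=; rewrite /upd; case: (eqVneq x p) => // ->; lia.
Qed.

Lemma exec_reset p s : p < K ->
  exec (freset p) 0 (tape_of s) ((ptr s p).*2.*2 + 6) 0 (tape_of (set_ptr s p 0)).
Proof.
move=> pK; apply: (@exec_le _ _ _ _ ((ptr s p).*2.+1 + (1 + ((ptr s p).*2.+1 + 1)))); last by lia.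
apply: exec_seq (exec_find s pK) _; apply: exec_seq (exec_act _ _ _) _ => //=.
apply: exec_seq (exec_go_home _ _) _; first exact: upd_tape_home.
set f := upd _ _ _; rewrite -(_ : upd f 0 (set_mark p true (f 0)) = tape_of _).
  exact: exec_act.
apply: functional_extensionality => i; rewrite /f /upd {f}.
case: (eqVneq i 0) => [->|ni].
  case: eqP => [e|ne]; rewrite -?e; apply: eq_cell => x xK /=; rewrite /upd.
  - case: (eqVneq x p) => // nxp.
    by rewrite /set_mark mark_cell // /upd (negbTE nxp) /tape_of mark_cell.
  - by rewrite /set_mark datum_cell // /tape_of datum_cell.
  - by case: (eqVneq x p) => // nxp; rewrite /tape_of mark_cell.
  - by rewrite /tape_of datum_cell.
case: (eqVneq i (ptr s p)) ni => [-> ni|n2 ni].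
  apply: eq_cell => x xK; rewrite /= /upd.
    by case: (eqVneq x p) => _; [lia|rewrite /tape_of mark_cell].
  by rewrite /tape_of datum_cell.
by apply: eq_cell => x xK //=; rewrite /upd; case: (eqVneq x p) => // ->; lia.
Qed.

Lemma exec_set a p b s : p < K -> a < K ->
  exec (pcompile (PSet a p b)) 0 (tape_of s) ((ptr s p).*2.*2 + 6) 0 (tape_of (psem (PSet a p b) s)).
Proof.
move=> pK aK; apply: (@exec_le _ _ _ _ ((ptr s p).*2.+1 + (1 + ((ptr s p).*2.+1)))); last by lia.
apply: exec_seq (exec_find s pK) _; apply: exec_seq (exec_act _ _ _) _ => //=.
set f := upd _ _ _; set f' := tape_of _.
suff -> : f = f' by apply: exec_go_home.
apply: functional_extensionality => i; rewrite /f /f' /upd {f f'}.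
case: eqP => [->|ni]; apply: eq_cell => x xK //=.
- by rewrite /tape_of mark_cell.
- by rewrite /upd; case: eqP => // _; rewrite ?eqxx /tape_of ?datum_cell.
- by case: eqP => // ->; case: eqP.
Qed.

(** [M] bounds all positions reached during the run, as pointers grow by at most the cost. An
    elementary command walks to a pointer and back a bounded number of times, hence the factor
    [4 * M + 10]. *)
Lemma exec_pcompile G N M c s : psize c <= K -> pwf G c -> (forall x, x \in G -> ptr s x <= N) ->
  (forall x, ptr s x + pcost N c <= M) ->
  exec (pcompile c) 0 (tape_of s) (pcost N c * (4 * M + 10)) 0 (tape_of (psem c s)).
Proof.
elim: c G s => [|c1 IH1 c2 IH2|a p b|a p c1 IH1 c2 IH2|p q c1 IH1 c2 IH2|p|p|p q c IH] G s /=.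
- move=> _ _ _ _; rewrite -{2}(upd_id (tape_of s) 0); apply: exec_le (exec_act _ _ _) _ => //; lia.
- rewrite geq_max => /andP[k1 k2] /andP[w1 w2] GN HM.
  rewrite mulnDl; apply: exec_seq; [apply: (IH1 G)|apply: (IH2 G)] => //.
  + by move=> x; have := HM x; lia.
  + by move=> x xG; rewrite (psem_ptr _ w1) ?GN.
  + by move=> x; have := HM x; have := psem_ptr_le x w1 GN; lia.
- rewrite geq_max => /andP[k1 k2] _ _ HM; apply: exec_le (exec_set _ _ _ _) _ => //.
  by have := HM p; lia.
- rewrite !geq_max => /andP[/andP[k1 k2] /andP[k3 k4]] /andP[w1 w2] GN HM.
  have Hp := HM p; apply: (@exec_le _ _ _ _ ((ptr s p).*2.+1 +
    ((ptr s p).*2.+1 + ((pcost N c1 + pcost N c2) * (4 * M + 10))).+1)); last by lia.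
  apply: exec_seq (exec_find s k2) _; apply: exec_if.
  rewrite {1}/tape_of datum_cell // mulnDl; case: ifP => _; apply: exec_seq (exec_go_home _ _) _ => //.
  + by apply: exec_le (leq_addr _ _); apply: IH1 w1 GN _ => // x; have := HM x; lia.
  + by apply: exec_le (leq_addl _ _); apply: IH2 w2 GN _ => // x; have := HM x; lia.
- rewrite !geq_max => /andP[/andP[k1 k2] /andP[k3 k4]] /andP[w1 w2] GN HM.
  have Hp := HM p; apply: (@exec_le _ _ _ _ ((ptr s p).*2.+1 +
    ((ptr s p).*2.+1 + ((pcost N c1 + pcost N c2) * (4 * M + 10))).+1)); last by lia.
  apply: exec_seq (exec_find s k1) _; apply: exec_if.
  rewrite {1}/tape_of mark_cell // mulnDl eq_sym; case: ifP => _; apply: exec_seq (exec_go_home _ _) _ => //.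
  + by apply: exec_le (leq_addr _ _); apply: IH1 w1 GN _ => // x; have := HM x; lia.
  + by apply: exec_le (leq_addl _ _); apply: IH2 w2 GN _ => // x; have := HM x; lia.
- by move=> k1 _ _ HM; apply: exec_le (exec_inc _ _) _ => //; have := HM p; lia.
- by move=> k1 _ _ HM; apply: exec_le (exec_reset _ _) _ => //; have := HM p; lia.
rewrite !geq_max => /andP[/andP[pK qK] cK] /and3P[qG pG wc] GN HM.
set k := pcost N c; set L := 4 * M + 10; set e := ptr s q.
have neq_qp : q != p by apply: contraNneq pG => <-.
have eN : e <= N := GN q qG.
have GN' t i : i <= N -> (forall x, x \in G -> ptr t x <= N) ->
    forall x, x \in p :: G -> ptr (set_ptr t p i) x <= N.
  by move=> iN tN x; rewrite inE /= /upd; case: eqP => //= _; apply: tN.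
have HM' x : ptr s x + k + N * k.+1 <= M.
  by have := HM x; rewrite -/k mulSn !mulnS; lia.
pose body t i := psem c (set_ptr t p i).
have bodyG t i x : x \in G -> ptr (body t i) x = ptr t x.
  move=> xG; rewrite (psem_ptr _ wc) /= ?inE ?xG ?orbT // upd_other //.
  by apply: contraNneq pG => <-.
have bodyp t i : ptr (body t i) p = i by rewrite (psem_ptr _ wc) /= ?mem_head ?upd_same.
have bodyE t i : i <= N -> (forall x, x \in G -> ptr t x <= N) ->
    (forall x, ptr (set_ptr t p i) x + k <= M) ->
    exec (pcompile c) 0 (tape_of (set_ptr t p i)) (k * L) 0 (tape_of (body t i)).
  by move=> iN tN tM; apply: (IH (p :: G)) => //; apply: GN'.
(* [j] counts the turns left. Each turn may raise a pointer by [k.+1], of which one is for the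
   advance of [p]. *)
have loopE j t : (forall x, x \in G -> ptr t x <= N) -> ptr t q = e -> j <= e ->
    ptr t p = e - j -> (forall x, ptr t x + j * k.+1 <= M) ->
    exec (fwhile (fun g => ~~ mark g q)
      (fseq go_home (fseq (finc p) (fseq (pcompile c) (find_ptr p)))))
      (ptr t p) (tape_of t) (j * (k.+2 * L)).+1 e
      (tape_of (foldl body t (iota (ptr t p).+1 j))).
  elim: j t => [|j IHj] t tN tq lt_je tp tM.
    rewrite tp subn0; apply: exec_while_stop.
    by rewrite {1}/tape_of mark_cell // negbK tq.
  have Mp := tM p; set i := (ptr t p).+1.
  have iN : i <= N by rewrite /i; lia.
  have i1M x : ptr (set_ptr t p i) x + k + j * k.+1 <= M.
    by have := tM x; rewrite /= /upd /i mulSn; case: eqP => [->|]; lia.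
  have bM x : ptr (body t i) x + j * k.+1 <= M.
    by have := psem_ptr_le x wc (GN' t i iN tN); have := i1M x; rewrite -/k -/(body t i); lia.
  apply: (@exec_le _ _ _ _ (((ptr t p).*2.+1 + (((ptr t p).*2.*2 + 6) +
    (k * L + i.*2.+1))) + (j * (k.+2 * L)).+1).+1); last first.
    by have := i1M p; rewrite /= upd_same mulSn !mulSn /L /i; lia.
  apply: (@exec_while _ _ _ _ _ _ i (tape_of (body t i))).
  - by rewrite {1}/tape_of mark_cell // tq tp; lia.
  - apply: exec_seq (exec_go_home _ _) _ => //; apply: exec_seq (exec_inc _ pK) _.
    apply: exec_seq (bodyE _ _ iN tN _) _ => [x|]; first by have := i1M x; lia.
    by have := exec_find (body t i) pK; rewrite bodyp.
  - have := IHj (body t i); rewrite bodyp bodyG //; apply=> //; try by rewrite /i; lia.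
    by move=> x xG; rewrite bodyG ?tN.
apply: (@exec_le _ _ _ _ (((ptr s p).*2.*2 + 6) + (k * L + (1 + ((e * (k.+2 * L)).+1 + e.*2.+1))))).
  apply: exec_seq (exec_reset _ pK) _; apply: exec_seq (bodyE _ _ _ GN _) _ => // [x|].
    by have := HM' x; rewrite /= /upd; case: eqP => _; lia.
  have F0 := exec_find (body s 0) pK; rewrite bodyp in F0.
  apply: exec_seq F0 _; apply: exec_seq.
    have := loopE e (body s 0); rewrite bodyp subnn bodyG //; apply => //.
    + by move=> x xG; rewrite bodyG ?GN.
    + move=> x; have := psem_ptr_le x wc (GN' s 0 isT GN).
      rewrite -/k -/(body s 0); have := HM' x.
      have : e * k.+1 <= N * k.+1 by rewrite leq_mul2r eN orbT.
      by rewrite /= /upd; case: eqP => _; lia.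
  exact: exec_go_home.
have : e * (k.+2 * L) <= N * (k.+2 * L) by rewrite leq_mul2r eN orbT.
have := HM' p; rewrite -mulnA mulSn; set X := N * (k.+2 * L); rewrite !mulSn /L; lia.
Qed.

End CompileP.

(** * Input and output conventions of the pointer programs *)

Definition code (x : isym) : nat := match x with I1 => 0 | Iend => 1 | Isep => 2 end.

Lemma code_inj : injective code.
Proof. by do 2!case. Qed.

Lemma code_lt3 x : code x < 3.
Proof. by case: x. Qed.

(* The head starts on the first input symbol; one more cell to its left serves as home,
   so that input symbol [i] sits at position [i.+1]. *)
Definition init_pstate (b : nat) (w : seq isym) : pstate :=
  PState (fun x => if x == b then (size w).+1 else 0)
    (fun a i => if i is j.+1 then (j < size w) && (code (nth I1 w j) == a) else false).

Definition outputs (s : pstate) (o : seq isym) := forall a i, a < 3 ->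
  bits s (3 + a) i.+1 = (i < size o) && (code (nth I1 o i) == a).

Section Wrap.
Variables (K : nat) (K6 : 6 <= K).

Definition blank_cell : cellT K := cell K false (fun _ => false) (fun _ => false).
(** The only bit set is the one in track [code x], so the raw input is already the tape of
    [init_pstate], apart from the home cell and the cell behind the input. *)
Definition input_cell (x : isym) : cellT K := cell K false (fun _ => false) (pred1 (code x)).

Lemma input_cell_inj : injective input_cell.
Proof.
move=> x y /(congr1 (fun g => datum g (code x))); rewrite !datum_cell /= ?eqxx.
- by move/esym/eqP/code_inj.
- by have := code_lt3 x; lia.
- by have := code_lt3 x; lia.
Qed.

Lemma input_cell_neq_blank x : input_cell x != blank_cell.
Proof.
apply/eqP => /(congr1 (fun g => datum g (code x))); rewrite !datum_cell /= ?eqxx //.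
- by have := code_lt3 x; lia.
- by have := code_lt3 x; lia.
Qed.

(** All pointers are put on the new home cell except [b], which goes to the first blank behind the
    input: this is how the length of the input becomes available as a loop bound. *)
Definition prologue (b : nat) : fragment (cellT K) :=
  fseq (act id DL) (fseq (act (fun _ => cell K true (predC1 b) (fun _ => false)) DR)
    (fseq (fwhile (predC1 blank_cell) (act id DR))
      (fseq (act (fun _ => cell K false (pred1 b) (fun _ => false)) DS) (go_home K)))).

Lemma exec_prologue b w : b < K -> exec (prologue b) 1 (input_tape blank_cell input_cell w)
  (4 * size w + 10) 0 (tape_of K (init_pstate b w)).
Proof.
move=> bK; apply: (@exec_le _ _ _ _ (1 + (1 + ((size w).*2.+1 + (1 + (size w).+1.*2.+1))))); last by lia.
apply: exec_seq (exec_act _ _ _) _ => //; apply: exec_seq (exec_act _ _ _) _ => //=.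
rewrite upd_id; set f := upd _ _ _.
have fE i : i < size w -> f i.+1 = input_cell (nth I1 w i).
  by move=> lt_iw; rewrite /f upd_other //= (nth_map I1).
have fB : f (size w).+1 = blank_cell by rewrite /f upd_other //= nth_default // size_map.
apply: (@exec_seq _ _ _ _ _ _ (size w).+1 f).
  suff H j : j <= size w -> exec (fwhile (predC1 blank_cell) (act id DR))
      (size w - j).+1 f (j.*2).+1 (size w).+1 f by have := H _ (leqnn _); rewrite subnn.
  elim: j => [|j IH] lt_j; first by rewrite subn0; apply: exec_while_stop; rewrite fB /= eqxx.
  rewrite doubleS; apply: (@exec_while _ _ _ _ _ 1 _ _ _ _ _ _ _ (IH (ltnW lt_j))).
    by rewrite /= fE ?input_cell_neq_blank //; lia.
  rewrite -{2}(upd_id f (size w - j.+1).+1) (_ : (size w - j).+1 = (size w - j.+1).+2); last by lia.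
  exact: exec_act.
apply: exec_seq (exec_act _ _ _) _ => //=; set f' := upd f _ _.
suff -> : f' = tape_of K (init_pstate b w) by apply: exec_go_home.
apply: functional_extensionality => i; rewrite /f' /upd.
case: (eqVneq i (size w).+1) => [->|ni].
  apply: eq_cell => x xK /=; last by rewrite ltnn.
  by case: (x == b); rewrite ?eqxx.
case: (ltnP i (size w).+1) => iw.
  case: i iw ni => [_ _|i lt_iw _]; rewrite ?fE //.
    by apply: eq_cell => x xK //=; case: (x == b).
  apply: eq_cell => x xK //=; last by rewrite -ltnS lt_iw eq_sym.
  by case: (x == b) => //; lia.
rewrite /f upd_other; last by lia.
case: i iw ni => // i iw ni; rewrite /= nth_default ?size_map; last by lia.
apply: eq_cell => x xK /=; last by rewrite (_ : i < size w = false) //; lia.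
by case: (x == b) => //; lia.
Qed.

Definition decode_cell (g : cellT K) : cellT K :=
  if datum g 3 then input_cell I1 else if datum g 4 then input_cell Iend else input_cell Isep.

(** Output cells also carry marks and other arrays, so each is overwritten by a genuine input
    symbol. The cell behind them is blanked, since the output of a machine ends at its first
    blank. *)
Definition epilogue : fragment (cellT K) :=
  fseq (act id DR) (fseq
    (fwhile (fun g => [|| datum g 3, datum g 4 | datum g 5]) (act decode_cell DR))
    (fseq (act (fun _ => blank_cell) DS) (fseq (go_home K) (act id DR)))).

Lemma exec_epilogue s o : outputs s o ->
  exists2 f, exec epilogue 0 (tape_of K s) (4 * size o + 10) 1 f &
    (forall i, i < size o -> f i.+1 = input_cell (nth I1 o i)) /\ f (size o).+1 = blank_cell.
Proof.
move=> Ho.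
(* The tape after the first [k] output cells have been decoded. *)
pose F k i := if 0 < i <= k then input_cell (nth I1 o i.-1) else tape_of K s i.
have F0 : F 0 = tape_of K s by apply: functional_extensionality => -[|i].
pose F' := upd (F (size o)) (size o).+1 blank_cell.
exists F'; last first.
  split; last by rewrite /F' upd_same.
  by move=> i lt_i; rewrite /F' upd_other; [rewrite /F /= lt_i|lia].
apply: (@exec_le _ _ _ _ (1 + ((size o).*2.+1 + (1 + ((size o).+1.*2.+1 + 1))))); last by lia.
apply: exec_seq (exec_act _ _ _) _ => //=; rewrite upd_id -F0.
apply: (@exec_seq _ _ _ _ _ _ (size o).+1 (F (size o))).
  suff H j : j <= size o ->
      exec (fwhile (fun g => [|| datum g 3, datum g 4 | datum g 5]) (act decode_cell DR))
        (size o - j).+1 (F (size o - j)) (j.*2).+1 (size o).+1 (F (size o)).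
    by have := H _ (leqnn _); rewrite subnn.
  elim: j => [|j IH] lt_j.
    rewrite subn0; apply: exec_while_stop; rewrite /F /= ltnn /tape_of.
    by rewrite !datum_cell ?(Ho 0) ?(Ho 1) ?(Ho 2) ?ltnn //; lia.
  set i := size o - j.+1.
  have iE : size o - j = i.+1 by rewrite /i; lia.
  have lt_i : i < size o by rewrite /i; lia.
  have FiE a : a < 3 -> datum (F i i.+1) (3 + a) = (code (nth I1 o i) == a).
    by move=> a3; rewrite /F /= ltnn datum_cell ?Ho ?lt_i //; lia.
  rewrite doubleS; apply: (@exec_while _ _ _ _ _ 1 _ _ _ _ _ _ _ (IH (ltnW lt_j))).
    by rewrite (FiE 0) // (FiE 1) // (FiE 2) //; case: (nth _ _ _).
  rewrite iE (_ : F i.+1 = upd (F i) i.+1 (decode_cell (F i i.+1))); first exact: exec_act.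
  apply: functional_extensionality => k; rewrite /decode_cell (FiE 0) // (FiE 1) //.
  rewrite /upd; case: (eqVneq k i.+1) => [->|nk].
    by rewrite /F /= leqnn; case: (nth _ _ _).
  by rewrite /F (leq_eqVlt k i.+1) (negbTE nk).
apply: exec_seq (exec_act _ _ _) _ => //=; rewrite -/F'.
apply: exec_seq (exec_go_home _ _) _ => [i|].
  rewrite /F' /F /upd; case: eqP => [->|_] //; case: ifP => //.
  by case: i.
rewrite -{2}(upd_id F' 0); exact: exec_act.
Qed.

End Wrap.

(** Asking for a pointer at or beyond the length of the output bounds that length by the cost, and
    with it the time spent on decoding. *)
Lemma pcmd_machine b G c : pwf G c ->
  exists (M : TM) (a k : nat), forall w o,
    let s := psem c (init_pstate b w) in
    outputs s o -> (exists x, size o <= ptr s x) ->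
    exists2 t, t <= a * size w ^ k + a & halts_with M w t o.
Proof.
move=> wf; pose K := maxn 6 (maxn b.+1 (psize c)).
have K6 : 6 <= K by rewrite /K; lia.
have bK : b < K by rewrite /K; lia.
have cK : psize c <= K by rewrite /K; lia.
have [a1 [b1 Ha]] := pcost_poly c.
pose prog := fseq (prologue K b) (fseq (pcompile K c) (epilogue K)).
exists (machine (input_cell_inj K6) (input_cell_neq_blank K6) prog).
(* The degree [B] is twice [b1 + 1]: one factor for the number of commands, one for the walks of the
   head in each. The factor [3 ^ B] absorbs the passage from [size w + 2] to [3 * size w]; the
   additive constant pays for the empty word. *)
pose A := (a1 + 20) * (4 * (a1 + 1) + 40); pose B := (b1 + 1) + (b1 + 1).
exists (A * 3 ^ B), B => w o s Ho [x Hx].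
have [f Ef [f1 f2]] := exec_epilogue K6 Ho.
set N := (size w).+1; set k := pcost N c; set M := N + k.
have initN y : ptr (init_pstate b w) y <= N by rewrite /=; case: ifP.
have Ec : exec (pcompile K c) 0 (tape_of K (init_pstate b w)) (k * (4 * M + 10)) 0 (tape_of K s).
  by apply: (exec_pcompile cK wf) => y => [_|]; rewrite ?leq_add2r.
have oM : size o <= M.
  apply: leq_trans Hx _; apply: leq_trans (psem_ptr_le _ wf _) _; first by move=> y _; apply: initN.
  by rewrite leq_add2r.
have E := exec_seq (exec_prologue K6 w bK) (exec_seq Ec Ef).
have [] := machine_halts (input_cell_inj K6) (input_cell_neq_blank K6) E (o := o).
- by move=> i lt_i; rewrite add1n f1 // (nth_map I1).
- by rewrite add1n.
move=> t le_t ht; exists t => //; apply: leq_trans le_t _.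
have kle : k <= a1 * N.+1 ^ (b1 + 1).
  by apply: leq_trans (Ha N) _; rewrite leq_mul // leq_pexp2l // leq_addr.
have Nle : N.+1 <= N.+1 ^ (b1 + 1) by rewrite addn1 expnS leq_pmulr // expn_gt0.
set P := N.+1 ^ (b1 + 1) in kle Nle.
have step1 : 4 * size w + 10 + (k * (4 * M + 10) + (4 * size o + 10)) <= (k + 20) * (4 * M + 40).
  have wM : size w <= M by rewrite /M /N; lia.
  have : k * (4 * M + 10) <= k * (4 * M + 40) by rewrite leq_mul2l leq_add2l orbT.
  by rewrite mulnDl; lia.
have step2 : (k + 20) * (4 * M + 40) <= ((a1 + 20) * P) * ((4 * (a1 + 1) + 40) * P).
  by apply: leq_mul; rewrite !mulnDl /M; lia.
apply: leq_trans step1 (leq_trans step2 _).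
rewrite mulnACA -/A /P -expnD -/B -mulnA -mulnDr leq_mul2l.
apply/orP; right; rewrite -expnMn /N.
case: (posnP (size w)) => [->|w0]; first by rewrite muln0; apply: leq_trans (leq_addl _ _); rewrite leq_exp2r //; lia.
by apply: leq_trans (leq_addr _ _); rewrite leq_exp2r /B; lia.
Qed.
(** * Nested bounded loops over multi-dimensional arrays *)

Definition lvar : eqType := (nat * nat)%type.

Inductive cmd :=
| Skip
| Seq of cmd & cmd
| ASet of nat & seq lvar & bool
| AIf of nat & seq lvar & cmd & cmd
| IfEq of lvar & lvar & cmd & cmd
| IfCnt of lvar & nat & cmd & cmd
| Inc of nat
| Reset of nat
| For of lvar & lvar & cmd
| Out of isym.

Record store := Store { cnt : nat -> nat; arr : nat -> seq nat -> bool; out : seq isym }.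

(* Loop variables live in the immutable environment [r]; counters, arrays and output are
   mutable. [For x y c] lets [x] range over [0], ..., [r y], both included. *)
Fixpoint sem (c : cmd) (r : lvar -> nat) (s : store) : store :=
  match c with
  | Skip => s
  | Seq c1 c2 => sem c2 r (sem c1 r s)
  | ASet t xs b => Store (cnt s) (upd (arr s) t (upd (arr s t) (map r xs) b)) (out s)
  | AIf t xs c1 c2 => if arr s t (map r xs) then sem c1 r s else sem c2 r s
  | IfEq x y c1 c2 => if r x == r y then sem c1 r s else sem c2 r s
  | IfCnt x k c1 c2 => if r x == cnt s k then sem c1 r s else sem c2 r s
  | Inc k => Store (upd (cnt s) k (cnt s k).+1) (arr s) (out s)
  | Reset k => Store (upd (cnt s) k 0) (arr s) (out s)
  | For x y c => loop (fun s' i => sem c (upd r x i) s') s (r y)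
  | Out a => Store (cnt s) (arr s) (rcons (out s) a)
  end.

(** A program starts with only these two variables in scope, holding [(size w).+1] and 0. Variables
    in scope cannot be rebound, so [vN] is available as a loop bound everywhere. *)
Definition vN : lvar := (0, 0).
Definition vZ : lvar := (0, 1).

(* Arrays 0, 1, 2 hold the input and 3, 4, 5 the output. *)
Fixpoint cwf (G : seq lvar) (c : cmd) : bool :=
  match c with
  | Seq c1 c2 => cwf G c1 && cwf G c2
  | ASet t xs _ => (5 < t) && all [in G] xs
  | AIf t xs c1 c2 => [&& (t < 3) || (5 < t), all [in G] xs, cwf G c1 & cwf G c2]
  | IfEq x y c1 c2 => [&& x \in G, y \in G, cwf G c1 & cwf G c2]
  | IfCnt x _ c1 c2 => [&& x \in G, cwf G c1 & cwf G c2]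
  | For x y c => [&& y \in G, x \notin G & cwf (x :: G) c]
  | _ => true
  end.

(* Bijective numeration in base [N.+1] with digits 1, ..., N.+1: it is injective on lists
   of arbitrary length, and the singleton [:: i] gets the position [i.+1] of input symbol [i]. *)
Fixpoint addr (N : nat) (xs : seq nat) : nat :=
  if xs is x :: xs' then x.+1 + N.+1 * addr N xs' else 0.

Lemma addr_inj N xs ys : all (leq^~ N) xs -> all (leq^~ N) ys ->
  addr N xs = addr N ys -> xs = ys.
Proof.
elim: xs ys => [|x xs IH] [|y ys] //= /andP[xN xsN] /andP[yN ysN] [] e.
have e1 : (x + N.+1 * addr N xs) %% N.+1 = (y + N.+1 * addr N ys) %% N.+1 by rewrite e.
move: e1; rewrite ![N.+1 * _]mulnC ![_ + _ * N.+1]addnC !modnMDl !modn_small // => exy.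
rewrite exy; congr (_ :: _); apply: IH => //.
by move: e; rewrite exy => /addnI /eqP; rewrite eqn_mul2l => /eqP.
Qed.

(* Pointers 0 (current address) and [4 * j + 4] are scratch, [4 * k + 1] are the counters,
   2 is the output position and [4 * i + 3] are the loop variables. *)
Definition cptr (k : nat) : nat := 4 * k + 1.
Definition lptr (x : lvar) : nat := 4 * pickle x + 3.

Lemma lptr_inj : injective lptr.
Proof. by move=> x y; rewrite /lptr => e; apply: (pcan_inj pickleK); lia. Qed.

(** Pointers can only be advanced by one, so [N.+1 ^ j] is added by [j] nested loops of [N.+1] turns
    each. *)
Fixpoint add_pow (j : nat) : pcmd :=
  if j is j'.+1 then PFor (4 * j' + 4) (lptr vN) (add_pow j') else PInc 0.

(** A loop bounded by [x] makes one turn more than the value of [x], which is precisely the digit of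
    [x] in [addr]; the bijective numeration fits the inclusive loops. *)
Fixpoint locate (j : nat) (xs : seq lvar) : pcmd :=
  if xs is x :: xs' then PSeq (PFor (4 * j + 4) (lptr x) (add_pow j)) (locate j.+1 xs')
  else PSkip.

Definition goto_addr xs := PSeq (PReset 0) (locate 0 xs).

Fixpoint compile (c : cmd) : pcmd :=
  match c with
  | Skip => PSkip
  | Seq c1 c2 => PSeq (compile c1) (compile c2)
  | ASet t xs b => PSeq (goto_addr xs) (PSet t 0 b)
  | AIf t xs c1 c2 => PSeq (goto_addr xs) (PIf t 0 (compile c1) (compile c2))
  | IfEq x y c1 c2 => PIfEq (lptr x) (lptr y) (compile c1) (compile c2)
  | IfCnt x k c1 c2 => PIfEq (lptr x) (cptr k) (compile c1) (compile c2)
  | Inc k => PInc (cptr k)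
  | Reset k => PReset (cptr k)
  | For x y c => PFor (lptr x) (lptr y) (compile c)
  | Out a => PSeq (PSet (3 + code a) 2 true) (PInc 2)
  end.

Lemma pwf_add_pow G j : lptr vN \in G -> 0 \notin G ->
  (forall i, i < j -> 4 * i + 4 \notin G) -> pwf G (add_pow j).
Proof.
elim: j G => //= j IH G NG zG jG; rewrite NG jG //=; apply: IH.
- by rewrite inE NG orbT.
- by rewrite inE negb_or zG andbT; lia.
- by move=> i lt_ij; rewrite inE negb_or jG ?andbT; lia.
Qed.

Lemma pwf_locate G j xs : vN \in G -> all [in G] xs -> pwf (map lptr G) (locate j xs).
Proof.
move=> NG; have mod4 p : p %% 4 != 3 -> p \notin map lptr G.
  by apply: contra => /mapP[x _ ->]; rewrite /lptr; lia.
elim: xs j => //= x xs IH j /andP[xG xsG]; rewrite IH // andbT map_f //= mod4 /=; last by lia.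
apply: pwf_add_pow; first by rewrite inE map_f ?orbT.
  by rewrite inE negb_or mod4 ?andbT //; lia.
by move=> i lt_ij; rewrite inE negb_or mod4 ?andbT; lia.
Qed.

Lemma pwf_compile G c : vN \in G -> cwf G c -> pwf (map lptr G) (compile c).
Proof.
elim: c G => //= [c1 IH1 c2 IH2|t xs b|t xs c1 IH1 c2 IH2|x y c1 IH1 c2 IH2|x k c1 IH1 c2 IH2|k|k|x y c IH|a] G NG.
- by case/andP=> w1 w2; rewrite IH1 ?IH2.
- by case/andP=> _ wx; rewrite pwf_locate // !andbT; apply/mapP=> -[x _]; rewrite /lptr; lia.
- case/and4P=> _ wx w1 w2; rewrite pwf_locate // IH1 // IH2 // !andbT.
  by apply/mapP=> -[x _]; rewrite /lptr; lia.
- by case/and4P=> _ _ w1 w2; rewrite IH1 ?IH2.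
- by case/and3P=> _ w1 w2; rewrite IH1 ?IH2.
- by move=> _; apply/mapP=> -[x _]; rewrite /lptr /cptr; lia.
- by move=> _; apply/mapP=> -[x _]; rewrite /lptr /cptr; lia.
- case/and3P=> yG xG wc; rewrite map_f //= (mem_map lptr_inj) xG /=.
  by apply: (IH (x :: G)) => //; rewrite inE NG orbT.
- by move=> _; apply/mapP=> -[x _]; rewrite /lptr; lia.
Qed.

Definition off_scratch (s s' : pstate) :=
  bits s' = bits s /\ forall p, p %% 4 != 0 -> ptr s' p = ptr s p.

Lemma psem_for_add p q c d s : p %% 4 = 0 -> 0 < p ->
  (forall t, off_scratch s t -> off_scratch s (psem c t) /\ ptr (psem c t) 0 = ptr t 0 + d) ->
  off_scratch s (psem (PFor p q c) s) /\
  ptr (psem (PFor p q c) s) 0 = ptr s 0 + (ptr s q).+1 * d.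
Proof.
move=> p4 p0 H /=; rewrite /loop -[in X in _ + X * d](size_iota 0 (ptr s q).+1).
suff G l t : off_scratch s t -> let t' := foldl (fun s' i => psem c (set_ptr s' p i)) t l in
    off_scratch s t' /\ ptr t' 0 = ptr t 0 + size l * d by apply: G.
elim: l t => [|i l IH] t st /=; first by rewrite addn0.
have st' : off_scratch s (set_ptr t p i).
  by case: st => sb sp; split=> //= y y4; rewrite upd_other ?sp //; apply: contraNneq y4 => ->; rewrite p4.
have [st2 e2] := H _ st'; have [st3 ->] := IH _ st2; split=> //.
by rewrite e2 /= upd_other ?mulSn ?addnA // eq_sym -lt0n.
Qed.

Section Simulation.
Variable N : nat.

Lemma psem_add_pow j s : ptr s (lptr vN) = N ->
  off_scratch s (psem (add_pow j) s) /\ ptr (psem (add_pow j) s) 0 = ptr s 0 + N.+1 ^ j.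
Proof.
elim: j s => [|j IH] s sN.
  split; last by rewrite /= upd_same addn1.
  by split=> // p p4; rewrite /= upd_other //; apply: contraNneq p4 => ->.
have := @psem_for_add (4 * j + 4) (lptr vN) (add_pow j) (N.+1 ^ j) s.
rewrite sN expnS; apply; [lia|lia|].
move=> t st; have tN : ptr t (lptr vN) = N.
  by case: st => _ ->; rewrite ?sN // /lptr; lia.
have [[b1 p1] e] := IH t tN; split=> //; case: st => b2 p2; split; first by rewrite b1.
by move=> p p4; rewrite p1 ?p2.
Qed.

Lemma psem_locate (r : lvar -> nat) j xs s : ptr s (lptr vN) = N ->
  all (fun x => ptr s (lptr x) == r x) xs ->
  off_scratch s (psem (locate j xs) s) /\
  ptr (psem (locate j xs) s) 0 = ptr s 0 + N.+1 ^ j * addr N (map r xs).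
Proof.
elim: xs j s => [|x xs IH] j s sN; first by rewrite /= muln0 addn0.
case/andP=> /eqP sx sxs.
have [||t st|[b1 p1] e1] := @psem_for_add (4 * j + 4) (lptr x) (add_pow j) (N.+1 ^ j) s; [lia|lia| |].
  have tN : ptr t (lptr vN) = N by case: st => _ ->; rewrite ?sN // /lptr; lia.
  have [[b2 p2] e2] := psem_add_pow j tN; split=> //; case: st => b3 p3.
  by split=> [|p p4]; [rewrite b2|rewrite p2 ?p3].
have lp4 y : lptr y %% 4 != 0 by rewrite /lptr; lia.
have [||[b2 p2] e2] := IH j.+1 (psem (PFor (4 * j + 4) (lptr x) (add_pow j)) s).
- by rewrite p1.
- by apply: sub_all sxs => y; rewrite p1.
split; first by split=> [|p p4]; [rewrite [LHS]b2|rewrite [LHS]p2 ?p1].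
rewrite [LHS]e2 e1 sx /= expnS mulnDr -addnA; congr (_ + _); rewrite mulnC; congr (_ + _).
by rewrite mulnA [_ * N.+1]mulnC.
Qed.

Lemma psem_goto_addr (r : lvar -> nat) xs s : ptr s (lptr vN) = N ->
  all (fun x => ptr s (lptr x) == r x) xs ->
  off_scratch s (psem (goto_addr xs) s) /\ ptr (psem (goto_addr xs) s) 0 = addr N (map r xs).
Proof.
move=> sN sx /=; set t := set_ptr s 0 0.
have st : off_scratch s t.
  by split=> // p p4; rewrite /= upd_other //; apply: contraNneq p4 => ->.
have lp4 y : lptr y %% 4 != 0 by rewrite /lptr; lia.
have [||[b1 p1] ->] := @psem_locate r 0 xs t; first by rewrite st.2.
  by apply: sub_all sx => y; rewrite st.2.
split; first by split=> [|p p4]; [rewrite b1|rewrite p1 ?st.2].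
by rewrite mul1n.
Qed.

(** Tape and arrays are compared only at index lists with entries up to [N], where [addr] is
    injective, and not on the output arrays, which [outputs] describes. The output pointer is one
    ahead because position 0 is the home cell. *)
Definition simulates (G : seq lvar) (r : lvar -> nat) (s : store) (p : pstate) :=
  [/\ forall x, x \in G -> ptr p (lptr x) = r x,
      forall k, ptr p (cptr k) = cnt s k,
      forall t xs, (t < 3) || (5 < t) -> all (leq^~ N) xs -> bits p t (addr N xs) = arr s t xs,
      ptr p 2 = (size (out s)).+1
    & outputs p (out s)].

Lemma simulates_off_scratch G r s p p' : off_scratch p p' ->
  simulates G r s p -> simulates G r s p'.
Proof.
case=> eb ep [h1 h2 h3 h4 h5]; split.
- by move=> x xG; rewrite ep ?h1 // /lptr; lia.
- by move=> k; rewrite ep ?h2 // /cptr; lia.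
- by rewrite eb.
- by rewrite ep.
- by rewrite /outputs eb.
Qed.

Lemma simulates_goto G r s p xs : vN \in G -> r vN = N -> (forall x, x \in G -> r x <= N) ->
  all [in G] xs -> simulates G r s p ->
  [/\ simulates G r s (psem (goto_addr xs) p),
      ptr (psem (goto_addr xs) p) 0 = addr N (map r xs) & all (leq^~ N) (map r xs)].
Proof.
move=> NG rN GN xsG sim; have [h1 _ _ _ _] := sim.
have [||o e] := @psem_goto_addr r xs p; first by rewrite h1.
  by apply/allP=> x xxs; rewrite h1 //; apply: (allP xsG).
split=> //; first exact: simulates_off_scratch sim.
by rewrite all_map; apply/allP=> x xxs /=; apply/GN/(allP xsG).
Qed.

Lemma simulates_compile G c r s p : vN \in G -> r vN = N -> (forall x, x \in G -> r x <= N) ->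
  cwf G c -> simulates G r s p -> simulates G r (sem c r s) (psem (compile c) p).
Proof.
elim: c G r s p => [|c1 IH1 c2 IH2|t xs b|t xs c1 IH1 c2 IH2|x y c1 IH1 c2 IH2|x k c1 IH1 c2 IH2|k|k|x y c IH|a] G r s p NG rN GN.
- by [].
- by case/andP=> w1 w2 sim; apply: IH2 => //; apply: IH1.
- case/andP=> t6 xsG /(simulates_goto NG rN GN xsG)[].
  rewrite [psem (compile _) p]/=; set p' := psem (locate _ _) _.
  rewrite [psem (goto_addr xs) p]/= -/p' => -[h1 h2 h3 h4 h5] e0 xsN; split=> //=.
  + move=> t' ys tt ysN; rewrite /upd; case: (eqVneq t' t) => [_|nt]; last exact: h3.
    rewrite e0; case: (eqVneq ys (map r xs)) => [->|ne]; first by rewrite eqxx.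
    rewrite ifN; first by apply: h3; rewrite ?t6 ?orbT.
    by apply: contra ne => /eqP/(addr_inj ysN xsN)->.
  + move=> a i a3; rewrite /= upd_other; first exact: h5.
    by lia.
- case/and4P=> tt xsG w1 w2 /(simulates_goto NG rN GN xsG)[sim e0 xsN].
  have [_ _ h3 _ _] := sim; rewrite [sem _ _ _]/= [psem _ p]/= -/(psem (goto_addr xs) p).
  rewrite (_ : psem (locate _ _) _ = psem (goto_addr xs) p) // e0 h3 //.
  by case: ifP => _; [apply: IH1|apply: IH2].
- case/and4P=> xG yG w1 w2 sim; have [h1 _ _ _ _] := sim; rewrite /= !h1 //.
  by case: ifP => _; [apply: IH1|apply: IH2].
- case/and3P=> xG w1 w2 sim; have [h1 h2 _ _ _] := sim; rewrite /= h1 // h2.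
  by case: ifP => _; [apply: IH1|apply: IH2].
- move=> _ [h1 h2 h3 h4 h5]; split=> //= [x xG|k'|].
  + by rewrite upd_other ?h1 // /lptr /cptr; lia.
  + rewrite /upd (_ : cptr k' == cptr k = (k' == k)) ?h2 //.
    by rewrite /cptr; lia.
  + by rewrite upd_other // /cptr; lia.
- move=> _ [h1 h2 h3 h4 h5]; split=> //= [x xG|k'|].
  + by rewrite upd_other ?h1 // /lptr /cptr; lia.
  + rewrite /upd (_ : cptr k' == cptr k = (k' == k)) ?h2 //.
    by rewrite /cptr; lia.
  + by rewrite upd_other // /cptr; lia.
- case/and3P=> yG xG wc sim; have [h1 _ _ _ _] := sim; rewrite /= h1 // /loop.
  have : all (leq^~ N) (iota 0 (r y).+1).
    by apply/allP=> i; rewrite mem_iota /= add0n ltnS => /leq_trans; apply; apply: GN.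
  move: (iota _ _) => l; elim: l s p sim {h1} => //= i l IHl s p sim /andP[iN lN].
  have nx z : z \in G -> z != x by move=> zG; apply: contraNneq xG => <-.
  apply: IHl => //.
  have [|||||h1 h2 h3 h4 h5] := IH (x :: G) (upd r x i) s (set_ptr p (lptr x) i).
  + by rewrite inE NG orbT.
  + by rewrite upd_other // nx.
  + by move=> z; rewrite inE /upd; case: eqP => //= _ zG; apply: GN.
  + by [].
  + case: sim => h1 h2 h3 h4 h5; split=> //= [z|k|].
    * rewrite inE /upd (inj_eq lptr_inj); case: eqP => //= _; exact: h1.
    * by rewrite upd_other ?h2 // /lptr /cptr; lia.
    * by rewrite upd_other // /lptr; lia.
  split=> // z zG; rewrite h1 ?upd_other ?nx // inE zG orbT //.
- move=> _ [h1 h2 h3 h4 h5]; split=> /=.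
  + by move=> x xG; rewrite upd_other ?h1 // /lptr; lia.
  + by move=> k; rewrite upd_other ?h2 // /cptr; lia.
  + move=> t xs tt xsN; rewrite upd_other ?h3 //.
    by have := code_lt3 a; lia.
  + by rewrite upd_same size_rcons h4.
  + move=> b i b3 /=; rewrite /upd eqn_add2l h4 ?eqSS size_rcons nth_rcons ltnS.
    case: (eqVneq b (code a)) => [eb|nb] /=.
      rewrite eb eqSS; case: (ltngtP i (size (out s))) => [lt_i|gt|_]; rewrite ?eqxx //.
        by rewrite (h5 (code a)) ?code_lt3 // lt_i.
      by rewrite (h5 (code a)) ?code_lt3 //= ltnNge ltnW.
    rewrite h5 //; case: (ltngtP i (size (out s))) => //= _.
    by rewrite eq_sym (negbTE nb).
Qed.

End Simulation.

Definition init_env (w : seq isym) : lvar -> nat := fun x => if x == vN then (size w).+1 else 0.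

Definition init_store (w : seq isym) : store :=
  Store (fun _ => 0) (fun t xs => bits (init_pstate (lptr vN) w) t (addr (size w).+1 xs)) [::].

Theorem cmd_machine c : cwf [:: vN; vZ] c ->
  exists (M : TM) (a k : nat), forall w,
    exists2 t, t <= a * size w ^ k + a &
      halts_with M w t (out (sem c (init_env w) (init_store w))).
Proof.
(* The output pointer starts at 1, as the home cell holds no output; it also serves as the pointer
   that bounds the length of the output. *)
move=> wc; have [|M [a [k H]]] := @pcmd_machine (lptr vN) (map lptr [:: vN; vZ]) (PSeq (PInc 2) (compile c)).
  by apply: (introT andP); split; last exact: (@pwf_compile [:: vN; vZ]).
exists M, a, k => w; set N := (size w).+1.
set s := sem c _ _; set p := psem (compile c) (set_ptr (init_pstate (lptr vN) w) 2 1).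
have : simulates N [:: vN; vZ] (init_env w) s p.
  apply: simulates_compile; rewrite ?inE //=; first by move=> x; rewrite /init_env; case: ifP.
  split=> /=.
  - move=> x _; rewrite upd_other; last by rewrite /lptr; lia.
    by rewrite /init_env (inj_eq lptr_inj).
  - move=> k'; rewrite upd_other; last by rewrite /cptr; lia.
    by rewrite ifN // /lptr /cptr; lia.
  - by [].
  - by rewrite upd_same.
  - move=> b i b3 /=.
    by case: ltnP => //= _; have := code_lt3 (nth I1 w i); lia.
case=> _ _ _ e2 ho; apply: H; last by exists 2; rewrite /= -/p e2.
by rewrite /= (_ : psem _ _ = p) // /p; congr psem; rewrite /set_ptr ifN.
Qed.
(** * Decomposing common intervals *)

Lemma perm_uniq_seq s : is_perm s -> uniq s.
Proof. by move/perm_uniq->; rewrite iota_uniq. Qed.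

Lemma mem_perm s v : is_perm s -> (v \in s) = (v < size s).
Proof. by move/perm_mem->; rewrite mem_iota. Qed.

Lemma perm_nth_inj s i j : is_perm s -> i < size s -> j < size s ->
  nth 0 s i = nth 0 s j -> i = j.
Proof. by move=> /perm_uniq_seq us si sj /eqP; rewrite nth_uniq // => /eqP. Qed.

Lemma seq_min_le f x : x \in f -> seq_min f <= x.
Proof.
rewrite /seq_min; move: (head 0 f) => e; elim: f => //= y f IH.
by rewrite inE geq_min => /orP[/eqP->|/IH->]; rewrite ?leqnn ?orbT.
Qed.

Lemma seq_min_mem f : f != [::] -> seq_min f \in f.
Proof.
have H e g : foldr minn e g \in e :: g.
  elim: g => [|y g IH]; rewrite /= ?mem_head // /minn; case: ifP => _.
    by rewrite !inE eqxx orbT.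
  by move: IH; rewrite !inE => /orP[->|->]; rewrite ?orbT.
by case: f => // x f _; have := H x (x :: f); rewrite !inE orbA orbb.
Qed.

Lemma seq_max_ge f x : x \in f -> x <= seq_max f.
Proof.
by elim: f => //= y f IH; rewrite inE leq_max => /orP[/eqP->|/IH->]; rewrite ?leqnn ?orbT.
Qed.

Lemma seq_max_mem f : f != [::] -> seq_max f \in f.
Proof.
elim: f => // y [|z f] IH _; first by rewrite /= maxn0 mem_head.
rewrite -[seq_max _]/(maxn y (seq_max (z :: f))) /maxn; case: ifP => _.
  by rewrite inE IH ?orbT.
exact: mem_head.
Qed.

Lemma mem_factor s I v : I.1 <= I.2 ->
  reflect (exists2 k, in_rng I k & v = nth 0 s k) (v \in factor s I).
Proof.
move=> le12; apply: (iffP mapP) => -[k Ik ->]; exists k => //.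
  by move: Ik; rewrite mem_iota /in_rng; lia.
by move: Ik; rewrite mem_iota /in_rng; lia.
Qed.

Lemma mem_ranges n (I : rng) : (I \in ranges n) = (I.1 <= I.2 < n).
Proof.
apply/allpairsPdep/idP => [[i [j [ii jj ->]]]|H].
  by move: ii jj; rewrite !mem_iota /=; lia.
by exists I.1, I.2; rewrite !mem_iota -surjective_pairing; split=> //; lia.
Qed.

Lemma has_rangesP n (P : pred rng) :
  reflect (exists2 I : rng, I.1 <= I.2 < n & P I) (has P (ranges n)).
Proof.
by apply: (iffP hasP) => -[I In PI]; exists I => //; move: In; rewrite mem_ranges.
Qed.

Lemma all_rangesP n (P : pred rng) :
  reflect (forall I : rng, I.1 <= I.2 < n -> P I) (all P (ranges n)).
Proof.
apply: (iffP allP) => H I; first by rewrite -mem_ranges; apply: H.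
by rewrite mem_ranges; apply: H.
Qed.

(** A common interval of a permutation, seen from positions: no position outside has a value between
    two values inside. This form avoids minima and maxima. *)
Definition convex_rng (s : seq nat) (I : rng) : Prop :=
  [/\ I.1 <= I.2, I.2 < size s &
      forall k1 k2 k, in_rng I k1 -> in_rng I k2 -> k < size s ->
        nth 0 s k1 <= nth 0 s k <= nth 0 s k2 -> in_rng I k].

Lemma common_intervalP s I : is_perm s -> reflect (convex_rng s I) (common_interval s I).
Proof.
move=> ps; apply: (iffP andP) => [[/andP[le12 ltn] /allP H]|[le12 ltn H]].
  split=> // k1 k2 k I1 I2 kn /andP[le1 le2].
  have f1 : nth 0 s k1 \in factor s I by apply/mem_factor => //; exists k1.
  have f2 : nth 0 s k2 \in factor s I by apply/mem_factor => //; exists k2.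
  have /H/(mem_factor _ _ le12)[k' Ik' e] : nth 0 s k \in
      iota (seq_min (factor s I)) (seq_max (factor s I) - seq_min (factor s I)).+1.
    by rewrite mem_iota; have := seq_min_le f1; have := seq_max_ge f2; lia.
  suff -> : k = k' by [].
  by apply: perm_nth_inj e => //; move: Ik'; rewrite /in_rng; lia.
split; first by rewrite le12.
have fN0 : factor s I != [::] by rewrite /factor -size_eq0 size_map size_iota.
apply/allP=> v; rewrite mem_iota => vb.
have /(mem_factor _ _ le12)[k1 I1 e1] := seq_min_mem fN0.
have /(mem_factor _ _ le12)[k2 I2 e2] := seq_max_mem fN0.
have ks k : in_rng I k -> k < size s by rewrite /in_rng; lia.
have k2s : nth 0 s k2 < size s by rewrite -mem_perm // mem_nth // ks.
have le_mM := seq_max_ge (seq_min_mem fN0).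
have vs : v \in s by rewrite mem_perm //; lia.
have v1 : index v s < size s by rewrite index_mem.
have /(H k1 k2 _ I1 I2 v1) Iv : nth 0 s k1 <= nth 0 s (index v s) <= nth 0 s k2.
  by rewrite nth_index // -e1 -e2; lia.
by apply/mem_factor => //; exists (index v s) => //; rewrite nth_index.
Qed.

(** * Unions, intersections and differences of common intervals *)

Section ConvexRanges.
Variables (s : seq nat) (I J : rng).
Hypotheses (cI : convex_rng s I) (cJ : convex_rng s J).

(** A value between one of [I] and one of [J] is compared with that of the shared position [x]: on
    either side of it, it lies between two values of the same interval. *)
Lemma convex_cup x : in_rng I x -> in_rng J x -> convex_rng s (minn I.1 J.1, maxn I.2 J.2).
Proof.
case: cI cJ => I12 In HI [J12 Jn HJ] Ix Jx.
have cupE k : in_rng (minn I.1 J.1, maxn I.2 J.2) k = in_rng I k || in_rng J k.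
  by move: Ix Jx; rewrite /in_rng /=; lia.
split=> /= [||k1 k2 k]; [lia|lia|rewrite !cupE => c1 c2 kn b].
case/orP: c1 => c1; case/orP: c2 => c2.
- by rewrite (HI k1 k2).
- have [lex|ltx] := leqP (nth 0 s k) (nth 0 s x).
    by rewrite (HI k1 x k) //; lia.
  by rewrite (HJ x k2 k) ?orbT //; lia.
- have [lex|ltx] := leqP (nth 0 s k) (nth 0 s x).
    by rewrite (HJ k1 x k) ?orbT //; lia.
  by rewrite (HI x k2 k) //; lia.
- by rewrite (HJ k1 k2) ?orbT.
Qed.

Lemma convex_cap x : in_rng I x -> in_rng J x -> convex_rng s (maxn I.1 J.1, minn I.2 J.2).
Proof.
case: cI cJ => I12 In HI [J12 Jn HJ] Ix Jx.
have capE k : in_rng (maxn I.1 J.1, minn I.2 J.2) k = in_rng I k && in_rng J k.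
  by rewrite /in_rng /=; lia.
split=> /= [||k1 k2 k]; [by move: Ix Jx; rewrite /in_rng; lia|lia|rewrite !capE].
by move=> /andP[i1 j1] /andP[i2 j2] kn b; rewrite (HI k1 k2) // (HJ k1 k2).
Qed.

(* If the value at a point [x] of [J] outside [I] lay above those of [I :\: J], then a value
   taken in [I :&: J] between two values of [I :\: J] would trap one of the latter in [J]. *)
Lemma convex_diff (D : rng) x : D.1 <= D.2 -> in_rng J x -> ~~ in_rng I x ->
  (forall k, in_rng D k = in_rng I k && ~~ in_rng J k) -> convex_rng s D.
Proof.
case: cI cJ => I12 In HI [J12 Jn HJ] D12 Jx Ix DE.
have D2 : in_rng D D.2 by rewrite /in_rng D12 /=.
split=> //; first by move: D2; rewrite DE /in_rng; lia.
move=> k1 k2 k; rewrite !DE => /andP[i1 /negP j1] /andP[i2 /negP j2] kn b.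
rewrite (HI k1 k2) //=; apply/negP => jk.
have xn : x < size s by move: Jx; rewrite /in_rng; lia.
have [le1|gt1] := leqP (nth 0 s k1) (nth 0 s x); last first.
  by apply: j1; apply: (HJ x k) => //; [move: i1; rewrite /in_rng|]; lia.
have [le2|gt2] := leqP (nth 0 s x) (nth 0 s k2).
  by case/negP: Ix; apply: (HI k1 k2) => //; rewrite le1.
by apply: j2; apply: (HJ k x) => //; [move: i2; rewrite /in_rng|]; lia.
Qed.

End ConvexRanges.

Lemma convex_point s x : is_perm s -> x < size s -> convex_rng s (x, x).
Proof.
move=> ps xn; split=> // k1 k2 k; rewrite /in_rng /= => e1 e2 kn.
have -> : k1 = x by lia.
have -> : k2 = x by lia.
rewrite -eqn_leq => /eqP e.
by rewrite (perm_nth_inj ps xn kn e) leqnn.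
Qed.

Lemma mem_iota_rng (I : rng) x : I.1 <= I.2 ->
  (x \in iota I.1 (I.2 - I.1).+1) = in_rng I x.
Proof. by rewrite mem_iota /in_rng; lia. Qed.

Lemma overlapE I J : I.1 <= I.2 -> J.1 <= J.2 ->
  overlap I J = [&& maxn I.1 J.1 <= minn I.2 J.2, ~~ subr I J & ~~ subr J I].
Proof.
move=> I12 J12; rewrite /overlap; set X := iota _ _.
have outE (A B : rng) : A.1 <= A.2 -> A.2 <= maxn I.2 J.2 ->
    has (fun x => in_rng A x && ~~ in_rng B x) X = ~~ subr A B.
  move=> A12 AX; apply/hasP/idP => [[x _]|]; rewrite /in_rng /subr; first by lia.
  rewrite negb_and -!ltnNge => H; exists (if A.1 < B.1 then A.1 else A.2).
    by rewrite mem_iota; case: ifP; lia.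
  by case: ifP; lia.
rewrite !outE ?leq_maxl ?leq_maxr // andbC; congr (_ && _).
apply/hasP/idP => [[x _]|H]; first by rewrite /in_rng; lia.
by exists (maxn I.1 J.1); rewrite ?mem_iota /in_rng; lia.
Qed.

Lemma strong_intervalP s I : is_perm s ->
  reflect (convex_rng s I /\ forall J x, convex_rng s J -> in_rng I x -> in_rng J x ->
             subr I J || subr J I)
          (strong_interval s I).
Proof.
move=> ps; apply: (iffP andP) => -[cI H].
  split=> [|J x cJ Ix Jx]; first exact/common_intervalP.
  have [I12 _ _] := elimT (common_intervalP I ps) cI; have [J12 Jn _] := cJ.
  have Jr : J.1 <= J.2 < size s by rewrite J12.
  have := all_rangesP _ _ H J Jr; rewrite (introT (common_intervalP J ps) cJ) /= overlapE // -negb_or.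
  suff -> : maxn I.1 J.1 <= minn I.2 J.2 by rewrite negbK.
  by move: Ix Jx; rewrite /in_rng; lia.
split; first exact/common_intervalP.
apply/all_rangesP => J _; apply/implyP => /(common_intervalP J ps) cJ.
have [I12 _ _] := cI; have [J12 Jn _] := cJ.
rewrite overlapE // -negb_or; apply/negP => /andP[m /negP]; apply.
by apply: (H J (maxn I.1 J.1)) => //; rewrite /in_rng; lia.
Qed.

(** Parts need not be strong intervals: a linear node, or a common interval that is not strong, is
    cut into two common intervals, which replaces the binary combs of the expanded tree. *)
Definition decomposes (s : seq nat) (I : rng) (cs : seq rng) : Prop :=
  [/\ forall J : rng, J \in cs -> convex_rng s J /\ psubr J I,
      forall i j, i < j < size cs -> (nth (0, 0) cs i).2 < (nth (0, 0) cs j).1 &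
      forall k, in_rng I k -> exists2 J : rng, J \in cs & in_rng J k].

(** * Common intervals that are not a concatenation of two common intervals *)

Section Decomposition.
Variables (s : seq nat) (I : rng).
Hypotheses (ps : is_perm s) (cI : convex_rng s I).
Hypothesis unsplit : forall c, I.1 < c <= I.2 ->
  convex_rng s (I.1, c.-1) -> convex_rng s (c, I.2) -> False.

Let subr_in (J K : rng) x : subr J K -> in_rng J x -> in_rng K x.
Proof. by rewrite /subr /in_rng; lia. Qed.

Let subr_anti (J K : rng) : subr J K -> subr K J -> J = K.
Proof.
by case: J K => [a b] [c e]; rewrite /subr /= => H1 H2; congr pair; lia.
Qed.

(** If a common interval [J] overlapped [I], then the part of [I] in [J] and the part outside would
    both be common intervals and cut [I] in two. *)
Lemma unsplit_strong : strong_interval s I.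
Proof.
apply/strong_intervalP => //; split=> // J x cJ Ix Jx.
case: (boolP (subr I J || subr J I)) => //; rewrite negb_or => /andP[n1 n2]; exfalso.
have [I12 In _] := cI; have [J12 Jn _] := cJ; have cap := convex_cap cI cJ Ix Jx.
have [lt|ge] := ltnP J.1 I.1.
  have e1 : maxn I.1 J.1 = I.1 by lia.
  have e2 : minn I.2 J.2 = J.2 by move: n1 n2; rewrite /subr; lia.
  apply: (@unsplit J.2.+1); rewrite ?e1 ?e2 in cap *.
  - by move: n1 n2 Ix Jx; rewrite /subr /in_rng; lia.
  - exact: cap.
  - apply: (convex_diff cI cJ (x := J.1)) => /=; rewrite /in_rng /=; move: n1 n2 Ix Jx; rewrite /subr /in_rng; lia.
have e1 : maxn I.1 J.1 = J.1 by lia.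
have e2 : minn I.2 J.2 = I.2 by move: n1 n2; rewrite /subr; lia.
apply: (@unsplit J.1); rewrite ?e1 ?e2 in cap *.
- by move: n1 n2 Ix Jx; rewrite /subr /in_rng; lia.
- apply: (convex_diff cI cJ (x := J.2)) => /=; rewrite /in_rng /=; move: n1 n2 Ix Jx; rewrite /subr /in_rng; lia.
- exact: cap.
Qed.

Definition maximal_rng (J : rng) : Prop :=
  [/\ convex_rng s J, psubr J I &
      forall K, convex_rng s K -> psubr K I -> subr J K -> K = J].

Lemma maximal_above J : convex_rng s J -> psubr J I ->
  exists2 K, maximal_rng K & subr J K.
Proof.
move: {2}(I.2 - I.1 - (J.2 - J.1)) (leqnn (I.2 - I.1 - (J.2 - J.1))) => n.
elim: n J => [|n IH] J le_n cJ pJ.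
  have [J12 _ _] := cJ; case/negP: (andP pJ).2; apply/eqP.
  by apply: subr_anti; move: pJ le_n; rewrite /psubr /subr; lia.
case: (boolP (has (fun K => [&& common_interval s K, psubr K I, subr J K & K != J]) (ranges (size s)))).
  case/has_rangesP=> K _ /and4P[/(common_intervalP _ ps) cK pK JK nKJ].
  have [|M mM KM] := IH K _ cK pK.
    have [K12 _ _] := cK; have [J12 _ _] := cJ.
    suff : J.2 - J.1 < K.2 - K.1 by move: pK le_n; rewrite /psubr /subr; lia.
    rewrite ltnNge; apply: contra nKJ => le; apply/eqP/subr_anti => //.
    by move: JK; rewrite /subr; lia.
  by exists M => //; move: JK KM; rewrite /subr; lia.
move=> H; exists J; last by rewrite /subr !leqnn.
split=> // K cK pK JK; apply/eqP; apply: contraNT H => nKJ.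
have [K12 Kn _] := cK; apply/has_rangesP; exists K; first by rewrite K12.
by rewrite (introT (common_intervalP K ps) cK) pK JK nKJ.
Qed.

Lemma maximal_at x : I.1 < I.2 -> in_rng I x -> exists2 K, maximal_rng K & in_rng K x.
Proof.
move=> lt12 Ix; have [_ In _] := cI.
have [||K mK xK] := @maximal_above (x, x).
- by apply: convex_point => //; move: Ix; rewrite /in_rng; lia.
- rewrite /psubr /subr /=; apply/andP; split; first by move: Ix; rewrite /in_rng.
  by case: I lt12 => a b /= lt; apply/eqP => -[]; lia.
by exists K => //; apply: subr_in xK _; rewrite /in_rng /= leqnn.
Qed.

(** The union of two meeting maximal intervals is a common interval. If it is proper, maximality
    makes both equal to it. If it is [I], the right one and the rest of the left one cut [I] in two,
    unless one contains the other, which maximality settles. *)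
Lemma maximal_disjoint J K x : maximal_rng J -> maximal_rng K ->
  in_rng J x -> in_rng K x -> J = K.
Proof.
move: J K.
have H J K : J.1 < K.1 -> maximal_rng J -> maximal_rng K -> in_rng J x -> in_rng K x -> J = K.
  move=> lt [cJ pJ mJ] [cK pK mK] Jx Kx; set U := (minn J.1 K.1, maxn J.2 K.2).
  have cU : convex_rng s U := convex_cup cJ cK Jx Kx.
  have JU : subr J U by rewrite /subr /U /=; lia.
  have KU : subr K U by rewrite /subr /U /=; lia.
  case: (eqVneq U I) => [eU|nU]; last first.
    have pU : psubr U I by rewrite /psubr nU; move: pJ pK; rewrite /psubr /subr /U /=; lia.
    by rewrite -(mJ U) // -(mK U).
  have [le|gt] := leqP K.2 J.2.
    by apply: mK => //; rewrite /subr; lia.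
  have I1 : I.1 = J.1 by rewrite -eU /=; lia.
  have I2 : I.2 = K.2 by rewrite -eU /=; lia.
  case: (@unsplit K.1).
  - by rewrite I1 I2; have [? _ _] := cK; lia.
  - apply: (convex_diff cJ cK (x := K.2)) => /=; rewrite /in_rng /= ?I1; move: Jx Kx; rewrite /in_rng; lia.
  - by rewrite I2 -surjective_pairing.
move=> J K mJ mK Jx Kx; case: (ltngtP J.1 K.1) => [lt|gt|e]; first exact: H.
  by apply/esym/H.
have [[cJ pJ HJ] [cK pK HK]] := (mJ, mK).
have [le|/ltnW le] := leqP J.2 K.2.
  by apply/esym/HJ => //; rewrite /subr e leqnn.
by apply: HK => //; rewrite /subr e leqnn.
Qed.

(** Maximal proper common intervals are strong: as [I] is strong, a common interval meeting one of
    them, say [M], either contains [I] or lies in a maximal one, which is [M] by disjointness. Hence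
    nothing strong lies strictly between them and [I], and every proper strong interval lies under
    one of them. *)
Lemma tree_childE J : I.1 < I.2 -> reflect (maximal_rng J) (tree_child s I J).
Proof.
move=> lt12; have [_ sI] := elimT (strong_intervalP I ps) unsplit_strong.
have strong_max M : maximal_rng M -> strong_interval s M.
  move=> mM; have [cM pM HM] := mM; apply/strong_intervalP => //; split=> // K x cK Mx Kx.
  have Ix : in_rng I x by apply: subr_in Mx; case/andP: pM.
  case/orP: (sI K x cK Ix Kx) => [IK|KI].
    by move: pM IK; rewrite /psubr /subr; lia.
  case: (eqVneq K I) => [->|nKI]; first by case/andP: pM => ->.
  have [|M' mM' KM'] := maximal_above cK; first by rewrite /psubr KI.
  by rewrite (maximal_disjoint mM mM' Mx (subr_in KM' Kx)) KM' orbT.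
apply: (iffP idP) => [/andP[/andP[sJ pJ] H]|mJ].
  have [cJ _] := elimT (strong_intervalP J ps) sJ.
  have [M mM JM] := maximal_above cJ pJ.
  case: (eqVneq J M) => [-> //|nJM]; have [cM pM _] := mM; have [M12 Mn _] := cM.
  case/has_rangesP: H; exists M; first by rewrite M12.
  by rewrite strong_max // pM /psubr JM nJM.
have [cJ pJ HJ] := mJ; rewrite /tree_child strong_max // pJ /=.
apply/has_rangesP => -[K _ /andP[/andP[sK /andP[JK nJK]] pK]].
have [cK _] := elimT (strong_intervalP K ps) sK.
by rewrite (HJ K) ?eqxx in nJK.
Qed.

Lemma mem_children J : I.1 < I.2 -> reflect (maximal_rng J) (J \in children s I).
Proof.
move=> lt12; rewrite mem_sort mem_filter; apply: (iffP andP) => [[/(tree_childE _ lt12)] //|mJ].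
by have [[J12 Jn _] _ _] := mJ; rewrite mem_ranges J12 Jn; split=> //; apply/tree_childE.
Qed.

Lemma ranges_uniq n : uniq (ranges n).
Proof.
rewrite /ranges; apply: allpairs_uniq_dep; rewrite ?iota_uniq //.
  by move=> x _; apply: iota_uniq.
by move=> [i j] [i' j'] _ _ /= [-> ->].
Qed.

Lemma children_uniq : uniq (children s I).
Proof. by rewrite sort_uniq filter_uniq // ranges_uniq. Qed.

Lemma children_lt i j : I.1 < I.2 -> i < j < size (children s I) ->
  (nth (0, 0) (children s I) i).2 < (nth (0, 0) (children s I) j).1.
Proof.
move=> lt12 /andP[lt_ij lt_j]; have lt_i := ltn_trans lt_ij lt_j.
set cs := children s I in lt_i lt_j *.
have /mem_children mi : nth (0, 0) cs i \in cs by apply: mem_nth.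
have /mem_children mj : nth (0, 0) cs j \in cs by apply: mem_nth.
have le_ij : (nth (0, 0) cs i).1 <= (nth (0, 0) cs j).1.
  have tr : transitive (fun a b : rng => a.1 <= b.1) by move=> a b c; apply: leq_trans.
  apply: (sorted_ltn_nth tr (0, 0) _ i j) => //.
  by apply: sort_sorted => a b; apply: leq_total.
rewrite ltnNge; apply/negP => le.
have [[j12 _ _] _ _] := mj lt12.
have : nth (0, 0) cs i = nth (0, 0) cs j.
  by apply: (maximal_disjoint (mi lt12) (mj lt12) (x := (nth (0, 0) cs j).1)); rewrite /in_rng ?le_ij ?leqnn.
by move/eqP; rewrite nth_uniq ?children_uniq // => /eqP e; rewrite e ltnn in lt_ij.
Qed.

Lemma children_decompose : I.1 < I.2 -> decomposes s I (children s I).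
Proof.
move=> lt12; split=> [J /mem_children[] //|i j|k Ik]; first exact: children_lt.
by have [J mJ Jk] := maximal_at lt12 Ik; exists J => //; apply/mem_children.
Qed.

(** A union of children from [p] to [q] that is a common interval other than [I] contains child [p],
    hence equals it by maximality, although it also contains the disjoint child [q]. There are at
    least three children, because two would cut [I]. *)
Lemma unsplit_prime : I.1 < I.2 -> prime_node s I.
Proof.
move=> lt12; have [Hc Hs Hk] := children_decompose lt12; have [I12 In _] := cI.
set cs := children s I in Hc Hs Hk *.
have nthc i : i < size cs -> maximal_rng (nth (0, 0) cs i).
  by move=> lt_i; apply/mem_children => //; apply: mem_nth.
have disj i j x : i < size cs -> j < size cs -> in_rng (nth (0, 0) cs i) x ->
    in_rng (nth (0, 0) cs j) x -> i = j.
  move=> si sj Hi Hj; have /eqP := maximal_disjoint (nthc i si) (nthc j sj) Hi Hj.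
  by rewrite nth_uniq ?children_uniq // => /eqP.
(* The witnesses are the children [J1] and [J2] at the two ends and the child [J3] right after [J1];
   were [J3] equal to [J2], then [J1] and [J2] would cut [I]. *)
have size3 : 2 < size cs.
  have [J1 J1c J1x] : exists2 J : rng, J \in cs & in_rng J I.1 by apply: Hk; rewrite /in_rng leqnn.
  have [J2 J2c J2x] : exists2 J : rng, J \in cs & in_rng J I.2 by apply: Hk; rewrite /in_rng leqnn I12.
  have [cJ1 pJ1] := Hc _ J1c; have [cJ2 pJ2] := Hc _ J2c.
  have J1l : J1.1 = I.1 by move: pJ1 J1x; rewrite /psubr /subr /in_rng; lia.
  have J2r : J2.2 = I.2 by move: pJ2 J2x; rewrite /psubr /subr /in_rng; lia.
  have J1r : J1.2 < I.2.
    rewrite ltnNge; apply/negP => le; case/andP: pJ1 => _ /eqP; apply.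
    by apply: subr_anti; rewrite /subr; move: (Hc _ J1c).2; rewrite /psubr /subr; lia.
  have [J3 J3c J3x] : exists2 J : rng, J \in cs & in_rng J J1.2.+1.
    by apply: Hk; move: J1x; rewrite /in_rng; lia.
  have [cJ3 pJ3] := Hc _ J3c.
  have m1 := elimT (mem_children _ lt12) J1c; have m2 := elimT (mem_children _ lt12) J2c.
  have m3 := elimT (mem_children _ lt12) J3c.
  have n13 : J1 != J3 by apply/eqP => e; move: J3x; rewrite -e /in_rng; lia.
  have n12 : J1 != J2 by apply/eqP => e; move: J2r J1r; rewrite -e; lia.
  have n23 : J2 != J3.
    apply/eqP => e; have J3l : J3.1 = J1.2.+1.
      apply/eqP; rewrite eqn_leq; apply/andP; split; first by case/andP: J3x.
      rewrite ltnNge; apply/negP => le; case/eqP: n13.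
      by apply: (maximal_disjoint m1 m3 (x := J1.2)); move: J1x J3x; rewrite /in_rng; lia.
    apply: (@unsplit J1.2.+1).
    - by move: J1x; rewrite /in_rng; lia.
    - by rewrite -J1l -surjective_pairing.
    - by rewrite -J3l -J2r e -surjective_pairing.
  by apply: (uniq_leq_size (s1 := [:: J1; J2; J3])) => [|J];
    rewrite /= !inE ?negb_or ?n12 ?n13 ?n23 // => /or3P[] /eqP->.
rewrite /prime_node /internal_node unsplit_strong lt12 -/cs size3 /=.
apply/allP => p0 _; apply/allP => q0; move: (p0 : nat) (q0 : nat) => {p0 q0} p q.
rewrite mem_iota => pq.
have lt_pq : p < q < size cs by lia.
case: (boolP ((p == 0) && (q == (size cs).-1))) => //= npq.
apply/has_rangesP => -[J _ /andP[/andP[/(common_intervalP _ ps) cJ /allP sub1] /allP sub2]].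
have sqp : q - p < size cs - p by lia.
have memU x : reflect (exists2 i, p <= i <= q & in_rng (nth (0, 0) cs i) x)
    (x \in union_pos (take (q - p).+1 (drop p cs))).
  apply: (iffP flatten_mapP) => [[V /(nthP (0, 0))[i]]|[i ipq xi]].
    rewrite size_takel ?size_drop //.
    move=> lt_i; rewrite nth_take // nth_drop => <- xi.
    exists (p + i); first by lia.
    by rewrite -mem_iota_rng //; have [|[]] := nthc (p + i); first by lia.
  exists (nth (0, 0) cs i); last first.
    by rewrite mem_iota_rng //; have [|[]] := nthc i; first by lia.
  rewrite (_ : i = p + (i - p)); last by lia.
  rewrite -nth_drop -[X in X \in _](@nth_take (q - p).+1); last by lia.
  by rewrite mem_nth // size_takel ?size_drop // ltnS leq_sub2r; lia.
have [J12 _ _] := cJ.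
have JU x : in_rng J x = (x \in union_pos (take (q - p).+1 (drop p cs))).
  apply/idP/idP => [Jx|/sub2 //]; apply: sub1.
  by rewrite mem_iota; move: Jx; rewrite /in_rng; lia.
have part i : p <= i <= q -> subr (nth (0, 0) cs i) J.
  move=> ipq; have [|[c12 _ _] _ _] := nthc i; first by lia.
  have H x : in_rng (nth (0, 0) cs i) x -> in_rng J x by move=> xi; rewrite JU; apply/memU; exists i.
  by have := H (nth (0, 0) cs i).1; have := H (nth (0, 0) cs i).2; rewrite /subr /in_rng; lia.
have inI x : in_rng J x -> in_rng I x.
  rewrite JU => /memU[i ipq xi]; apply: subr_in xi.
  by have [|_ /andP[]] := nthc i; first by lia.
have [|_ _ Hp] := nthc p; first by lia.
have eJ : J = nth (0, 0) cs p.
  apply: Hp => //; last by apply: part; lia.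
  apply/andP; split.
    by have := inI J.1; have := inI J.2; rewrite /subr /in_rng; lia.
  apply/eqP => eJI.
  (* A child outside the union: the one after [q] if the union begins with the first child,
     otherwise the first child. *)
  have [r rc nr] : exists2 r, r < size cs & ~~ (p <= r <= q).
    by exists (if p == 0 then q.+1 else 0); move: npq; case: eqP => /=; lia.
  have [[r12 _ _] /andP[sr _] _] := nthc r rc.
  have xr : in_rng (nth (0, 0) cs r) (nth (0, 0) cs r).1 by rewrite /in_rng leqnn.
  have := subr_in sr xr; rewrite -eJI JU => /memU[i ipq xi].
  by case/negP: nr; rewrite -(disj i r _ _ rc xi xr) //; lia.
have [|[q12 _ _] _ _] := nthc q; first by lia.
have xq : in_rng (nth (0, 0) cs q) (nth (0, 0) cs q).1 by rewrite /in_rng leqnn.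
have : in_rng J (nth (0, 0) cs q).1 by apply: subr_in xq; apply: part; lia.
by rewrite eJ => xp; have := disj p q _ _ _ xp xq; lia.
Qed.

End Decomposition.

Theorem common_interval_decomposition d s I : in_R d s -> convex_rng s I -> I.1 < I.2 ->
  exists2 cs, size cs <= maxn d 2 & decomposes s I cs.
Proof.
move=> [ps Rs] cI lt12; have [I12 In _] := cI.
case: (boolP (has (fun c => common_interval s (I.1, c.-1) && common_interval s (c, I.2))
                  (iota I.1.+1 (I.2 - I.1)))).
  case/hasP=> c; rewrite mem_iota => cI12.
  case/andP=> /(common_intervalP _ ps) c1 /(common_intervalP _ ps) c2.
  exists [:: (I.1, c.-1); (c, I.2)]; first by rewrite /= leq_maxr.
  split=> [J|i j|k].
  - rewrite !inE => /orP[] /eqP->; split=> //; rewrite /psubr /subr /=.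
      by apply/andP; split; [lia|apply/eqP => /(congr1 snd) /=; lia].
    by apply/andP; split; [lia|apply/eqP => /(congr1 fst) /=; lia].
  - by case: i j => [|i] [|[|j]] //=; lia.
  - move=> Ik; exists (if k < c then (I.1, c.-1) else (c, I.2)).
      by case: ifP; rewrite !inE eqxx ?orbT.
    by move: Ik; rewrite /in_rng; case: ifP => /=; lia.
move/hasPn=> H; have ns c : I.1 < c <= I.2 -> convex_rng s (I.1, c.-1) -> convex_rng s (c, I.2) -> False.
  move=> cI12 c1 c2; have := H c; rewrite mem_iota => /(_ _)/negP; apply; first by lia.
  by apply/andP; split; apply/common_intervalP.
exists (children s I); last exact: children_decompose.
by have := Rs I (unsplit_prime ps cI ns lt12); rewrite /arity; lia.
Qed.
(** * Matchings between boxes *)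

Section Cut.
Variables (T : eqType) (L : seq T) (lev f : T -> nat) (lo hi m : nat).
Hypotheses (m_gt0 : 0 < m) (le_lohi : lo <= hi).
Hypothesis f_bound : forall e, e \in L -> lo <= f e < hi.
Hypothesis lev_bound : forall e, e \in L -> lev e < m.
Hypothesis lev_mono : {in L &, forall e e', lev e < lev e' -> f e < f e'}.

(** [lev] numbers the pieces and [f] is a coordinate that respects their order; the cut before piece
    [k] is put just above the coordinates used by earlier pieces. From [m] on all cuts are [hi], so
    that the pieces padded up to [K] get empty ranges. *)
Definition cut (k : nat) : nat :=
  if m <= k then hi else maxn lo (\max_(e <- L | lev e < k) (f e).+1).

Lemma cut0 : cut 0 = lo.
Proof. by rewrite /cut leqNgt m_gt0 big_pred0 // maxn0. Qed.

Lemma cut_end k : m <= k -> cut k = hi.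
Proof. by rewrite /cut => ->. Qed.

Lemma cut_le_hi k : cut k <= hi.
Proof.
rewrite /cut; case: ifP => // _; rewrite geq_max le_lohi /=.
by apply/bigmax_leqP_seq => e eL _; case/andP: (f_bound eL).
Qed.

Lemma cut_mono k : cut k <= cut k.+1.
Proof.
rewrite {2}/cut; case: ifP => [_|lt]; first exact: cut_le_hi.
rewrite /cut ifF; last by lia.
rewrite geq_max leq_maxl /= leq_max; apply/orP; right.
apply/bigmax_leqP_seq => e eL lt_e; apply: leq_bigmax_seq eL _; exact: ltnW.
Qed.

Lemma cut_mem e : e \in L -> cut (lev e) <= f e < cut (lev e).+1.
Proof.
move=> eL; apply/andP; split.
  rewrite /cut ifF; last by have := lev_bound eL; lia.
  rewrite geq_max; case/andP: (f_bound eL) => -> _ /=.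
  by apply/bigmax_leqP_seq => e' e'L; apply: lev_mono.
rewrite /cut; case: ifP => _; first by case/andP: (f_bound eL).
rewrite leq_max; apply/orP; right; exact: (@leq_bigmax_seq _ _ (fun e' => lev e' < (lev e).+1) (fun e => (f e).+1) e eL (ltnSn _)).
Qed.

End Cut.

Lemma ltn_count (T : eqType) (P Q : pred T) (l : seq T) x : subpred P Q ->
  x \in l -> Q x -> ~~ P x -> count P l < count Q l.
Proof.
move=> PQ xl Qx nPx; rewrite -(size_filter Q) -(count_predC P (filter Q l)) !count_filter.
rewrite (eq_count (a1 := predI P Q) (a2 := P)); last by move=> y /=; case: (boolP (P y)) => [/PQ->|].
rewrite -[X in X < _]addn0 ltn_add2l -has_count; apply/hasP; exists x => //=.
by rewrite nPx.
Qed.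

(** [X] and [Y] cut the positions and values of the first permutation, [Z] and [W] those of the
    second. The piece in place [i] by position has place [rho i] by value in both. *)
Definition subbox (X Y Z W rho : nat -> nat) (i : nat) : seq nat :=
  [:: X i; X i.+1; Y (rho i); Y (rho i).+1; Z i; Z i.+1; W (rho i); W (rho i).+1].

Definition hull (X Y Z W : nat -> nat) (K : nat) : seq nat :=
  [:: X 0; X K; Y 0; Y K; Z 0; Z K; W 0; W K].

Definition cuts_mono (K : nat) (X : nat -> nat) := forall k, k < K -> X k <= X k.+1.

Lemma cuts_monoW K X i j : cuts_mono K X -> i <= j -> j <= K -> X i <= X j.
Proof.
move=> mono; elim: j => [|j IH]; first by rewrite leqn0 => /eqP->.
rewrite leq_eqVlt ltnS => /orP[/eqP-> //|le_ij] lt_jK.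
by apply: leq_trans (IH le_ij (ltnW lt_jK)) (mono _ lt_jK).
Qed.

Definition inj_below (K : nat) (rho : nat -> nat) :=
  (forall i, i < K -> rho i < K) /\ (forall i j, i < K -> j < K -> rho i = rho j -> i = j).

Section Matchings.
Variables s t : seq nat.

Definition in_box (B : seq nat) (e : nat * nat) : bool :=
  if B is [:: x0; x1; y0; y1; z0; z1; w0; w1] then
    [&& x0 <= e.1 < x1, y0 <= nth 0 s e.1 < y1, z0 <= e.2 < z1, w0 <= nth 0 t e.2 < w1,
        e.1 < size s & e.2 < size t]
  else false.

Definition compatible (e e' : nat * nat) : Prop :=
  (e.1 < e'.1) = (e.2 < e'.2) /\ (nth 0 s e.1 < nth 0 s e'.1) = (nth 0 t e.2 < nth 0 t e'.2).

(** A common pattern without its normal form: one occurrence in each permutation, paired element by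
    element. *)
Definition matching (B : seq nat) (M : seq (nat * nat)) : Prop :=
  [/\ forall e : nat * nat, e \in M -> in_box B e, forall e e' : nat * nat, e \in M -> e' \in M -> compatible e e'
    & uniq M].

Lemma matching0 B : matching B [::].
Proof. by split. Qed.

Lemma flatten_uniq (T : eqType) (Ms : nat -> seq T) (l : seq nat) : uniq l ->
  (forall i, i \in l -> uniq (Ms i)) ->
  (forall i j e, i \in l -> j \in l -> e \in Ms i -> e \in Ms j -> i = j) ->
  uniq (flatten (map Ms l)).
Proof.
elim: l => //= i l IH /andP[il ul] uM dM; rewrite cat_uniq uM ?mem_head //= IH //.
- rewrite andbT; apply/hasPn => e /flatten_mapP[j jl ej]; apply/negP => ei.
  by move: il; rewrite (dM i j e) ?mem_head ?inE ?jl ?orbT.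
- by move=> j jl; apply: uM; rewrite inE jl orbT.
- by move=> j k e jl kl; apply: dM; rewrite inE ?jl ?kl orbT.
Qed.

(** Pairs from different pieces compare in position as the pieces do, and in value as their images
    under [rho] do, in both permutations alike; so they are compatible whatever the permutations
    are. *)
Lemma matching_union K X Y Z W rho Ms :
  cuts_mono K X -> cuts_mono K Y -> cuts_mono K Z -> cuts_mono K W -> inj_below K rho ->
  (forall i, i < K -> matching (subbox X Y Z W rho i) (Ms i)) ->
  matching (hull X Y Z W K) (flatten (map Ms (iota 0 K))).
Proof.
move=> mX mY mZ mW [rK rI] HM.
have memM (e : nat * nat) : e \in flatten (map Ms (iota 0 K)) -> exists2 i, i < K & e \in Ms i.
  by case/flatten_mapP=> i; rewrite mem_iota => iK ei; exists i.
have boxM i (e : nat * nat) : i < K -> e \in Ms i -> in_box (subbox X Y Z W rho i) e.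
  by move=> /HM[H _ _]; apply: H.
have lt_M i j (e e' : nat * nat) : i < j -> j < K -> e \in Ms i -> e' \in Ms j -> e.1 < e'.1 /\ e.2 < e'.2.
  move=> lt_ij jK ei ej; have iK := ltn_trans lt_ij jK.
  have /and5P[b1 _ b3 _ _] := boxM i e iK ei; have /and5P[b1' _ b3' _ _] := boxM j e' jK ej.
  have := cuts_monoW mX lt_ij (ltnW jK); have := cuts_monoW mZ lt_ij (ltnW jK); lia.
have lt_V i j (e e' : nat * nat) : rho i < rho j -> i < K -> j < K -> e \in Ms i -> e' \in Ms j ->
    nth 0 s e.1 < nth 0 s e'.1 /\ nth 0 t e.2 < nth 0 t e'.2.
  move=> lt_ij iK jK ei ej.
  have /and5P[_ b2 _ b4 _] := boxM i e iK ei; have /and5P[_ b2' _ b4' _] := boxM j e' jK ej.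
  have := cuts_monoW mY lt_ij (ltnW (rK _ jK)); have := cuts_monoW mW lt_ij (ltnW (rK _ jK)); lia.
split.
- move=> e /memM[i iK ei]; have /and5P[b1 b2 b3 b4 b5] := boxM i e iK ei; rewrite /in_box /= b5.
  have rKi := rK _ iK.
  have := cuts_monoW mX (leq0n i) (ltnW iK); have := cuts_monoW mX iK (leqnn K).
  have := cuts_monoW mZ (leq0n i) (ltnW iK); have := cuts_monoW mZ iK (leqnn K).
  have := cuts_monoW mY (leq0n (rho i)) (ltnW rKi); have := cuts_monoW mY rKi (leqnn K).
  have := cuts_monoW mW (leq0n (rho i)) (ltnW rKi); have := cuts_monoW mW rKi (leqnn K).
  lia.
- move=> e e' /memM[i iK ei] /memM[j jK ej]; rewrite /compatible.
  case: (ltngtP i j) => [lt|gt|eij].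
  + have [-> ->] := lt_M _ _ _ _ lt jK ei ej.
    case: (ltngtP (rho i) (rho j)) => [ltr|gtr|/rI eqr].
    * by have [-> ->] := lt_V _ _ _ _ ltr iK jK ei ej.
    * have := lt_V _ _ _ _ gtr jK iK ej ei; lia.
    * by rewrite (eqr iK jK) ltnn in lt.
  + have := lt_M _ _ _ _ gt iK ej ei.
    case: (ltngtP (rho i) (rho j)) => [ltr|gtr|/rI eqr].
    * have := lt_V _ _ _ _ ltr iK jK ei ej; lia.
    * have := lt_V _ _ _ _ gtr jK iK ej ei; lia.
    * by rewrite (eqr iK jK) ltnn in gt.
  + by subst j; have [_ H _] := HM i iK; apply: H.
- apply: flatten_uniq => [|i|i j e]; first exact: iota_uniq.
    by rewrite mem_iota => /HM[].
  rewrite !mem_iota => iK jK ei ej; case: (ltngtP i j) => // lt.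
    by have := lt_M _ _ _ _ lt jK ei ej; rewrite ltnn => -[].
  by have := lt_M _ _ _ _ lt iK ej ei; rewrite ltnn => -[].
Qed.

(* [derivable N K r (v :: B)]: [r] rounds of the dynamic program, with coordinates at most
   [N] and boxes cut into at most [K] pieces along each axis, find a matching of size [v] in [B]. *)
Inductive derivable (N K : nat) : nat -> seq nat -> Prop :=
| Derivable_nil r B : size B = 8 -> all (leq^~ N) B -> derivable N K r (0 :: B)
| Derivable_point r B e : all (leq^~ N) B -> in_box B e -> derivable N K r (1 :: B)
| Derivable_join r X Y Z W rho V :
    cuts_mono K X -> cuts_mono K Y -> cuts_mono K Z -> cuts_mono K W -> inj_below K rho ->
    (forall k, [/\ X k <= N, Y k <= N, Z k <= N & W k <= N]) ->
    (forall i, i < K -> V i <= N) -> \sum_(0 <= i < K) V i <= N ->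
    (forall i, i < K -> derivable N K r (V i :: subbox X Y Z W rho i)) ->
    derivable N K r.+1 (\sum_(0 <= i < K) V i :: hull X Y Z W K).

(** On the side of [s] the box contains the whole interval [I], since the cuts there separate the
    parts of [I] and not just the matched positions. On the side of [t] only matched positions are
    separated; as there may be none, [z0 <= z1] and [w0 <= w1] are imposed. *)
Definition frames (I : rng) (B : seq nat) : Prop :=
  if B is [:: x0; x1; y0; y1; z0; z1; w0; w1] then
    [/\ x0 <= I.1, I.2 < x1, forall k, in_rng I k -> y0 <= nth 0 s k < y1, z0 <= z1 & w0 <= w1]
  else False.

Definition fits (N : nat) (I : rng) (B : seq nat) (M : seq (nat * nat)) : Prop :=
  [/\ matching B M, forall e : nat * nat, e \in M -> in_rng I e.1, frames I B & all (leq^~ N) B].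

(** * Cutting a matching along a decomposition of its interval *)

Section Step.
Variables (N K : nat) (I : rng) (cs : seq rng).
Hypotheses (ps : is_perm s) (cI : convex_rng s I) (dec : decomposes s I cs) (csK : size cs <= K).

Let part i := nth (0, 0) cs i.
Let idx k := find (in_rng^~ k) cs.
(** The place of a part by value, read at its first element because any element gives the same
    comparison. Beyond the number of parts the identity completes it to a permutation of [K]
    places. *)
Let rnk i := if i < size cs then
    count (fun J : rng => nth 0 s J.1 < nth 0 s (part i).1) cs else i.

Lemma part_convex i : i < size cs -> convex_rng s (part i) /\ psubr (part i) I.
Proof. by move=> lt; case: dec => H _ _; apply: H; apply: mem_nth. Qed.

Lemma part_lt i j x y : i < j -> j < size cs -> in_rng (part i) x -> in_rng (part j) y -> x < y.
Proof.
by move=> lt lj; case: dec => _ H _; have := H i j; rewrite lt lj /part /in_rng => /(_ isT); lia.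
Qed.

Lemma part_disjoint i j x : i < size cs -> j < size cs ->
  in_rng (part i) x -> in_rng (part j) x -> i = j.
Proof.
move=> si sj xi xj; case: (ltngtP i j) => // lt.
  by have := part_lt lt sj xi xj; rewrite ltnn.
by have := part_lt lt si xj xi; rewrite ltnn.
Qed.

Lemma part_in i x : i < size cs -> in_rng (part i) x -> in_rng I x.
Proof. by move=> /part_convex[_]; rewrite /psubr /subr /in_rng; lia. Qed.

Lemma part_fst i : i < size cs -> in_rng (part i) (part i).1.
Proof. by move=> /part_convex[[le _ _] _]; rewrite /in_rng leqnn. Qed.

Lemma part_snd i : i < size cs -> in_rng (part i) (part i).2.
Proof. by move=> /part_convex[[le _ _] _]; rewrite /in_rng leqnn andbT. Qed.

Lemma rng_size x : in_rng I x -> x < size s.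
Proof. by case: cI => _ + _; rewrite /in_rng; lia. Qed.

Lemma idx_part k : in_rng I k -> idx k < size cs /\ in_rng (part (idx k)) k.
Proof.
case: dec => _ _ H /H[J Jc Jk].
have hk : has (in_rng^~ k) cs by apply/hasP; exists J.
by rewrite /idx -has_find; split=> //; apply: (nth_find (0, 0) hk).
Qed.

Lemma idx_eq i k : i < size cs -> in_rng (part i) k -> idx k = i.
Proof.
move=> si ik; have [lt Hk] := idx_part (part_in si ik).
exact: part_disjoint lt si Hk ik.
Qed.

Lemma idx_lt k k' : in_rng I k -> in_rng I k' -> idx k < idx k' -> k < k'.
Proof. by move=> /idx_part[s1 p1] /idx_part[s2 p2] lt; apply: part_lt lt s2 p1 p2. Qed.

(** Were the order reversed for [k'] and [l'], then [l] or [k'] would have a value between two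
    values of the other part and belong to it by convexity. *)
Lemma part_value_lt i j k l k' l' : i < size cs -> j < size cs -> i <> j ->
  in_rng (part i) k -> in_rng (part j) l -> nth 0 s k < nth 0 s l ->
  in_rng (part i) k' -> in_rng (part j) l' -> nth 0 s k' < nth 0 s l'.
Proof.
move=> si sj nij ik jl lt ik' jl'; have [ci _] := part_convex si; have [cj _] := part_convex sj.
have sz x i' : i' < size cs -> in_rng (part i') x -> x < size s by move=> si' /(part_in si')/rng_size.
have [_ _ Hi] := ci; have [_ _ Hj] := cj; rewrite ltnNge; apply/negP => le.
have nl x : in_rng (part j) x -> ~ in_rng (part i) x.
  by move=> jx ix; apply: nij; apply: part_disjoint ix jx.
have [le2|gt2] := leqP (nth 0 s l) (nth 0 s k').
  apply: (nl l jl); apply: (Hi k k') => //; first exact: sz jl.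
  by rewrite (ltnW lt).
apply: (nl k' _ ik'); apply: (Hj l' l) => //; first exact: sz ik'.
by rewrite le (ltnW gt2).
Qed.

Lemma rnk_lt_value i j : i < size cs -> j < size cs ->
  (rnk i < rnk j) = (nth 0 s (part i).1 < nth 0 s (part j).1).
Proof.
have H a b : a < size cs -> b < size cs ->
    nth 0 s (part a).1 < nth 0 s (part b).1 -> rnk a < rnk b.
  move=> sa sb lt; rewrite /rnk sa sb; apply: (ltn_count (x := part a)).
  - by move=> J /= /ltn_trans; apply.
  - exact: mem_nth.
  - exact: lt.
  - by rewrite ltnn.
move=> si sj; apply/idP/idP; last exact: H.
case: (ltngtP (nth 0 s (part i).1) (nth 0 s (part j).1)) => // [gt|e].
  by have := H _ _ sj si gt; lia.
by rewrite /rnk si sj e ltnn.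
Qed.

Lemma rnk_below i : i < size cs -> rnk i < size cs.
Proof.
move=> si; rewrite {1}/rnk si -(count_predT cs).
by apply: (ltn_count (x := part i)) => //; [apply: mem_nth|rewrite ltnn].
Qed.

Lemma rnk_out i : size cs <= i -> rnk i = i.
Proof. by move=> ge; rewrite /rnk ifF //; lia. Qed.

Lemma rnk_inj : inj_below K rnk.
Proof.
split=> [i iK|i j iK jK].
  case: (ltnP i (size cs)) => [/rnk_below lt|ge]; first exact: leq_trans lt csK.
  by rewrite rnk_out.
case: (ltnP i (size cs)) => [si|ge]; case: (ltnP j (size cs)) => [sj|ge'].
- move=> e; have e' : nth 0 s (part i).1 = nth 0 s (part j).1.
    by have := rnk_lt_value si sj; have := rnk_lt_value sj si; rewrite e ltnn; lia.
  apply: (part_disjoint (x := (part i).1)) => //; first exact: part_fst.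
  rewrite (perm_nth_inj ps _ _ e') ?part_fst //.
    by apply/rng_size/(part_in si)/part_fst.
  by apply/rng_size/(part_in sj)/part_fst.
- by rewrite (rnk_out ge') => e; have := rnk_below si; lia.
- by rewrite (rnk_out ge) => e; have := rnk_below sj; lia.
- by rewrite !rnk_out.
Qed.

Lemma rnk_value k k' : in_rng I k -> in_rng I k' -> rnk (idx k) < rnk (idx k') ->
  nth 0 s k < nth 0 s k'.
Proof.
move=> /idx_part[s1 p1] /idx_part[s2 p2] lt.
have n12 : idx k <> idx k' by move=> e; rewrite e ltnn in lt.
apply: (part_value_lt s1 s2 n12 (part_fst s1) (part_fst s2)) => //.
by rewrite -rnk_lt_value.
Qed.

(** Compatibility carries the order of matched positions and values from [s] to [t], so the parts of
    [I] induce cuts of [t] as well. Each piece receives the pairs that start in its part; pieces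
    beyond the parts receive none. *)
Lemma fits_split B M : fits N I B M -> exists X Y Z W rho Ms,
  [/\ B = hull X Y Z W K,
      [/\ cuts_mono K X, cuts_mono K Y, cuts_mono K Z, cuts_mono K W & inj_below K rho],
      forall k, [/\ X k <= N, Y k <= N, Z k <= N & W k <= N],
      size M = \sum_(0 <= i < K) size (Ms i) &
      forall i, i < K -> if i < size cs then fits N (part i) (subbox X Y Z W rho i) (Ms i)
                         else Ms i = [::]].
Proof.
move: B => [|x0 [|x1 [|y0 [|y1 [|z0 [|z1 [|w0 [|w1 [|? ?]]]]]]]]] // [mM MI fB BN] //.
have [fx0 fx1 fy fz fw] := fB; have [I12 In _] := cI.
have I1 : in_rng I I.1 by rewrite /in_rng leqnn.
have m0 : 0 < size cs by have [lt _] := idx_part I1; lia.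
have y01 : y0 <= y1 by have := fy _ I1; lia.
pose L := filter (in_rng I) (iota 0 (size s)).
have LI k : (k \in L) = in_rng I k.
  by rewrite mem_filter mem_iota; case: (boolP (in_rng I k)) => //= /rng_size.
have [boxM cM uM] := mM.
pose lev k := rnk (idx k).
pose X := cut L idx id x0 x1 (size cs).
pose Y := cut L lev (nth 0 s) y0 y1 (size cs).
pose Z := cut M (fun e => idx e.1) snd z0 z1 (size cs).
pose W := cut M (fun e => lev e.1) (fun e => nth 0 t e.2) w0 w1 (size cs).
have Xb e : e \in L -> x0 <= e < x1 by rewrite LI /in_rng; lia.
have Yb e : e \in L -> y0 <= nth 0 s e < y1 by rewrite LI; apply: fy.
have Zb e : e \in M -> z0 <= e.2 < z1 by move=> /boxM /and5P[].
have Wb e : e \in M -> w0 <= nth 0 t e.2 < w1 by move=> /boxM /and5P[].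
have il k : in_rng I k -> idx k < size cs by case/idx_part.
have ll k : in_rng I k -> lev k < size cs by move=> /il/rnk_below.
have Xl e : e \in L -> idx e < size cs by rewrite LI; apply: il.
have Yl e : e \in L -> lev e < size cs by rewrite LI; apply: ll.
have Zl e : e \in M -> idx e.1 < size cs by move/MI/il.
have Wl e : e \in M -> lev e.1 < size cs by move/MI/ll.
have Xm : {in L &, forall e e', idx e < idx e' -> e < e'}.
  by move=> e e'; rewrite !LI; apply: idx_lt.
have Ym : {in L &, forall e e', lev e < lev e' -> nth 0 s e < nth 0 s e'}.
  by move=> e e'; rewrite !LI; apply: rnk_value.
have Zm : {in M &, forall e e', idx e.1 < idx e'.1 -> e.2 < e'.2}.
  by move=> e e' eM e'M; rewrite -(cM e e' eM e'M).1; apply: idx_lt; apply: MI.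
have Wm : {in M &, forall e e', lev e.1 < lev e'.1 -> nth 0 t e.2 < nth 0 t e'.2}.
  by move=> e e' eM e'M; rewrite -(cM e e' eM e'M).2; apply: rnk_value; apply: MI.
have x01 : x0 <= x1 by lia.
pose Ms i := filter (fun e => idx e.1 == i) M.
have [Nx1 Ny1 Nz1 Nw1] : [/\ x1 <= N, y1 <= N, z1 <= N & w1 <= N].
  by split; apply: (allP BN); rewrite !inE eqxx ?orbT.
have leN k : [/\ X k <= N, Y k <= N, Z k <= N & W k <= N].
  split.
  - exact: leq_trans (cut_le_hi idx (f := id) _ x01 Xb k) Nx1.
  - exact: leq_trans (cut_le_hi lev _ y01 Yb k) Ny1.
  - exact: leq_trans (cut_le_hi (fun e => idx e.1) _ fz Zb k) Nz1.
  - exact: leq_trans (cut_le_hi (fun e => lev e.1) _ fw Wb k) Nw1.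
exists X, Y, Z, W, rnk, Ms; split=> //.
- by rewrite /hull /X /Y /Z /W !cut0 ?cut_end.
- split; last exact: rnk_inj.
  + by move=> k _; apply: cut_mono.
  + by move=> k _; apply: cut_mono.
  + by move=> k _; apply: cut_mono.
  + by move=> k _; apply: cut_mono.
- transitivity (\sum_(0 <= i < K) count (fun e => idx e.1 == i) M); last first.
    by apply: eq_bigr => i _; rewrite size_filter.
  have : all (fun e => idx e.1 < K) M.
    by apply/allP => e /Zl/leq_trans; apply.
  elim: (M) => [|e M' IH] /=; first by rewrite big1.
  case/andP=> eK /IH ->; rewrite big_split /= -add1n; congr (_ + _).
  rewrite (bigD1_seq (idx e.1)) ?mem_index_iota ?iota_uniq //=.
  by rewrite eqxx big1 // => i; rewrite eq_sym => /negbTE->.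
- move=> i iK; case: ifP => [si|/negbT]; last first.
    rewrite -leqNgt => ge; apply/eqP; rewrite -size_eq0 size_filter -leqn0 leqNgt -has_count.
    by apply/hasP => -[e /Zl lt /eqP e1]; rewrite e1 ltnNge ge in lt.
  have Li k : in_rng (part i) k -> k \in L by move=> ik; rewrite LI; apply: part_in si ik.
  split.
  + split; last exact: filter_uniq.
      move=> e; rewrite mem_filter => /andP[/eqP ei eM].
      have /and5P[_ _ _ _ b5] := boxM e eM; rewrite /in_box /= b5 !andbT.
      have e1L : e.1 \in L by rewrite LI; apply: MI.
      have := cut_mem m0 x01 Xb Xl Xm e1L; have := cut_mem m0 y01 Yb Yl Ym e1L.
      have := cut_mem m0 fz Zb Zl Zm eM; have := cut_mem m0 fw Wb Wl Wm eM.
      by rewrite /lev ei => -> -> -> ->.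
    by move=> e e'; rewrite !mem_filter => /andP[_ eM] /andP[_ e'M]; apply: cM.
  + move=> e; rewrite mem_filter => /andP[/eqP <- /MI/idx_part[] //].
  + split.
    * by have := cut_mem m0 x01 Xb Xl Xm (Li _ (part_fst si)); rewrite (idx_eq si (part_fst si)) => /andP[].
    * by have := cut_mem m0 x01 Xb Xl Xm (Li _ (part_snd si)); rewrite (idx_eq si (part_snd si)) => /andP[].
    * by move=> k ik; have := cut_mem m0 y01 Yb Yl Ym (Li _ ik); rewrite /lev (idx_eq si ik).
    * exact: cut_mono.
    * exact: cut_mono.
  + have [? ? ? ?] := leN i; have [? _ ? _] := leN i.+1.
    have [_ ? _ ?] := leN (rnk i); have [_ ? _ ?] := leN (rnk i).+1.
    by rewrite /= !andbT; do !(apply/andP; split).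
Qed.

End Step.

Lemma compatible_eq e e' : compatible e e' -> compatible e' e -> (e.1 == e'.1) = (e.2 == e'.2).
Proof. by move=> [h1 _] [h2 _]; rewrite !eqn_leq (leqNgt e.1) (leqNgt e'.1) h1 h2 -!leqNgt. Qed.

Lemma matching_eq1 B M e e' : matching B M -> e \in M -> e' \in M -> e.1 = e'.1 -> e = e'.
Proof.
move=> [_ cM _] eM e'M e1; have := compatible_eq (cM e e' eM e'M) (cM e' e e'M eM).
by rewrite e1 eqxx => /esym/eqP e2; rewrite [LHS]surjective_pairing e1 e2 -surjective_pairing.
Qed.

Lemma matching_eq2 B M e e' : matching B M -> e \in M -> e' \in M -> e.2 = e'.2 -> e = e'.
Proof.
move=> [_ cM _] eM e'M e2; have := compatible_eq (cM e e' eM e'M) (cM e' e e'M eM).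
by rewrite e2 eqxx => /eqP e1; rewrite [LHS]surjective_pairing e1 e2 -surjective_pairing.
Qed.

Lemma matching_uniq1 B M : matching B M -> uniq (unzip1 M).
Proof.
move=> mM; have [_ _ uM] := mM; rewrite map_inj_in_uniq // => e e' eM e'M.
exact: matching_eq1 mM eM e'M.
Qed.

Lemma in_box_size B e : in_box B e -> (e.1 < size s) && (e.2 < size t).
Proof.
by case: B => [|? [|? [|? [|? [|? [|? [|? [|? [|? ?]]]]]]]]] // /and5P[].
Qed.

Lemma matching_size B M : matching B M -> size M <= size t.
Proof.
move=> mM; have [bM _ uM] := mM; rewrite -(size_map snd) -(size_iota 0 (size t)).
apply: uniq_leq_size.
  by rewrite map_inj_in_uniq // => e e' eM e'M; apply: matching_eq2 mM eM e'M.
by move=> q /mapP[e eM ->]; rewrite mem_iota; have /andP[] := in_box_size (bM e eM).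
Qed.

Lemma fits_point N K I B M r : I.2 <= I.1 -> fits N I B M -> derivable N K r (size M :: B).
Proof.
move=> I21 [mM MI fB BN]; have sizeB : size B = 8.
  by move: fB; case: (B) => [|? [|? [|? [|? [|? [|? [|? [|? [|? ?]]]]]]]]].
have [boxM _ uM] := mM.
move: boxM mM MI uM; case: M => [|e [|e' M']] boxM mM MI uM.
- by constructor.
- by apply: Derivable_point BN (boxM _ (mem_head _ _)).
- have eM : e \in [:: e, e' & M'] by rewrite mem_head.
  have e'M : e' \in [:: e, e' & M'] by rewrite !inE eqxx orbT.
  have e1 : e.1 = e'.1 by have := MI e eM; have := MI e' e'M; rewrite /in_rng; lia.
  by move: uM; rewrite /= (matching_eq1 mM eM e'M e1) mem_head.
Qed.

(** A part is proper, hence shorter than [I], and this pays for the round. Places without a part are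
    filled by the empty matching, available in every round. [size t <= N] keeps all sizes within the
    range of the table. *)
Lemma fits_derivable d N I B M r : in_R d s -> convex_rng s I -> I.2 - I.1 <= r -> size t <= N ->
  fits N I B M -> derivable N (maxn d 2) r (size M :: B).
Proof.
move=> Rs + + tN; have ps := Rs.1; elim: r I B M => [|r IH] I B M cI le_r fM.
  by apply: fits_point fM; lia.
have [lt12|ge12] := ltnP I.1 I.2; last exact: fits_point fM.
have [mM _ _ _] := fM; have [I12 In _] := cI.
have [cs csK dec] := common_interval_decomposition Rs cI lt12.
have [X [Y [Z [W [rho [Ms [eB [mX mY mZ mW rI] leN eM HM]]]]]]] := fits_split ps cI dec csK fM.
have subN i : all (leq^~ N) (subbox X Y Z W rho i).
  have [? ? ? ?] := leN i; have [? _ ? _] := leN i.+1.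
  have [_ ? _ ?] := leN (rho i); have [_ ? _ ?] := leN (rho i).+1.
  by rewrite /= !andbT; do !(apply/andP; split).
rewrite eB eM; apply: (Derivable_join mX mY mZ mW rI leN).
- move=> i iK; have := HM i iK; case: ifP => [_ [/matching_size le _ _ _]|_ -> //].
  exact: leq_trans le tN.
- by rewrite -eM; apply: leq_trans (matching_size mM) tN.
- move=> i iK; have := HM i iK; case: ifP => [si fi|_ ->]; last by constructor.
  have [ci /andP[sub ne]] := part_convex dec si.
  have [c12 _ _] := ci; apply: IH ci _ fi; rewrite -ltnS; apply: leq_trans le_r.
  rewrite ltnNge; apply: contra ne => le; apply/eqP.
  by rewrite [LHS]surjective_pairing [RHS]surjective_pairing; congr pair; move: sub; rewrite /subr; lia.
Qed.

End Matchings.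
(** * Common patterns as matchings *)

Lemma order_isoP a b :
  reflect (size a = size b /\ forall i j, i < size a -> j < size a ->
             (nth 0 a i < nth 0 a j) = (nth 0 b i < nth 0 b j)) (order_iso a b).
Proof.
apply: (iffP andP) => -[/eqP sz H]; split=> //.
- move=> i j si sj; have mi : i \in iota 0 (size a) by rewrite mem_iota.
  have mj : j \in iota 0 (size a) by rewrite mem_iota.
  have Hi := allP H i mi; have /eqP := allP Hi j mj; exact.
- apply/allP => i; rewrite mem_iota => si; apply/allP => j; rewrite mem_iota => sj.
  by apply/eqP/H.
Qed.

Lemma sorted_nth_ltn (P : seq nat) i j : sorted ltn P -> i < size P -> j < size P ->
  (nth 0 P i < nth 0 P j) = (i < j).
Proof.
move=> sP si sj; have H a b : a < b -> b < size P -> nth 0 P a < nth 0 P b.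
  by move=> lt lb; apply: (sorted_ltn_nth ltn_trans 0 sP) => //; rewrite inE //; apply: ltn_trans lb.
case: (ltngtP i j) => [lt|gt|->]; last exact: ltnn.
  exact: H.
by apply/negbTE; rewrite -leqNgt; apply/ltnW/H.
Qed.

Lemma sorted_subseq_iota (P : seq nat) n : sorted ltn P -> all (ltn^~ n) P -> subseq P (iota 0 n).
Proof.
move=> sP /allP lP; suff -> : P = filter (mem P) (iota 0 n) by apply: filter_subseq.
apply: (irr_sorted_eq ltn_trans ltnn) => //; first exact/(sorted_filter ltn_trans)/iota_ltn_sorted.
move=> x; rewrite mem_filter mem_iota /=; case: (boolP (x \in P)) => xP; rewrite ?xP ?(negbTE xP) //=.
by rewrite add0n; apply/esym/lP.
Qed.

Lemma sorted_subseq_nth s (P : seq nat) : sorted ltn P -> all (ltn^~ (size s)) P ->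
  subseq (map (nth 0 s) P) s.
Proof.
by move=> sP lP; rewrite -{2}(mkseq_nth 0 s); apply/map_subseq/sorted_subseq_iota.
Qed.

Lemma subseq_positions u s : subseq u s ->
  exists P, [/\ sorted ltn P, all (ltn^~ (size s)) P & u = map (nth 0 s) P].
Proof.
case/subseqP=> m sm ->; exists (mask m (iota 0 (size s))).
have sub := mask_subseq m (iota 0 (size s)); split.
- by apply: (subseq_sorted ltn_trans sub); apply: iota_ltn_sorted.
- by apply/allP => i /(mem_subseq sub); rewrite mem_iota.
- by rewrite map_mask -/(mkseq _ _) mkseq_nth.
Qed.

Definition full_box (N : nat) : seq nat := [:: 0; N; 0; N; 0; N; 0; N].

Lemma in_full_box s t N e : is_perm s -> is_perm t -> size s <= N -> size t <= N ->
  in_box s t (full_box N) e = (e.1 < size s) && (e.2 < size t).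
Proof.
move=> ps pt sN tN; rewrite /in_box /=; case: (ltnP e.1 (size s)) => [es|]; rewrite ?andbF //=.
case: (ltnP e.2 (size t)) => [et|]; rewrite ?andbF //= !andbT.
have : nth 0 s e.1 < size s by rewrite -mem_perm // mem_nth.
have : nth 0 t e.2 < size t by rewrite -mem_perm // mem_nth.
lia.
Qed.

Lemma common_pattern_matching s t pi N : is_perm s -> is_perm t -> size s <= N -> size t <= N ->
  is_pattern pi s -> is_pattern pi t -> exists2 M, matching s t (full_box N) M & size M = size pi.
Proof.
move=> ps pt sN tN [_ [u [us /order_isoP[zu iu]]]] [_ [v [vt /order_isoP[zv iv]]]].
have [P [sP lP eu]] := subseq_positions us; have [Q [sQ lQ ev]] := subseq_positions vt.
have zP : size P = size pi by rewrite -zu eu size_map.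
have zQ : size Q = size pi by rewrite -zv ev size_map.
have zPQ : size P = size Q by rewrite zP zQ.
exists (zip P Q); last by rewrite size_zip zP zQ minnn.
have memZ (e : nat * nat) : e \in zip P Q -> exists2 i, i < size P & e = (nth 0 P i, nth 0 Q i).
  move/(nthP (0, 0)) => [i]; rewrite size_zip -zPQ minnn => si <-.
  by exists i; rewrite ?nth_zip.
split; last by apply/zip_uniql/(sorted_uniq ltn_trans ltnn sP).
- move=> e /memZ[i si ->]; rewrite in_full_box //=.
  apply/andP; split; first exact: (allP lP _ (mem_nth 0 si)).
  by apply: (allP lQ _ (mem_nth 0 _)); rewrite -zPQ.
- move=> e e' /memZ[i si ->] /memZ[j sj ->]; rewrite /compatible /=.
  split; first by rewrite (sorted_nth_ltn sP) // (sorted_nth_ltn sQ) -?zPQ.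
  have := iu i j; have := iv i j; rewrite eu ev !size_map.
  by rewrite !(nth_map 0) -?zPQ // => -> // ->.
Qed.

Definition standardize (a : seq nat) : seq nat := [seq count (fun y => y < x) a | x <- a].

Lemma count_ltn_mono (a : seq nat) x y : x \in a -> y \in a ->
  (count (fun z => z < x) a < count (fun z => z < y) a) = (x < y).
Proof.
move=> xa ya; case: (ltnP x y) => [lt|le].
  apply: (ltn_count (x := x)) => //; last by rewrite ltnn.
  by move=> z /= /ltn_trans; apply.
by apply/negbTE; rewrite -leqNgt; apply: sub_count => z /= /leq_trans; apply.
Qed.

Lemma standardize_perm a : uniq a -> is_perm (standardize a).
Proof.
move=> ua; have us : uniq (standardize a).
  rewrite map_inj_in_uniq // => x y xa ya e.
  have := count_ltn_mono xa ya; have := count_ltn_mono ya xa; rewrite e ltnn; lia.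
have sub : {subset standardize a <= iota 0 (size a)}.
  move=> _ /mapP[x xa ->]; rewrite mem_iota /= -(count_predT a).
  by apply: (ltn_count (x := x)) => //; rewrite ltnn.
have sz : size (standardize a) = size a by rewrite size_map.
rewrite /is_perm sz; apply: uniq_perm; rewrite ?iota_uniq //.
by have [|_] := uniq_min_size us sub; rewrite ?size_iota ?sz.
Qed.

Lemma standardize_iso a b : size b = size a ->
  (forall i j, i < size a -> j < size a -> (nth 0 a i < nth 0 a j) = (nth 0 b i < nth 0 b j)) ->
  order_iso b (standardize a).
Proof.
move=> zb H; apply/order_isoP; rewrite size_map; split=> // i j; rewrite zb => si sj.
by rewrite !(nth_map 0) // count_ltn_mono ?mem_nth // H.
Qed.

(** The matched positions of [s] alone determine the pattern, written here in the form in which the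
    program prints it. Its occurrence in [t] follows each position to its partner [q i];
    compatibility keeps the partners increasing. *)
Lemma matching_patterns s t N B M : is_perm s -> size s <= N -> matching s t B M ->
  let idxs := [seq i <- iota 0 N.+1 | i \in unzip1 M] in
  let pi := standardize (map (nth 0 s) idxs) in
  [/\ is_pattern pi s, is_pattern pi t & size pi = size M].
Proof.
move=> ps sN mM idxs pi; have [bM cM uM] := mM.
have idxM i : (i \in idxs) = (i \in unzip1 M).
  rewrite mem_filter mem_iota; case: (boolP (i \in unzip1 M)) => //= /mapP[e eM ->].
  by have /andP[] := in_box_size (bM e eM); lia.
have sI : sorted ltn idxs by apply/(sorted_filter ltn_trans)/iota_ltn_sorted.
have lI : all (ltn^~ (size s)) idxs.
  by apply/allP => i; rewrite idxM => /mapP[e eM ->]; have /andP[] := in_box_size (bM e eM).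
have uI : uniq idxs by apply: sorted_uniq ltn_trans ltnn _ sI.
have zI : size idxs = size M.
  rewrite -(size_map fst M); apply/perm_size/uniq_perm => //; exact: matching_uniq1 mM.
have ppi : is_perm pi.
  apply: standardize_perm; rewrite map_inj_in_uniq // => i j iI jI.
  by apply: perm_nth_inj => //; apply: (allP lI).
pose q i := (nth (0, 0) M (index i (unzip1 M))).2.
have qM i : i \in idxs -> (i, q i) \in M.
  rewrite idxM => iM; have si : index i (unzip1 M) < size M by rewrite -(size_map fst M) index_mem.
  rewrite (_ : (i, q i) = nth (0, 0) M (index i (unzip1 M))) ?mem_nth //.
  rewrite [RHS]surjective_pairing; congr (_, _).
  by rewrite -(nth_map (0, 0) 0 fst) // nth_index.
have qC i j : i \in idxs -> j \in idxs -> compatible s t (i, q i) (j, q j).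
  by move=> /qM iM /qM jM; apply: cM.
split; last by rewrite /pi !size_map zI.
- split=> //; exists (map (nth 0 s) idxs); split; first exact: sorted_subseq_nth.
  exact: standardize_iso.
- split=> //; exists (map (nth 0 t) (map q idxs)); split.
    apply: sorted_subseq_nth.
      rewrite sorted_map; apply: (sub_in_sorted (P := [in idxs]) (e := ltn)) sI.
        by move=> i j iI jI /=; rewrite (qC i j iI jI).1.
      exact/allP.
    apply/allP => _ /mapP[i iI ->] /=.
    by have /andP[] := in_box_size (bM _ (qM i iI)).
  apply: standardize_iso; first by rewrite !size_map.
  move=> i j; rewrite !size_map => si sj; rewrite -map_comp !(nth_map 0) //=.
  by rewrite (qC _ _ (mem_nth 0 si) (mem_nth 0 sj)).2.
Qed.
(** * Rules for loops *)

Lemma loop_ind (S : Type) (P : nat -> S -> Prop) (f : S -> nat -> S) s n :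
  P 0 s -> (forall i s', i <= n -> P i s' -> P i.+1 (f s' i)) -> P n.+1 (loop f s n).
Proof.
move=> P0 PS; rewrite /loop.
suff H m k s' : k + m = n.+1 -> P k s' -> P n.+1 (foldl f s' (iota k m)) by apply: H P0.
elim: m k s' => [|m IH] k s' e Pk; first by rewrite -e addn0.
by apply: IH; [lia|apply: PS => //; lia].
Qed.

Lemma loop_inv (S : Type) (P : S -> Prop) (f : S -> nat -> S) s n :
  P s -> (forall i s', i <= n -> P s' -> P (f s' i)) -> P (loop f s n).
Proof. exact: (@loop_ind S (fun _ => P)). Qed.

Lemma loop_visit (S : Type) (P Q : S -> Prop) (f : S -> nat -> S) s n i :
  i <= n -> P s -> (forall j s', j <= n -> P s' -> P (f s' j)) ->
  (forall j s', j <= n -> Q s' -> Q (f s' j)) ->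
  (forall s', P s' -> Q (f s' i)) -> Q (loop f s n).
Proof.
move=> le_in Ps PP QQ PQ.
suff: P (loop f s n) /\ (i < n.+1 -> Q (loop f s n)) by case=> _; apply.
apply: (loop_ind (P := fun k s' => P s' /\ (i < k -> Q s'))) => // j s' le_jn [Ps' Qs'].
split; first exact: PP.
rewrite ltnS leq_eqVlt => /orP[/eqP <-|/Qs']; [exact: PQ|exact: QQ].
Qed.

Lemma loop_single (S : Type) (P : S -> Prop) (f : S -> nat -> S) s n i :
  i <= n -> P s -> P (f s i) -> (forall j s', j <> i -> P s' -> f s' j = s') ->
  loop f s n = f s i.
Proof.
move=> le_in Ps Pfs H.
have: n.+1 <= i /\ loop f s n = s \/ i < n.+1 /\ loop f s n = f s i; last first.
  by case=> -[] //; rewrite ltnNge le_in.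
apply: (loop_ind (P := fun k s' => k <= i /\ s' = s \/ i < k /\ s' = f s i)); first by left.
move=> j s' _ [[le ->]|[lt ->]].
  case: (eqVneq j i) => [->|/eqP ne]; [by right|left; rewrite H //; split=> //; lia].
by right; rewrite H ?ltnS ?(ltnW lt) //; lia.
Qed.

Fixpoint writes (t : nat) (b : bool) (c : cmd) : bool :=
  match c with
  | Seq c1 c2 | AIf _ _ c1 c2 | IfEq _ _ c1 c2 | IfCnt _ _ c1 c2 => writes t b c1 || writes t b c2
  | ASet t' _ b' => (t' == t) && (b' == b)
  | For _ _ c => writes t b c
  | _ => false
  end.

Fixpoint prints (c : cmd) : bool :=
  match c with
  | Seq c1 c2 | AIf _ _ c1 c2 | IfEq _ _ c1 c2 | IfCnt _ _ c1 c2 => prints c1 || prints c2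
  | For _ _ c => prints c
  | Out _ => true
  | _ => false
  end.

Lemma sem_keep c r s t b k : ~~ writes t (~~ b) c -> arr s t k = b -> arr (sem c r s) t k = b.
Proof.
elim: c r s => //= [c1 IH1 c2 IH2|t' xs b'|t' xs c1 IH1 c2 IH2|x y c1 IH1 c2 IH2|x j c1 IH1 c2 IH2|x y c IH] r s.
- by rewrite negb_or => /andP[w1 w2] e; apply: IH2 => //; apply: IH1.
- rewrite /upd eq_sym; case: (eqVneq t t') => [->|//] /=.
  by case: (k == _) => //; case: b b' => [] [].
- by rewrite negb_or => /andP[w1 w2] e; case: ifP => _; [apply: IH1|apply: IH2].
- by rewrite negb_or => /andP[w1 w2] e; case: ifP => _; [apply: IH1|apply: IH2].
- by rewrite negb_or => /andP[w1 w2] e; case: ifP => _; [apply: IH1|apply: IH2].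
- by move=> w e; apply: (loop_inv (P := fun s => arr s t k = b)) => // i s' _ e'; apply: IH.
Qed.

Lemma sem_frame c r s t : ~~ writes t true c -> ~~ writes t false c ->
  arr (sem c r s) t = arr s t.
Proof.
move=> wt wf; apply: functional_extensionality => k.
by apply: sem_keep => //; case: (arr s t k).
Qed.

Lemma sem_out c r s : ~~ prints c -> out (sem c r s) = out s.
Proof.
elim: c r s => //= [c1 IH1 c2 IH2|t' xs c1 IH1 c2 IH2|x y c1 IH1 c2 IH2|x j c1 IH1 c2 IH2|x y c IH] r s.
- by rewrite negb_or => /andP[w1 w2]; rewrite IH2 ?IH1.
- by rewrite negb_or => /andP[w1 w2]; case: ifP => _; [apply: IH1|apply: IH2].
- by rewrite negb_or => /andP[w1 w2]; case: ifP => _; [apply: IH1|apply: IH2].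
- by rewrite negb_or => /andP[w1 w2]; case: ifP => _; [apply: IH1|apply: IH2].
- move=> w; apply: (loop_inv (P := fun s' => out s' = out s)) => // i s' _ <-; exact: IH.
Qed.

Fixpoint touches (j : nat) (c : cmd) : bool :=
  match c with
  | Seq c1 c2 | AIf _ _ c1 c2 | IfEq _ _ c1 c2 | IfCnt _ _ c1 c2 => touches j c1 || touches j c2
  | For _ _ c => touches j c
  | Inc j' | Reset j' => j' == j
  | _ => false
  end.

Lemma sem_cnt c r s j : ~~ touches j c -> cnt (sem c r s) j = cnt s j.
Proof.
elim: c r s => //= [c1 IH1 c2 IH2|t' xs c1 IH1 c2 IH2|x y c1 IH1 c2 IH2|x i c1 IH1 c2 IH2|j'|j'|x y c IH] r s.
- by rewrite negb_or => /andP[w1 w2]; rewrite IH2 ?IH1.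
- by rewrite negb_or => /andP[w1 w2]; case: ifP => _; [apply: IH1|apply: IH2].
- by rewrite negb_or => /andP[w1 w2]; case: ifP => _; [apply: IH1|apply: IH2].
- by rewrite negb_or => /andP[w1 w2]; case: ifP => _; [apply: IH1|apply: IH2].
- by move=> w; rewrite upd_other // eq_sym.
- by move=> w; rewrite upd_other // eq_sym.
- move=> w; apply: (loop_inv (P := fun s' => cnt s' j = cnt s j)) => // i s' _ <-; exact: IH.
Qed.

(** * Nests of loops as exhaustive search *)

Definition nest (L : seq (lvar * lvar)) (c : cmd) : cmd :=
  foldr (fun xy c' => For xy.1 xy.2 c') c L.

Lemma writes_nest t b L c : writes t b (nest L c) = writes t b c.
Proof. by elim: L. Qed.

Lemma prints_nest L c : prints (nest L c) = prints c.
Proof. by elim: L. Qed.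

(** No bound is rebound by its own loop or a later one, so it keeps its value down to the innermost
    environment; this is why [extends] can compare a variable with its bound there. *)
Fixpoint nest_ok (L : seq (lvar * lvar)) : bool :=
  if L is (x, y) :: L' then [&& x \notin unzip1 L', y \notin x :: unzip1 L' & nest_ok L'] else true.

Definition extends (L : seq (lvar * lvar)) (r r' : lvar -> nat) : Prop :=
  (forall z, z \notin unzip1 L -> r' z = r z) /\ (forall x y, (x, y) \in L -> r' x <= r' y).

Lemma extends_cons x y L r r' i : nest_ok ((x, y) :: L) -> i <= r y ->
  extends L (upd r x i) r' -> extends ((x, y) :: L) r r'.
Proof.
move=> /= /and3P[xL + okL] le_i [e1 e2]; rewrite inE negb_or => /andP[yx yL]; split=> [z|x' y'].
  by rewrite inE negb_or => /andP[zx zL]; rewrite e1 // upd_other.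
rewrite inE => /orP[/eqP[-> ->]|]; last exact: e2.
by rewrite !e1 // upd_same upd_other.
Qed.

Lemma extends_uncons x y L r r' : nest_ok ((x, y) :: L) ->
  extends ((x, y) :: L) r r' -> r' x <= r y /\ extends L (upd r x (r' x)) r'.
Proof.
move=> /= /and3P[xL + okL] [e1 e2]; rewrite inE negb_or => /andP[yx yL].
have yE : r' y = r y by rewrite e1 // inE negb_or yx.
split; first by rewrite -yE; apply: e2; rewrite inE eqxx.
split=> [z zL|a b ab]; last by apply: e2; rewrite inE ab orbT.
by rewrite /upd; case: eqP => [->//|/eqP zx]; rewrite e1 // inE negb_or zx.
Qed.

Lemma nest_inv (P : store -> Prop) L c r s : nest_ok L ->
  (forall r' s', extends L r r' -> P s' -> P (sem c r' s')) -> P s -> P (sem (nest L c) r s).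
Proof.
elim: L r s => [|[x y] L IH] r s ok H Ps; first by apply: H => //; split.
apply: loop_inv => // i s' le_i Ps'; apply: IH => //; first by case/and3P: ok.
by move=> r' s2 ex; apply: H; apply: extends_cons ok le_i ex.
Qed.

(** [r0] is the assignment at which the search succeeds: every turn keeps [P], the turn at [r0]
    derives [Q] from it, and later turns keep [Q]. *)
Lemma nest_visit (P Q : store -> Prop) L c r r0 s : nest_ok L ->
  (forall r' s', extends L r r' -> P s' -> P (sem c r' s')) ->
  (forall r' s', Q s' -> Q (sem c r' s')) ->
  extends L r r0 -> (forall s', P s' -> Q (sem c r0 s')) -> P s -> Q (sem (nest L c) r s).
Proof.
elim: L r s => [|[x y] L IH] r s ok HP HQ ex PQ Ps.
  have e : r0 = r by apply: functional_extensionality => z; apply: ex.1.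
  by rewrite -e; apply: PQ.
have [le_x ex'] := extends_uncons ok ex; have okL : nest_ok L by case/and3P: ok.
have HP' i : i <= r y -> forall r' s', extends L (upd r x i) r' -> P s' -> P (sem c r' s').
  by move=> le_i r' s' e; apply: HP; apply: extends_cons ok le_i e.
apply: (loop_visit (P := P) (i := r0 x)) => //.
- by move=> i s' le_i; apply: nest_inv => //; apply: HP'.
- by move=> i s' _; apply: nest_inv => // r' s2 _; apply: HQ.
- by move=> s'; apply: IH => //; apply: HP'.
Qed.

Fixpoint nest_scope (G : seq lvar) (L : seq (lvar * lvar)) : seq lvar :=
  if L is (x, _) :: L' then nest_scope (x :: G) L' else G.

Fixpoint nest_wf (G : seq lvar) (L : seq (lvar * lvar)) : bool :=
  if L is (x, y) :: L' then [&& y \in G, x \notin G & nest_wf (x :: G) L'] else true.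

Lemma cwf_nest G L c : cwf G (nest L c) = nest_wf G L && cwf (nest_scope G L) c.
Proof. by elim: L G => //= -[x y] L IH G /=; rewrite IH !andbA. Qed.

Lemma mem_nest_scope G L x : (x \in nest_scope G L) = (x \in unzip1 L) || (x \in G).
Proof.
elim: L G => //= -[y z] L IH G; rewrite IH !inE /=.
by case: (x == y); rewrite ?orbT.
Qed.

Lemma map_upd (T : eqType) (r : T -> nat) x i (l : seq T) : x \notin l -> map (upd r x i) l = map r l.
Proof.
move=> xl; apply/eq_in_map => y yl; rewrite upd_other //.
by apply: contraNneq xl => <-.
Qed.
(** * The dynamic program *)

(* Arrays: 6 and 7 hold the points [(i, value)] of the two permutations; 8 is set at [v :: B]
   once a matching of size [v] has been found in the pair of boxes [B], and then 9 holds at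
   [m :: v :: B] whether this matching uses position [m] of the first permutation; 10 is the
   final selection of positions and 11 tells whether the separator has been read.
   Counters: 0 and 1 hold the index and the value being read, 2 is the constant 1 and 3 a sum.
   Loop variables: [(1, i)], ..., [(4, i)] are the cuts of the positions and values of the
   first permutation, then of the second one, and [(5, i)] is the size found in piece [i]. *)
Definition vv : lvar := (0, 2).
Definition vm : lvar := (0, 3).
Definition vr : lvar := (0, 4).
Definition vt : lvar := (0, 5).
Definition vp : lvar := (0, 6).
Definition vu : lvar := (0, 7).
Definition vq : lvar := (0, 8).
Definition vw : lvar := (0, 9).

(** The language has no boolean expressions, so a test is passed as a command [g] with its two
    branches left open. *)
Definition set_mask (t : nat) (tgt : seq lvar) (g : cmd -> cmd -> cmd) : cmd :=
  For vm vN (g (ASet t (vm :: tgt) true) (ASet t (vm :: tgt) false)).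

(** An entry is filled at most once. This also protects the copying of masks: the entries read by a
    join are filled and its target is not, so writing the mask of the target cannot alter what is
    being read. *)
Definition claim (tgt : seq lvar) (g : cmd -> cmd -> cmd) : cmd :=
  AIf 8 tgt Skip (Seq (set_mask 9 tgt g) (ASet 8 tgt true)).

Definition agree_off (t : nat) (l : seq nat) (st st' : store) : Prop :=
  forall t' k, t' <> t \/ behead k <> l -> arr st' t' k = arr st t' k.

Lemma sem_set_mask t tgt g r st cond : vm \notin tgt ->
  (forall i st' c1 c2, i <= r vN -> agree_off t (map r tgt) st st' ->
     sem (g c1 c2) (upd r vm i) st' = sem (if cond i then c1 else c2) (upd r vm i) st') ->
  agree_off t (map r tgt) st (sem (set_mask t tgt g) r st) /\
  (forall i, i <= r vN -> arr (sem (set_mask t tgt g) r st) t (i :: map r tgt) = cond i).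
Proof.
move=> mt Hg /=.
apply: (loop_ind (P := fun j st' => agree_off t (map r tgt) st st' /\
  forall i, i < j -> arr st' t (i :: map r tgt) = cond i)) => // i st' le_i [off H].
rewrite (Hg _ _ _ _ le_i off).
rewrite (_ : sem _ _ _ = Store (cnt st')
   (upd (arr st') t (upd (arr st' t) (i :: map r tgt) (cond i))) (out st')); last first.
  by case: (cond i); rewrite /= upd_same map_upd.
split=> [t' k ne|i' lt_i'] /=.
  rewrite -off // /upd; case: eqP => // et; case: eqP => [ek|_]; last by rewrite et.
  by case: ne; rewrite ?et ?ek.
rewrite upd_same /upd; case: eqP => [[->] //|ne]; apply: H.
by move: lt_i'; rewrite ltnS leq_eqVlt => /orP[/eqP e|//]; rewrite e in ne.
Qed.

Lemma claimE tgt g r st : sem (claim tgt g) r st =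
  if arr st 8 (map r tgt) then st else sem (ASet 8 tgt true) r (sem (set_mask 9 tgt g) r st).
Proof. by []. Qed.

Section Claim.
Variables (sg ta : seq nat) (N : nat).

Definition witness (k : seq nat) (P : nat -> bool) : Prop :=
  exists M, [/\ matching sg ta (behead k) M, size M = head 0 k &
                forall m, m <= N -> P m = (m \in unzip1 M)].

Definition dp_inv (st : store) : Prop :=
  [/\ forall a b, arr st 6 [:: a; b] = (a < size sg) && (nth 0 sg a == b),
      forall a b, arr st 7 [:: a; b] = (a < size ta) && (nth 0 ta a == b) &
      forall k, arr st 8 k -> witness k (fun m => arr st 9 (m :: k))].

Lemma dp_inv_eq st st' : arr st' = arr st -> dp_inv st -> dp_inv st'.
Proof. by rewrite /dp_inv => ->. Qed.

Lemma claim_inv r st tgt g cond : r vN = N -> vm \notin tgt ->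
  (forall i st' c1 c2, i <= N -> ~~ arr st 8 (map r tgt) -> agree_off 9 (map r tgt) st st' ->
     sem (g c1 c2) (upd r vm i) st' = sem (if cond i then c1 else c2) (upd r vm i) st') ->
  (~~ arr st 8 (map r tgt) -> witness (map r tgt) cond) ->
  dp_inv st -> dp_inv (sem (claim tgt g) r st) /\ arr (sem (claim tgt g) r st) 8 (map r tgt).
Proof.
move=> rN mt Hg Hw inv; rewrite claimE; case: ifPn => // nF; have [iS iT iF] := inv.
have [|off Hc] := @sem_set_mask 9 tgt g r st cond mt; first by move=> i st' c1 c2; rewrite rN => /Hg; apply.
set st1 := sem _ _ _ in off Hc *; split; last by rewrite /= !upd_same.
split=> [a b|a b|k] /=.
- by rewrite upd_other // off //; left.
- by rewrite upd_other // off //; left.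
- rewrite upd_same /upd; case: eqP => [-> _|ne].
    have [M [mM zM PM]] := Hw nF; exists M; split=> // m le_m.
    by rewrite /= Hc ?rN // PM.
  rewrite off; last by left.
  move/iF => [M [mM zM PM]]; exists M; split=> // m le_m.
  by rewrite /= off ?PM //; right.
Qed.

End Claim.

Definition box_key (rho : nat -> nat) (i : nat) : seq lvar :=
  [:: (1, i); (1, i.+1); (2, rho i); (2, (rho i).+1);
      (3, i); (3, i.+1); (4, rho i); (4, (rho i).+1)].

Definition hull_key (K : nat) : seq lvar :=
  [:: (1, 0); (1, K); (2, 0); (2, K); (3, 0); (3, K); (4, 0); (4, K)].

(** No mask is written: that of the empty matching is all false, as array 9 is at the start. *)
Definition base_empty : cmd :=
  nest [seq (x, vN) | x <- hull_key 1] (ASet 8 (vZ :: hull_key 1) true).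

(** Only equality can be tested, so order is expressed by loop bounds: [(1, 0)] runs up to [vp] and
    [vp] up to [(1, 1)], where equality is excluded because boxes are half-open. The constant 1 is
    available as counter 2. *)
Definition base_point : cmd :=
  nest [:: (vv, vN); ((1, 1), vN); (vp, (1, 1)); ((1, 0), vp);
           ((2, 1), vN); (vu, (2, 1)); ((2, 0), vu);
           ((3, 1), vN); (vq, (3, 1)); ((3, 0), vq);
           ((4, 1), vN); (vw, (4, 1)); ((4, 0), vw)]
    (IfCnt vv 2
      (IfEq vp (1, 1) Skip (IfEq vu (2, 1) Skip (IfEq vq (3, 1) Skip (IfEq vw (4, 1) Skip
        (AIf 6 [:: vp; vu] (AIf 7 [:: vq; vw] (claim (vv :: hull_key 1) (IfEq vm vp)) Skip)
          Skip)))))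
      Skip).

(** A loop includes its bound and would count one too many, so the turn at the bound itself is
    skipped. *)
Definition size_sum (K : nat) : cmd :=
  Seq (Reset 3) (foldr (fun i c => Seq (For vt (5, i) (IfEq vt (5, i) Skip (Inc 3))) c) Skip
    (iota 0 K)).

Definition any_mask (rho : nat -> nat) (l : seq nat) (c1 c2 : cmd) : cmd :=
  foldr (fun i c => AIf 9 (vm :: (5, i) :: box_key rho i) c1 c) c2 l.

Definition when_all (rho : nat -> nat) (l : seq nat) (c : cmd) : cmd :=
  foldr (fun i c' => AIf 8 ((5, i) :: box_key rho i) c' Skip) c l.

Definition join_body (K : nat) (rho : nat -> nat) : cmd :=
  when_all rho (iota 0 K) (Seq (size_sum K) (IfCnt vv 3
    (claim (vv :: hull_key K) (any_mask rho (iota 0 K))) Skip)).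

(** Each cut is bounded by the next one, so only nondecreasing sequences are searched; the last cut
    is chosen first, in [cuts], with bound [vN]. *)
Fixpoint chain (k K : nat) (L : seq (lvar * lvar)) : seq (lvar * lvar) :=
  if K is j.+1 then ((k, j), (k, j.+1)) :: chain k j L else L.

Definition cuts (k K : nat) (L : seq (lvar * lvar)) : seq (lvar * lvar) :=
  ((k, K), vN) :: chain k K L.

Fixpoint sizes (K : nat) (L : seq (lvar * lvar)) : seq (lvar * lvar) :=
  if K is j.+1 then ((5, j), vN) :: sizes j L else L.

Definition join_loops (K : nat) : seq (lvar * lvar) :=
  cuts 1 K (cuts 2 K (cuts 3 K (cuts 4 K (sizes K [:: (vv, vN)])))).

Definition join (K : nat) (rho : nat -> nat) : cmd := nest (join_loops K) (join_body K rho).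

Definition fun_below (K : nat) (f : {ffun 'I_K -> 'I_K}) (i : nat) : nat :=
  if insub i is Some j then val (f j) else i.

Definition round (K : nat) : cmd :=
  foldr Seq Skip [seq join K (fun_below f) | f <- enum [pred f : {ffun 'I_K -> 'I_K} | injectiveb f]].

Lemma mem_chain k K L x :
  (x \in unzip1 (chain k K L)) = (x.1 == k) && (x.2 < K) || (x \in unzip1 L).
Proof.
elim: K => [|K IH] /=; first by rewrite ltn0 andbF.
rewrite inE IH {IH}; case: x => a b; rewrite xpair_eqE /= orbA ltnS (leq_eqVlt b K).
by case: (a == k).
Qed.

Lemma mem_cuts k K L x :
  (x \in unzip1 (cuts k K L)) = (x.1 == k) && (x.2 <= K) || (x \in unzip1 L).
Proof.
rewrite /= inE mem_chain; case: x => a b; rewrite xpair_eqE /= orbA (leq_eqVlt b K).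
by case: (a == k).
Qed.

Lemma mem_sizes K L x : (x \in unzip1 (sizes K L)) = (x.1 == 5) && (x.2 < K) || (x \in unzip1 L).
Proof.
elim: K => [|K IH] /=; first by rewrite ltn0 andbF.
rewrite inE IH {IH}; case: x => a b; rewrite xpair_eqE /= orbA ltnS (leq_eqVlt b K).
by case: (a == 5).
Qed.

Lemma mem_join_loops K x : (x \in unzip1 (join_loops K)) =
  [|| (0 < x.1 < 5) && (x.2 <= K), (x.1 == 5) && (x.2 < K) | x == vv].
Proof.
rewrite !mem_cuts mem_sizes inE; case: x => a b /=.
by case: a => [|[|[|[|[|[|a]]]]]] //=; rewrite ?orbF ?orbb.
Qed.

Lemma nest_ok_chain k K L : nest_ok L -> (forall i, i <= K -> (k, i) \notin unzip1 L) ->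
  nest_ok (chain k K L).
Proof.
move=> okL; elim: K => //= K IH HK; rewrite inE !mem_chain /= !(negbTE (HK _ _)) //.
rewrite IH => [|i le]; last by apply: HK; apply: leqW.
by rewrite xpair_eqE !eqxx; lia.
Qed.

Lemma nest_ok_cuts k K L : 0 < k -> nest_ok L -> (forall i, i <= K -> (k, i) \notin unzip1 L) ->
  vN \notin unzip1 L -> nest_ok (cuts k K L).
Proof.
move=> k0 okL HK NL; rewrite /= inE !mem_chain /= nest_ok_chain // (negbTE (HK _ _)) // (negbTE NL).
by rewrite ltnn andbF /vN xpair_eqE; case: (k) k0.
Qed.

Lemma nest_ok_join K : nest_ok (join_loops K).
Proof.
have okV : nest_ok (sizes K [:: (vv, vN)]).
  by elim: K => //= K ->; rewrite inE !mem_sizes !inE /= ltnn.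
have ok4 : nest_ok (cuts 4 K (sizes K [:: (vv, vN)])).
  by apply: nest_ok_cuts okV _ _ => // [i _|]; rewrite mem_sizes inE.
have ok3 : nest_ok (cuts 3 K (cuts 4 K (sizes K [:: (vv, vN)]))).
  by apply: nest_ok_cuts ok4 _ _ => // [i _|]; rewrite mem_cuts mem_sizes inE.
have ok2 : nest_ok (cuts 2 K (cuts 3 K (cuts 4 K (sizes K [:: (vv, vN)])))).
  by apply: nest_ok_cuts ok3 _ _ => // [i _|]; rewrite !mem_cuts mem_sizes inE.
by apply: nest_ok_cuts ok2 _ _ => // [i _|]; rewrite !mem_cuts mem_sizes inE.
Qed.

Lemma join_loops_chain K k i : 0 < k < 5 -> i < K -> ((k, i), (k, i.+1)) \in join_loops K.
Proof.
have inC L : i < K -> ((k, i), (k, i.+1)) \in chain k K L.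
  elim: K => //= K IH; rewrite ltnS leq_eqVlt inE => /orP[/eqP->|/IH->]; first by rewrite eqxx.
  by rewrite orbT.
have sub p k' L : p \in L -> p \in cuts k' K L.
  move=> pL; rewrite inE; apply/orP; right; elim: {inC} K => //= j IH.
  by rewrite inE IH orbT.
move=> k5 lt_iK; have {}inC L : ((k, i), (k, i.+1)) \in cuts k K L by rewrite inE inC ?orbT.
rewrite /join_loops; case: k k5 inC => [|[|[|[|[|k]]]]] // _ inC.
- by apply: sub; apply: inC.
- by do 2!apply: (sub); apply: inC.
- by do 3!apply: (sub); apply: inC.
Qed.

Definition key_of (r : lvar -> nat) (rho : nat -> nat) (i : nat) : seq nat :=
  r (5, i) :: subbox (fun k => r (1, k)) (fun k => r (2, k)) (fun k => r (3, k))
    (fun k => r (4, k)) rho i.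

Definition hull_of (r : lvar -> nat) (K : nat) : seq nat :=
  hull (fun k => r (1, k)) (fun k => r (2, k)) (fun k => r (3, k)) (fun k => r (4, k)) K.

Lemma sem_when_all rho l c r st : sem (when_all rho l c) r st =
  if all (fun i => arr st 8 (key_of r rho i)) l then sem c r st else st.
Proof. by elim: l => //= i l ->; case: ifP. Qed.

Lemma sem_any_mask rho l c1 c2 r st i : 
  sem (any_mask rho l c1 c2) (upd r vm i) st =
  sem (if has (fun j => arr st 9 (i :: key_of r rho j)) l then c1 else c2) (upd r vm i) st.
Proof. by elim: l => //= j l ->; case: ifP. Qed.

Lemma sem_size_sum K r st : [/\ arr (sem (size_sum K) r st) = arr st,
  out (sem (size_sum K) r st) = out st &
  cnt (sem (size_sum K) r st) 3 = \sum_(0 <= i < K) r (5, i)].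
Proof.
rewrite /size_sum /index_iota subn0 [sem _ _ _]/=; set st0 := Store _ _ _.
have -> : \sum_(i <- iota 0 K) r (5, i) = cnt st0 3 + \sum_(i <- iota 0 K) r (5, i).
  by rewrite /= upd_same.
rewrite -[arr st]/(arr st0) -[out st]/(out st0).
elim: (iota 0 K) (st0) => [|i l IH] s; first by rewrite big_nil addn0.
rewrite big_cons [sem _ _ _]/=; set s1 := loop _ _ _.
have -> : s1 = Store (upd (cnt s) 3 (cnt s 3 + r (5, i))) (arr s) (out s).
  rewrite -[in RHS](minn_idPr (leqnSn (r (5, i)))).
  apply: (@loop_ind _ (fun j s' => s' =
    Store (upd (cnt s) 3 (cnt s 3 + minn j (r (5, i)))) (arr s) (out s))) => [|j s' le_j ->].
    by case: s {s1} => c a o /=; rewrite min0n addn0 upd_id.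
  rewrite /= upd_same upd_other //; case: eqP => [->|ne].
    by rewrite (minn_idPr (leqnSn _)) minnn.
  by rewrite upd_upd upd_same -addnS; congr (Store (upd _ _ (_ + _)) _ _); lia.
by have [-> -> ->] := IH (Store (upd (cnt s) 3 (cnt s 3 + r (5, i))) (arr s) (out s)); rewrite /= upd_same addnA.
Qed.

Lemma foldr_visit (P Q : store -> Prop) (T : eqType) (F : T -> cmd) l x r s : x \in l ->
  (forall y s', y \in l -> P s' -> P (sem (F y) r s')) ->
  (forall y s', Q s' -> Q (sem (F y) r s')) -> (forall s', P s' -> Q (sem (F x) r s')) ->
  P s -> Q (sem (foldr Seq Skip (map F l)) r s).
Proof.
move=> + + QQ PQ; elim: l s => //= y l IH s xl PP Ps.
have QS s' : Q s' -> Q (sem (foldr Seq Skip (map F l)) r s').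
  by elim: (l) s' => //= z l' IHl s' Qs'; apply: IHl; apply: QQ.
case: (eqVneq x y) xl => [exy _|ne]; first by apply: QS; rewrite -exy; apply: PQ.
rewrite inE (negbTE ne) /= => xl; apply: IH => //; last by apply: PP; rewrite ?mem_head.
by move=> z s' zl; apply: PP; rewrite inE zl orbT.
Qed.

(** * Soundness and completeness of the table *)

Section Phases.
Variables (sg ta : seq nat) (N : nat).
Notation inv := (dp_inv sg ta N).

Lemma in_unzip1_flatten (Ms : nat -> seq (nat * nat)) (l : seq nat) m :
  (m \in unzip1 (flatten (map Ms l))) = has (fun i => m \in unzip1 (Ms i)) l.
Proof.
by elim: l => //= i l <-; rewrite /unzip1 map_cat mem_cat.
Qed.

Lemma choose_seq (T : Type) (P : nat -> T -> Prop) (x0 : T) K :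
  (forall i, i < K -> exists x, P i x) -> exists f, forall i, i < K -> P i (f i).
Proof.
elim: K => [|K IH] H; first by exists (fun _ => x0).
have [f Hf] := IH (fun i lt => H i (ltnW lt)); have [x Px] := H K (ltnSn K).
exists (upd f K x) => i; rewrite ltnS leq_eqVlt /upd => /orP[/eqP->|lt]; first by rewrite eqxx.
by rewrite ifN; [apply: Hf|rewrite neq_ltn lt].
Qed.

Lemma join_witness K rho r st : inj_below K rho ->
  (forall k i, 0 < k < 5 -> i < K -> r (k, i) <= r (k, i.+1)) -> inv st ->
  all (fun i => arr st 8 (key_of r rho i)) (iota 0 K) ->
  witness sg ta N (\sum_(0 <= i < K) r (5, i) :: hull_of r K)
    (fun m => has (fun j => arr st 9 (m :: key_of r rho j)) (iota 0 K)).
Proof.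
move=> rI mono [_ _ iF] /allP HF.
have [i iK|Ms HM] := @choose_seq _ (fun i M => [/\ matching sg ta (behead (key_of r rho i)) M,
  size M = r (5, i) & forall m, m <= N -> arr st 9 (m :: key_of r rho i) = (m \in unzip1 M)]) [::] K.
  have [|M HM] := iF (key_of r rho i); first by apply: HF; rewrite mem_iota.
  by exists M.
exists (flatten (map Ms (iota 0 K))); split.
- apply: (@matching_union sg ta K (fun k => r (1, k)) (fun k => r (2, k)) (fun k => r (3, k))
    (fun k => r (4, k)) rho Ms _ _ _ _ rI); try by move=> k; apply: mono.
  by move=> i /HM[].
- rewrite size_flatten /shape -map_comp sumnE big_map /index_iota subn0 [RHS]/=.
  by apply: eq_big_seq => i; rewrite mem_iota => /HM[].
- move=> m le_m; rewrite in_unzip1_flatten; apply: eq_in_has => i.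
  by rewrite mem_iota => /HM[_ _ ->].
Qed.

Lemma join_body_inv K rho r st : inj_below K rho -> r vN = N ->
  (forall k i, 0 < k < 5 -> i < K -> r (k, i) <= r (k, i.+1)) ->
  inv st -> inv (sem (join_body K rho) r st) /\
  (all (fun i => arr st 8 (key_of r rho i)) (iota 0 K) ->
   r vv = \sum_(0 <= i < K) r (5, i) ->
   arr (sem (join_body K rho) r st) 8 (r vv :: hull_of r K)).
Proof.
move=> rI rN mono iv; rewrite sem_when_all; case: ifPn => // HF.
have [ea eo ec] := sem_size_sum K r st; set st1 := sem (size_sum K) r st in ea eo ec.
rewrite -[sem (Seq _ _) r st]/(sem (IfCnt vv 3 (claim (vv :: hull_key K) (any_mask rho (iota 0 K))) Skip) r st1).
have iv1 : inv st1 := dp_inv_eq ea iv.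
have HF1 : all (fun i => arr st1 8 (key_of r rho i)) (iota 0 K) by rewrite ea.
rewrite [sem (IfCnt _ _ _ _) _ _]/= -/(claim _ _) ec; case: eqP => // ev.
rewrite -[r vv :: hull_of r K]/(map r (vv :: hull_key K)).
have [||||//] := @claim_inv sg ta N r st1 (vv :: hull_key K) (any_mask rho (iota 0 K))
  (fun m => has (fun j => arr st1 9 (m :: key_of r rho j)) (iota 0 K)) rN.
- by [].
- move=> i st' c1 c2 _ nF off; rewrite sem_any_mask; congr (sem (if _ then _ else _) _ _).
  apply: eq_in_has => j jK /=; rewrite off //; right=> e.
  by case/negP: nF; rewrite -e; apply: (allP HF1).
- by move=> _; rewrite [map _ _]/= ev; apply: join_witness.
- exact: iv1.
Qed.

Lemma writes_when_all t b rho l c : writes t b (when_all rho l c) = writes t b c.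
Proof. by elim: l => //= i l ->; rewrite orbF. Qed.

Lemma prints_when_all rho l c : prints (when_all rho l c) = prints c.
Proof. by elim: l => //= i l ->; rewrite orbF. Qed.

Lemma writes_any_mask t b rho l c1 c2 : ~~ writes t b c1 -> ~~ writes t b c2 ->
  ~~ writes t b (any_mask rho l c1 c2).
Proof. by move=> n1 n2; elim: l => //= i l IH; rewrite negb_or n1. Qed.

Lemma prints_any_mask rho l c1 c2 : ~~ prints c1 -> ~~ prints c2 ->
  ~~ prints (any_mask rho l c1 c2).
Proof. by move=> n1 n2; elim: l => //= i l IH; rewrite negb_or n1. Qed.

Lemma writes_size_sum t b K : ~~ writes t b (size_sum K).
Proof. by rewrite /=; elim: (iota 0 K). Qed.

Lemma prints_size_sum K : ~~ prints (size_sum K).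
Proof. by rewrite /=; elim: (iota 0 K). Qed.

Lemma writes_join t b K rho : t != 9 -> ~~ ((t == 8) && b) -> ~~ writes t b (join K rho).
Proof.
rewrite writes_nest writes_when_all => t9 t8.
rewrite -[writes t b _]/(writes t b (size_sum K) || _) negb_or writes_size_sum /=.
rewrite !orbF (eq_sym 8) (eq_sym true) eqb_id negb_or t8 andbT writes_any_mask //=.
  by rewrite eq_sym (negbTE t9).
by rewrite eq_sym (negbTE t9).
Qed.

Lemma prints_join K rho : ~~ prints (join K rho).
Proof.
rewrite prints_nest prints_when_all -[prints _]/(prints (size_sum K) || _) negb_or prints_size_sum /=.
by rewrite !orbF prints_any_mask.
Qed.

Lemma writes_round t b K : t != 9 -> ~~ ((t == 8) && b) -> ~~ writes t b (round K).
Proof.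
move=> t9 t8; rewrite /round; elim: (enum _) => //= f l IH.
by rewrite negb_or IH andbT; apply: writes_join.
Qed.

Lemma prints_round K : ~~ prints (round K).
Proof. by rewrite /round; elim: (enum _) => //= f l IH; rewrite negb_or IH andbT prints_join. Qed.

Lemma mem_chain_pair k K L x y : (x, y) \in chain k K L ->
  (exists2 i, i < K & x = (k, i) /\ y = (k, i.+1)) \/ (x, y) \in L.
Proof.
elim: K => [|K IH] /=; first by right.
rewrite inE => /orP[/eqP[-> ->]|/IH[[i lt e]|]]; last by right.
  by left; exists K.
by left; exists i => //; apply: ltnW.
Qed.

Lemma join_loops_pair K x y : (x, y) \in join_loops K ->
  (exists k i, [/\ 0 < k < 5, i < K, x = (k, i) & y = (k, i.+1)]) \/ y = vN.
Proof.
have step k L : 0 < k < 5 -> (x, y) \in cuts k K L ->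
    (exists k i, [/\ 0 < k < 5, i < K, x = (k, i) & y = (k, i.+1)]) \/ y = vN \/ (x, y) \in L.
  move=> k5; rewrite inE => /orP[/eqP[_ ->]|/mem_chain_pair[[i lt [ex ey]]|xyL]].
  - by right; left.
  - by left; exists k, i.
  - by right; right.
move=> /step[//|//|[->|/step[//|//|[->|/step[//|//|[->|/step[//|//|[->|]]]]]]]]; try by [left|right].
elim: K {step} => [|K IH] /=; first by rewrite inE => /eqP[_ ->]; right.
by rewrite inE => /orP[/eqP[_ ->]|/IH[[k [i [? ? ? ?]]]|]]; [right|left; exists k, i; split=> //; apply: ltnW|right].
Qed.

Lemma extends_join K r r' : extends (join_loops K) r r' ->
  r' vN = r vN /\ forall k i, 0 < k < 5 -> i < K -> r' (k, i) <= r' (k, i.+1).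
Proof.
case=> e1 e2; split; first by rewrite e1 // mem_join_loops.
by move=> k i k5 iK; apply: e2; apply: join_loops_chain.
Qed.

Lemma fun_below_inj K (f : {ffun 'I_K -> 'I_K}) : injectiveb f -> inj_below K (fun_below f).
Proof.
move/injectiveP => fI; split=> [i iK|i j iK jK]; rewrite /fun_below !insubT //=.
by move/val_inj/fI => [].
Qed.

Lemma join_inv K rho r st : inj_below K rho -> r vN = N -> inv st -> inv (sem (join K rho) r st).
Proof.
move=> rI rN; apply: nest_inv; first exact: nest_ok_join.
by move=> r' s' /extends_join[eN mono] iv; apply: (join_body_inv rI _ mono iv).1; rewrite eN.
Qed.

Lemma round_inv K r st : r vN = N -> inv st -> inv (sem (round K) r st).
Proof.
move=> rN; rewrite /round.
have : {subset enum [pred f : {ffun 'I_K -> 'I_K} | injectiveb f] <= [pred f : {ffun 'I_K -> 'I_K} | injectiveb f]}.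
  by move=> f; rewrite mem_enum.
elim: (enum _) st => //= f l IH st sub iv; apply: IH.
  by move=> g gl; apply: sub; rewrite inE gl orbT.
by apply: join_inv => //; apply/fun_below_inj/sub/mem_head.
Qed.

Definition found (K l : nat) (st : store) : Prop :=
  forall k, derivable sg ta N K l k -> arr st 8 k.

Lemma join_found K rho r st X Y Z W V : inj_below K rho -> r vN = N -> inv st ->
  cuts_mono K X -> cuts_mono K Y -> cuts_mono K Z -> cuts_mono K W ->
  (forall k, [/\ X k <= N, Y k <= N, Z k <= N & W k <= N]) ->
  (forall i, i < K -> V i <= N) -> \sum_(0 <= i < K) V i <= N ->
  (forall i, i < K -> arr st 8 (V i :: subbox X Y Z W rho i)) ->
  arr (sem (join K rho) r st) 8 (\sum_(0 <= i < K) V i :: hull X Y Z W K).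
Proof.
move=> rI rN iv mX mY mZ mW leN VN sN HF.
(* The assignment under which the nest meets the given cuts and sizes; the default case is meant for
   [vv]. *)
pose val (z : lvar) := match z.1 with
  | 1 => X z.2 | 2 => Y z.2 | 3 => Z z.2 | 4 => W z.2 | 5 => V z.2 | _ => \sum_(0 <= i < K) V i end.
pose r0 z := if z \in unzip1 (join_loops K) then val z else r z.
have r0E k i : 0 < k < 5 -> i <= K -> r0 (k, i) = val (k, i).
  by move=> k5 iK; rewrite /r0 mem_join_loops /= k5 iK.
have r0V i : i < K -> r0 (5, i) = V i by move=> iK; rewrite /r0 mem_join_loops /= iK.
have r0v : r0 vv = \sum_(0 <= i < K) V i by rewrite /r0 mem_join_loops.
have r0N : r0 vN = N by rewrite /r0 mem_join_loops.
have valN z : z \in unzip1 (join_loops K) -> val z <= N.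
  rewrite mem_join_loops; case: z => a b; rewrite /val /=; have [? ? ? ?] := leN b.
  case: a => [|[|[|[|[|[|a]]]]]] //=; rewrite ?orbF; exact: VN.
have r0in z : z \in unzip1 (join_loops K) -> r0 z = val z by rewrite /r0 => ->.
have r0out z : z \notin unzip1 (join_loops K) -> r0 z = r z by rewrite /r0 => /negbTE->.
clearbody r0; have ex : extends (join_loops K) r r0.
  split=> [z|x y xy]; first exact: r0out.
  have [[k [i [k5 iK -> ->]]]|->] := join_loops_pair xy.
    rewrite (r0E k i k5 (ltnW iK)) (r0E k i.+1 k5 iK); case: k k5 => [|[|[|[|[|k]]]]] // _; rewrite /val /=.
    - exact: mX.
    - exact: mY.
    - exact: mZ.
    - exact: mW.
  rewrite r0N; have xL : x \in unzip1 (join_loops K) by apply/mapP; exists (x, y).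
  by rewrite r0in ?valN.
have keyE i : i < K -> key_of r0 rho i = V i :: subbox X Y Z W rho i.
  move=> iK; have rK := rI.1 i iK.
  by rewrite /key_of /subbox r0V // !r0E // ltnW.
have hullE : hull_of r0 K = hull X Y Z W K by rewrite /hull_of /hull !r0E.
apply: (@nest_visit (fun s => inv s /\ forall i, i < K -> arr s 8 (V i :: subbox X Y Z W rho i)) 
  (fun s => arr s 8 (\sum_(0 <= i < K) V i :: hull X Y Z W K)) (join_loops K) (join_body K rho) r r0) => //.
- exact: nest_ok_join.
- move=> r' s' /extends_join[eN mono] [iv' HF']; split.
    by apply: (join_body_inv rI _ mono iv').1; rewrite eN.
  move=> i iK; apply: sem_keep; last exact: HF'.
  by have := @writes_join 8 false K rho isT isT; rewrite writes_nest.
- move=> r' s' H; apply: sem_keep => //.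
  by have := @writes_join 8 false K rho isT isT; rewrite writes_nest.
- move=> s' [iv' HF'].
  have [_ mono] := extends_join ex.
  have [_] := join_body_inv rI r0N mono iv'; rewrite r0v hullE; apply.
    by apply/allP => i; rewrite mem_iota => iK; rewrite keyE ?HF'.
  by apply: eq_big_nat => i iK; rewrite r0V.
Qed.

Lemma round_found K l r st : r vN = N -> inv st -> found K l st -> found K l.+1 (sem (round K) r st).
Proof.
move=> rN iv fd k.
have keep k' : arr st 8 k' -> arr (sem (round K) r st) 8 k'.
  by apply: sem_keep; apply: writes_round.
move El: l.+1 => l1 der; case: l1 k / der El => [l' B sB BN|l' B e BN Be|l' X Y Z W rho V mX mY mZ mW rI leN VN sN der] El.
- by apply/keep/fd; constructor.
- by apply/keep/fd; apply: Derivable_point BN Be.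
case: El => El; rewrite -El in der.
pose f := [ffun i : 'I_K => insubd i (rho i)].
have fE i : i < K -> fun_below f i = rho i.
  by move=> iK; rewrite /fun_below insubT /= ffunE val_insubd /= rI.1.
have fI : injectiveb f.
  apply/injectiveP => i j; rewrite !ffunE => /(congr1 val).
  by rewrite !val_insubd !rI.1 // => /rI.2 e; apply: val_inj; apply: e.
have HF i : i < K -> arr st 8 (V i :: subbox X Y Z W (fun_below f) i).
  by move=> iK; rewrite /subbox fE //; apply: fd; apply: der.
have fL : f \in enum [pred f : {ffun 'I_K -> 'I_K} | injectiveb f] by rewrite mem_enum.
apply: (@foldr_visit (fun s => inv s /\ forall i, i < K -> arr s 8 (V i :: subbox X Y Z W (fun_below f) i))
  (fun s => arr s 8 (\sum_(0 <= i < K) V i :: hull X Y Z W K)) _ (fun f => join K (fun_below f)) _ f) => //.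
- move=> g s' gL [iv' HF']; split.
    by apply: join_inv => //; apply: fun_below_inj; move: gL; rewrite mem_enum.
  by move=> i iK; apply: sem_keep; [apply: writes_join|apply: HF'].
- by move=> g s' H; apply: sem_keep => //; apply: writes_join.
- by move=> s' [iv' HF']; apply: join_found => //; apply: fun_below_inj.
Qed.

Lemma rounds_found K r st : r vN = N -> inv st -> found K 0 st ->
  inv (sem (For vr vN (round K)) r st) /\ found K N.+1 (sem (For vr vN (round K)) r st).
Proof.
move=> rN iv fd; rewrite /= rN.
apply: (loop_ind (P := fun l s => inv s /\ found K l s)) => // l s _ [iv' fd'].
have rN' : upd r vr l vN = N by rewrite upd_other.
by split; [apply: round_inv|apply: round_found].
Qed.

Lemma base_empty_inv r st : r vN = N -> r vZ = 0 -> inv st -> (forall k, arr st 9 k = false) ->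
  let st' := sem base_empty r st in
  [/\ inv st', forall k, arr st' 9 k = false &
      forall B, size B = 8 -> all (leq^~ N) B -> arr st' 8 (0 :: B)].
Proof.
move=> rN rZ iv st9 st'.
have ok : nest_ok [seq (x, vN) | x <- hull_key 1] by [].
pose P s := inv s /\ forall k, arr s 9 k = false.
have PP r' s : extends [seq (x, vN) | x <- hull_key 1] r r' -> P s ->
    P (sem (ASet 8 (vZ :: hull_key 1) true) r' s).
  move=> [e1 _] [iv' s9]; split=> [|k] /=; last by rewrite upd_other.
  have [iS iT iF] := iv'; split=> [a b|a b|k] /=; [by rewrite upd_other|by rewrite upd_other|].
  rewrite upd_same /upd /=; case: eqP => [-> _|_ /iF] //.
  exists [::]; split; [exact: matching0|by rewrite /= (e1 vZ)|by move=> m _; rewrite s9].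
have Pst : P st by [].
have [iv' s9] : P st' by apply: nest_inv Pst.
split=> // -[|x0 [|x1 [|y0 [|y1 [|z0 [|z1 [|w0 [|w1 [|? ?]]]]]]]]] //= _ BN.
pose r0 (z : lvar) := match z with
  | (1, 0) => x0 | (1, 1) => x1 | (2, 0) => y0 | (2, 1) => y1
  | (3, 0) => z0 | (3, 1) => z1 | (4, 0) => w0 | (4, 1) => w1 | _ => r z end.
apply: (@nest_visit P (fun s => arr s 8 [:: 0; x0; x1; y0; y1; z0; z1; w0; w1])
  _ _ r r0 st ok PP) => //.
- by move=> r' s; apply: sem_keep.
- split=> [z|x y].
    by case: z => [[|[|[|[|[|?]]]]] [|[|?]]].
  case/mapP=> z zk [-> ->]; rewrite [r0 vN]/= rN; have /and5P[? ? ? ? /and4P[? ? ? /andP[? _]]] := BN.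
  by move: zk; rewrite !inE; do !(case/orP=> [/eqP-> //|]); move/eqP->.
- by move=> s _; rewrite /= rZ upd_same upd_same.
Qed.

Lemma base_point_inv r st : 0 < N -> r vN = N -> cnt st 2 = 1 -> inv st ->
  let st' := sem base_point r st in
  inv st' /\ forall B e, all (leq^~ N) B -> in_box sg ta B e -> arr st' 8 (1 :: B).
Proof.
move=> N0 rN c2 iv st'.
set L := [:: (vv, vN); ((1, 1), vN); (vp, (1, 1)); ((1, 0), vp);
           ((2, 1), vN); (vu, (2, 1)); ((2, 0), vu);
           ((3, 1), vN); (vq, (3, 1)); ((3, 0), vq);
           ((4, 1), vN); (vw, (4, 1)); ((4, 0), vw)].
pose P s := inv s /\ cnt s 2 = 1.
pose body := IfCnt vv 2
      (IfEq vp (1, 1) Skip (IfEq vu (2, 1) Skip (IfEq vq (3, 1) Skip (IfEq vw (4, 1) Skip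
        (AIf 6 [:: vp; vu] (AIf 7 [:: vq; vw] (claim (vv :: hull_key 1) (IfEq vm vp)) Skip)
          Skip)))))
      Skip.
have ok : nest_ok L by [].
have key (r' : lvar -> nat) s : r' vN = N -> extends L r r' -> P s -> r' vv = 1 ->
    r' vp <> r' (1, 1) -> r' vu <> r' (2, 1) -> r' vq <> r' (3, 1) -> r' vw <> r' (4, 1) ->
    arr s 6 [:: r' vp; r' vu] -> arr s 7 [:: r' vq; r' vw] ->
    inv (sem (claim (vv :: hull_key 1) (IfEq vm vp)) r' s) /\
    arr (sem (claim (vv :: hull_key 1) (IfEq vm vp)) r' s) 8 (map r' (vv :: hull_key 1)).
  move=> rN' [_ e2] [iv' _] ev np nu nq nw; have [iS iT _] := iv'.
  rewrite iS iT => /andP[ps /eqP pu] /andP[qt /eqP qw].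
  apply: (@claim_inv _ _ _ _ _ _ _ (pred1 (r' vp))) => //.
    by move=> i s' c1 c2' _ _ _; rewrite /= upd_same upd_other //; case: ifP.
  move=> _; exists [:: (r' vp, r' vq)]; rewrite [behead _]/= [head _ _]/= ev; split=> //.
    have e2' x y : (x, y) \in L -> r' x <= r' y by apply: e2.
    have := e2' vp (1, 1) isT; have := e2' (1, 0) vp isT.
    have := e2' vu (2, 1) isT; have := e2' (2, 0) vu isT.
    have := e2' vq (3, 1) isT; have := e2' (3, 0) vq isT.
    have := e2' vw (4, 1) isT; have := e2' (4, 0) vw isT.
    move=> b1 b2 b3 b4 b5 b6 b7 b8; split=> //.
      by move=> e; rewrite inE => /eqP->; rewrite /in_box /= pu qw ps qt !andbT; lia.
    by move=> e e'; rewrite !inE => /eqP-> /eqP->; rewrite /compatible !ltnn.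
  by move=> m _; rewrite /= inE.
have PP r' s : extends L r r' -> P s -> P (sem body r' s).
  move=> ex Ps; have [iv' c2'] := Ps; split; last by rewrite sem_cnt.
  have rN' : r' vN = N by rewrite ex.1.
  rewrite [sem _ _ _]/=; case: eqP => // ev; rewrite c2' in ev; do 4!(case: eqP => // ?).
  case: ifP => // h6; case: ifP => // h7.
  by apply: (key r' s rN' ex Ps ev _ _ _ _ h6 h7).1.
have Pst : P st by [].
split; first by have [] : P st' by apply: nest_inv Pst.
move=> [|x0 [|x1 [|y0 [|y1 [|z0 [|z1 [|w0 [|w1 [|? ?]]]]]]]]] // [p q] BN be.
pose r0 (z : lvar) := match z with
  | (0, 2) => 1 | (0, 6) => p | (0, 7) => nth 0 sg p | (0, 8) => q | (0, 9) => nth 0 ta q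
  | (1, 0) => x0 | (1, 1) => x1 | (2, 0) => y0 | (2, 1) => y1
  | (3, 0) => z0 | (3, 1) => z1 | (4, 0) => w0 | (4, 1) => w1 | _ => r z end.
have /and5P[/andP[/= bx1 bx2] /andP[/= by1 by2] /andP[/= bz1 bz2] /andP[/= bw1 bw2] /andP[/= ps qt]] := be.
have ex : extends L r r0.
  split=> [z|x y].
    by case: z => [[|[|[|[|[|?]]]]] [|[|[|[|[|[|[|[|[|[|?]]]]]]]]]]].
  have /and5P[? ? ? ? /and4P[? ? ? /andP[? _]]] := BN.
  rewrite !inE; do !(case/orP=> [/eqP[-> ->]|]); rewrite /= ?rN //; try exact: ltnW.
  by move/eqP=> [-> ->].
apply: (@nest_visit P (fun s => arr s 8 [:: 1; x0; x1; y0; y1; z0; z1; w0; w1])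
  _ _ r r0 st ok PP) => //.
- by move=> r' s; apply: sem_keep.
- move=> s Ps; have [iv' c2'] := Ps; have [iS iT _] := iv'.
  rewrite [sem _ _ _]/= c2' /=; do 4!(case: eqP => [e|_]; first by rewrite e ltnn in bx2 by2 bz2 bw2).
  rewrite iS iT ps qt !eqxx /=.
  by apply: (key r0 s _ ex Ps _ _ _ _ _ _ _).2; rewrite //= ?iS ?iT ?ps ?qt ?eqxx //; lia.
Qed.

End Phases.

(** * Selecting a largest matching and printing its pattern *)

Lemma sem_For x y c r s :
  sem (For x y c) r s = loop (fun s' i => sem c (upd r x i) s') s (r y).
Proof. by []. Qed.

Definition full_key : seq lvar := [:: vZ; vN; vZ; vN; vZ; vN; vZ; vN].

(** Sizes are tried in increasing order and each success overwrites array 10, so the mask of the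
    largest size remains. *)
Definition select : cmd :=
  For vv vN (AIf 8 (vv :: full_key) (set_mask 10 [::] (AIf 9 (vm :: vv :: full_key))) Skip).

Lemma select_spec sg ta N r st : r vN = N -> r vZ = 0 -> dp_inv sg ta N st ->
  arr st 8 (0 :: full_box N) -> exists2 M, matching sg ta (full_box N) M &
    (forall m, m <= N -> arr (sem select r st) 10 [:: m] = (m \in unzip1 M)) /\
    (forall v, v <= N -> arr st 8 (v :: full_box N) -> v <= size M).
Proof.
move=> rN rZ [_ _ iF] F0; rewrite /select sem_For rN; set f := fun s' i => sem _ _ s'.
pose P j s := [/\ arr s 8 = arr st 8, arr s 9 = arr st 9 &
    0 < j -> exists2 M, matching sg ta (full_box N) M &
      (forall m, m <= N -> arr s 10 [:: m] = (m \in unzip1 M)) /\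
      (forall v, v < j -> arr st 8 (v :: full_box N) -> v <= size M)].
have H : P N.+1 (loop f st N).
  apply: (@loop_ind _ P) => // j s le_j [e8 e9 HM].
  have keyE : map (upd r vv j) (vv :: full_key) = j :: full_box N.
    by rewrite /= upd_same !upd_other // rN rZ.
  rewrite /f; set r1 := upd r vv j.
  have -> : sem (AIf 8 (vv :: full_key) (set_mask 10 [::] (AIf 9 (vm :: vv :: full_key))) Skip) r1 s =
      if arr s 8 (map r1 (vv :: full_key)) then sem (set_mask 10 [::] (AIf 9 (vm :: vv :: full_key))) r1 s else s.
    by [].
  rewrite keyE e8.
  case: ifPn => [Fj|nFj]; last first.
    (* Here [j] is not 0, as the empty matching is in the table; hence a selection has been made
       before. *)
    split=> // _; move: HM nFj {keyE r1}; case: j {le_j} => [|j] HM nF; first by rewrite F0 in nF.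
    have [//|M mM [HR Hv]] := HM; exists M => //; split=> // v.
    by rewrite ltnS leq_eqVlt => /orP[/eqP->|/Hv //]; rewrite (negbTE nF).
  have [||off HR] := @sem_set_mask 10 [::] (AIf 9 (vm :: vv :: full_key)) r1 s (fun m => arr st 9 (m :: j :: full_box N)).
  - by [].
  - move=> i s' c1 c2 _ off; rewrite -e9 -(off 9 _ (or_introl _)) // -keyE.
    transitivity (if arr s' 9 (map (upd r1 vm i) (vm :: vv :: full_key))
      then sem c1 (upd r1 vm i) s' else sem c2 (upd r1 vm i) s'); first by [].
    have -> : map (upd r1 vm i) (vm :: vv :: full_key) = i :: map r1 (vv :: full_key).
      by rewrite [LHS]/= upd_same !upd_other.
    by case: (arr s' 9 _).
  have r1N : r1 vN = N by rewrite /r1 upd_other.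
  rewrite r1N in HR.
  split=> [||_].
  - by apply: functional_extensionality => k; rewrite off ?e8 //; left.
  - by apply: functional_extensionality => k; rewrite off ?e9 //; left.
  have [M [mM zM HP]] := iF _ Fj; exists M => //; split=> [m le_m|v]; first by rewrite HR ?HP.
  by rewrite ltnS => le_v _; rewrite zM.
by have [_ _ /(_ isT)] := H.
Qed.

Lemma flatten_iotaS (T : Type) (g : nat -> seq T) n :
  flatten (map g (iota 0 n.+1)) = flatten (map g (iota 0 n)) ++ g n.
Proof. by rewrite -addn1 iotaD map_cat flatten_cat /= cats0. Qed.

Lemma flatten_pick (T : Type) (h : nat -> seq T) a n :
  flatten [seq if i == a then h i else [::] | i <- iota 0 n] = if a < n then h a else [::].
Proof.
elim: n => // n IH; rewrite flatten_iotaS IH ltnS (eq_sym n).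
by case: (ltngtP a n) => [lt|gt|->]; rewrite ?cats0.
Qed.

Lemma flatten_count (T : Type) (p : pred nat) (x : T) l :
  flatten [seq if p i then [:: x] else [::] | i <- l] = nseq (count p l) x.
Proof. by elim: l => //= i l ->; case: (p i). Qed.

Lemma flatten_filter (T : Type) (p : pred nat) (h : nat -> seq T) l :
  flatten [seq if p i then h i else [::] | i <- l] = flatten (map h (filter p l)).
Proof. by elim: l => //= i l ->; case: (p i). Qed.

Lemma loop_out (A : nat -> seq nat -> bool) (f : store -> nat -> store) (g : nat -> seq isym) s n :
  (forall i s', i <= n -> arr s' = A -> arr (f s' i) = A /\ out (f s' i) = out s' ++ g i) ->
  arr s = A -> arr (loop f s n) = A /\ out (loop f s n) = out s ++ flatten (map g (iota 0 n.+1)).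
Proof.
move=> H e; apply: (loop_ind (P := fun j s' => arr s' = A /\ out s' = out s ++ flatten (map g (iota 0 j)))).
  by rewrite cats0.
move=> i s' le_i [e' o']; have [-> ->] := H i s' le_i e'; split=> //.
by rewrite o' flatten_iotaS catA.
Qed.

(** A rank is printed in unary, one [I1] for each selected position of smaller value, so no number
    has to be stored. Values are found by search: [vu] is the value at [vp] and [vw] the one at
    [vq]; the bound of [vw] and the equality test say that it is smaller. *)
Definition print_less : cmd := For vw vu (IfEq vw vu Skip (AIf 6 [:: vq; vw] (Out I1) Skip)).

Definition print_compare : cmd := For vu vN (AIf 6 [:: vp; vu] print_less Skip).

Definition print_rank : cmd := For vq vN (AIf 10 [:: vq] print_compare Skip).

Definition print : cmd := For vp vN (AIf 10 [:: vp] (Seq print_rank (Out Iend)) Skip).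

Section Print.
Variables (sg : seq nat) (N : nat) (M : seq (nat * nat)) (A : nat -> seq nat -> bool).
Hypotheses (ps : is_perm sg) (sN : size sg <= N).
Hypothesis iS : forall a b, A 6 [:: a; b] = (a < size sg) && (nth 0 sg a == b).
Hypothesis iR : forall m, m <= N -> A 10 [:: m] = (m \in unzip1 M).
Hypothesis MS : forall m, m \in unzip1 M -> m < size sg.

Let value_le a : a < size sg -> nth 0 sg a <= N.
Proof. by move=> lt; apply: leq_trans sN; apply: ltnW; rewrite -mem_perm // mem_nth. Qed.

Lemma print_less_spec r s : r vq < size sg -> arr s = A ->
  arr (sem print_less r s) = A /\
  out (sem print_less r s) = out s ++ (if nth 0 sg (r vq) < r vu then [:: I1] else [::]).
Proof.
move=> lt_q es; have -> : (if nth 0 sg (r vq) < r vu then [:: I1] else [::]) =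
    (if nth 0 sg (r vq) < (r vu).+1 then if nth 0 sg (r vq) == r vu then [::] else [:: I1] else [::]).
  by rewrite ltnS; case: ltngtP.
rewrite -(flatten_pick (fun a => if a == r vu then [::] else [:: I1])) /print_less sem_For.
apply: loop_out es => a s' _ es /=; rewrite upd_same !upd_other // es iS lt_q eq_sym /=.
rewrite (eq_sym a); case: (r vu == a); first by case: ifP; rewrite cats0.
by case: eqP => _; rewrite ?cats0 ?cats1.
Qed.

Lemma print_compare_spec r s : r vN = N -> r vp < size sg -> r vq < size sg -> arr s = A ->
  arr (sem print_compare r s) = A /\ out (sem print_compare r s) =
    out s ++ (if nth 0 sg (r vq) < nth 0 sg (r vp) then [:: I1] else [::]).
Proof.
move=> rN lt_p lt_q es.
have -> : (if nth 0 sg (r vq) < nth 0 sg (r vp) then [:: I1] else [::]) =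
    if nth 0 sg (r vp) < N.+1 then
      if nth 0 sg (r vq) < nth 0 sg (r vp) then [:: I1] else [::] else [::].
  by rewrite ltnS value_le.
rewrite -(flatten_pick (fun u => if nth 0 sg (r vq) < u then [:: I1] else [::])) /print_compare sem_For rN.
apply: loop_out es => u s' _ es.
have -> : sem (AIf 6 [:: vp; vu] print_less Skip) (upd r vu u) s' =
    if nth 0 sg (r vp) == u then sem print_less (upd r vu u) s' else s'.
  by rewrite [LHS]/= upd_same upd_other // es iS lt_p.
rewrite eq_sym; case: ifP => _; last by rewrite cats0.
by have := @print_less_spec (upd r vu u) s'; rewrite upd_same upd_other //; apply.
Qed.

Lemma print_rank_spec r s : r vN = N -> r vp < size sg -> arr s = A ->
  arr (sem print_rank r s) = A /\ out (sem print_rank r s) = out s ++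
    nseq (count (fun j => (j \in unzip1 M) && (nth 0 sg j < nth 0 sg (r vp))) (iota 0 N.+1)) I1.
Proof.
move=> rN lt_p es; rewrite -flatten_count /print_rank sem_For rN.
apply: loop_out es => j s' le_j es.
have -> : sem (AIf 10 [:: vq] print_compare Skip) (upd r vq j) s' =
    if j \in unzip1 M then sem print_compare (upd r vq j) s' else s'.
  by rewrite [LHS]/= upd_same es iR.
case: ifPn => Mj; last by rewrite cats0.
by have := @print_compare_spec (upd r vq j) s'; rewrite upd_same !upd_other //; apply=> //; apply: MS.
Qed.

Lemma print_spec r s : r vN = N -> arr s = A ->
  out (sem print r s) = out s ++ enc_perm (standardize
    (map (nth 0 sg) [seq i <- iota 0 N.+1 | i \in unzip1 M])).
Proof.
move=> rN es; pose h i := enc_nat (count (fun j => (j \in unzip1 M) && (nth 0 sg j < nth 0 sg i)) (iota 0 N.+1)).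
have [_ ->] : arr (sem print r s) = A /\ out (sem print r s) =
    out s ++ flatten [seq if i \in unzip1 M then h i else [::] | i <- iota 0 N.+1].
  rewrite /print sem_For rN; apply: loop_out es => i s' le_i es.
  have -> : sem (AIf 10 [:: vp] (Seq print_rank (Out Iend)) Skip) (upd r vp i) s' =
      if i \in unzip1 M then sem (Out Iend) (upd r vp i) (sem print_rank (upd r vp i) s') else s'.
    by rewrite [LHS]/= upd_same es iR.
  case: ifPn => Mi; last by rewrite cats0.
  have := @print_rank_spec (upd r vp i) s'; rewrite upd_same upd_other // => /(_ rN (MS Mi) es)[ea eo].
  by rewrite /= ea eo; split=> //; rewrite /h /enc_nat -!cats1 catA.
rewrite flatten_filter /enc_perm /standardize -!map_comp; congr (_ ++ flatten _).
apply: eq_map => i; rewrite /comp count_map count_filter; congr enc_nat.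
by apply: eq_count => j /=; rewrite andbC.
Qed.

End Print.

(** * Reading the input *)

Definition store_point : cmd :=
  For vp vN (For vq vN (IfCnt vp 0 (IfCnt vq 1
    (AIf 11 [::] (ASet 7 [:: vp; vq] true) (ASet 6 [:: vp; vq] true)) Skip) Skip)).

Definition read_symbol : cmd :=
  AIf 0 [:: vu] (Inc 1)
    (AIf 1 [:: vu] (Seq store_point (Seq (Inc 0) (Reset 1)))
      (AIf 2 [:: vu] (Seq (ASet 11 [::] true) (Seq (Reset 0) (Reset 1))) Skip)).

Definition read_input : cmd := For vu vN read_symbol.

(** A counter cannot index an array, so two loops look for the loop variables equal to the counters;
    the point is stored because both counters are within the loop bound. *)
Lemma store_point_spec r st : cnt st 0 <= r vN -> cnt st 1 <= r vN ->
  sem store_point r st = let t := if arr st 11 [::] then 7 else 6 in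
    Store (cnt st) (upd (arr st) t (upd (arr st t) [:: cnt st 0; cnt st 1] true)) (out st).
Proof.
move=> le0 le1; rewrite /store_point sem_For.
pose P s := cnt s = cnt st.
have inner r' s : r' vN = r vN -> sem (For vq vN (IfCnt vp 0 (IfCnt vq 1
    (AIf 11 [::] (ASet 7 [:: vp; vq] true) (ASet 6 [:: vp; vq] true)) Skip) Skip)) r' s =
    if r' vp == cnt s 0 then (if cnt s 1 <= r vN then let t := if arr s 11 [::] then 7 else 6 in
      Store (cnt s) (upd (arr s) t (upd (arr s t) [:: cnt s 0; cnt s 1] true)) (out s) else s) else s.
  move=> rN; rewrite sem_For rN; case: (eqVneq (r' vp) (cnt s 0)) => [e|ne]; last first.
    apply: (loop_inv (P := fun s' => s' = s)) => // i s' _ -> /=.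
    by rewrite upd_other // (negbTE ne).
  case: (leqP (cnt s 1) (r vN)) => [le|gt]; last first.
    apply: (loop_inv (P := fun s' => s' = s)) => // i s' le_i -> /=.
    by rewrite upd_same upd_other // e eqxx (_ : i == cnt s 1 = false) //; lia.
  rewrite (@loop_single _ (fun s' => cnt s' = cnt s) _ s _ (cnt s 1)) //=.
  - by rewrite upd_same !upd_other // e !eqxx /=; case: (arr s 11 _).
  - by rewrite upd_same !upd_other // e !eqxx /=; case: (arr s 11 _).
  - move=> j s' ne es; rewrite es upd_same !upd_other // e eqxx ifF //.
    exact/eqP.
have rNv j : upd r vp j vN = r vN by rewrite upd_other.
rewrite (@loop_single _ P _ st _ (cnt st 0)) //.
- by rewrite inner // upd_same eqxx le1.
- by rewrite inner // upd_same eqxx le1.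
- move=> j s' ne es; rewrite inner // upd_same es ifF //; exact/eqP.
Qed.

(** Index and value of the entry being read, whether the separator has passed, and the points read
    so far, each with the flag telling its permutation. *)
Definition reader := (nat * nat * bool * seq (bool * nat * nat))%type.

Definition read_step (p : reader) (a : isym) : reader :=
  let: (i, v, f, l) := p in
  match a with
  | I1 => (i, v.+1, f, l)
  | Iend => (i.+1, 0, f, (f, i, v) :: l)
  | Isep => (0, 0, true, l)
  end.

Definition read_all (w : seq isym) : reader := foldl read_step (0, 0, false, [::]) w.

(** This keeps index and value within reach of the search made by [store_point]. *)
Lemma read_all_bound w : let: (i, v, _, _) := read_all w in i <= size w /\ v <= size w.
Proof.
elim/last_ind: w => // w a; rewrite /read_all foldl_rcons size_rcons.
case: (foldl _ _ _) => [[[i v] f] l] [le1 le2]; case: a => /=; split=> //; exact: leqW.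
Qed.

Lemma read_nat i v f l x :
  foldl read_step (i, v, f, l) (enc_nat x) = (i.+1, 0, f, (f, i, v + x) :: l).
Proof.
rewrite /enc_nat foldl_rcons.
suff -> : foldl read_step (i, v, f, l) (nseq x I1) = (i, v + x, f, l) by [].
by elim: x v => [|x IH] v /=; rewrite ?addn0 // IH addSnnS.
Qed.

Lemma read_perm s i f l : exists l', foldl read_step (i, 0, f, l) (enc_perm s) = (i + size s, 0, f, l')
  /\ forall g a b, ((g, a, b) \in l') =
       ((g, a, b) \in l) || [&& g == f, i <= a < i + size s & nth 0 s (a - i) == b].
Proof.
elim: s i l => [|x s IH] i l /=.
  exists l; split=> [|g a b]; first by rewrite addn0.
  by rewrite (_ : i <= a < i + 0 = false) ?andbF ?orbF //; lia.
rewrite /enc_perm /= foldl_cat read_nat add0n; have [l' [-> H]] := IH i.+1 ((f, i, x) :: l).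
exists l'; split=> [|g a b]; first by rewrite addSnnS.
rewrite H inE !xpair_eqE orbC orbA [RHS]orbC; congr orb.
case: (g == f) => //=; case: (ltngtP i a) => [lt|gt|<-] /=.
- by rewrite -(subnSK lt) addSnnS orbF.
- by [].
- by rewrite subnn addnS ltnS leq_addr /= eq_sym.
Qed.

Lemma read_pair s t : exists i v f l, read_all (enc_pair s t) = (i, v, f, l) /\
  (forall a b : nat, ((false, a, b) \in l) = (a < size s) && (nth 0 s a == b)) /\
  (forall a b : nat, ((true, a, b) \in l) = (a < size t) && (nth 0 t a == b)).
Proof.
rewrite /read_all /enc_pair foldl_cat.
have [l1 [-> H1]] := read_perm s 0 false [::]; rewrite /=.
have [l2 [-> H2]] := read_perm t 0 true l1.
exists (0 + size t), 0, true, l2; split=> //; split=> a b; rewrite H2 H1 /= ?orbF subn0 //.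
Qed.

Definition reads (w : seq isym) (p : reader) (st : store) : Prop :=
  let: (i, v, f, l) := p in
  [/\ cnt st 0 = i /\ cnt st 1 = v, arr st 11 [::] = f,
      forall a b, arr st 6 [:: a; b] = ((false, a, b) \in l),
      forall a b, arr st 7 [:: a; b] = ((true, a, b) \in l) &
      forall t x, t < 3 -> arr st t [:: x] = (x < size w) && (code (nth I1 w x) == t)].

Lemma read_symbol_spec w x r st : r vN = (size w).+1 -> r vu = x ->
  reads w (read_all (take x w)) st -> reads w (read_all (take x.+1 w)) (sem read_symbol r st).
Proof.
move=> rN ru.
have bnd := read_all_bound (take x w); have sz : size (take x w) <= (size w).+1.
  by rewrite size_take; case: ifP => lt; lia.
case E : (read_all (take x w)) bnd => [[[i v] f] l] [bi bv] [[c0 c1] e11 e6 e7 ein].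
have in0 := ein 0 x isT; have in1 := ein 1 x isT; have in2 := ein 2 x isT.
have semE : sem read_symbol r st =
  if arr st 0 [:: x] then sem (Inc 1) r st else
  if arr st 1 [:: x] then sem (Seq (Inc 0) (Reset 1)) r (sem store_point r st) else
  if arr st 2 [:: x] then sem (Seq (ASet 11 [::] true) (Seq (Reset 0) (Reset 1))) r st else st.
  by rewrite -ru.
have [le0 le1] : cnt st 0 <= r vN /\ cnt st 1 <= r vN by rewrite rN c0 c1; lia.
rewrite semE (store_point_spec le0 le1) in0 in1 in2.
case: (ltnP x (size w)) => [lt_x|ge_x]; last first.
  by rewrite take_oversize ?leqW //; move: E; rewrite take_oversize // => ->; split.
rewrite (take_nth I1) // /read_all foldl_rcons -/(read_all _) E.
case: (nth I1 w x) => /=.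
- by split=> //=; split; [rewrite upd_other|rewrite upd_same c1].
- rewrite c0 c1 e11; split=> /=.
  + by split; [rewrite upd_other // upd_same c0|rewrite upd_same].
  + by rewrite upd_other ?e11 //; case: (f).
  + move=> a b; rewrite inE !xpair_eqE; case: (f) => /=; first by rewrite upd_other.
    by rewrite upd_same /upd !eqseq_cons andbT; case: ifP.
  + move=> a b; rewrite inE !xpair_eqE; case: (f) => /=; last by rewrite upd_other.
    by rewrite upd_same /upd !eqseq_cons andbT; case: ifP.
  + by move=> t y t3; rewrite -ein // upd_other //; case: (f); lia.
- by split=> //= t y t3; rewrite -ein // upd_other //; lia.
Qed.

Lemma read_input_spec w r st : r vN = (size w).+1 -> reads w (read_all [::]) st ->
  reads w (read_all w) (sem read_input r st).
Proof.
move=> rN st0; rewrite /read_input sem_For rN.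
(* The loop makes [(size w).+2] turns; those beyond the word find none of the arrays 0, 1, 2 set and
   do nothing. *)
rewrite -[X in read_all X](@take_oversize _ (size w).+2 w); last by lia.
apply: (@loop_ind _ (fun j s => reads w (read_all (take j w)) s)); first by rewrite take0.
by move=> x s _; apply: read_symbol_spec; rewrite ?upd_same ?upd_other.
Qed.

(** * The whole program and its correctness *)

Definition lcp_program (K : nat) : cmd :=
  Seq (Inc 2) (Seq read_input (Seq base_empty (Seq base_point
    (Seq (For vr vN (round K)) (Seq select print))))).

Lemma nest_wf_chain G k K L : (k, K) \in G -> (forall i, i < K -> (k, i) \notin G) ->
  (forall G', (forall x, (x \in G') = (x.1 == k) && (x.2 < K) || (x \in G)) -> nest_wf G' L) ->
  nest_wf G (chain k K L).
Proof.
elim: K G => [|K IH] G KG iG HL /=; first by apply: HL => x; rewrite ltn0 andbF.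
rewrite KG iG //=; apply: IH; first exact: mem_head.
  by move=> i lt; rewrite inE negb_or iG ?leqW // andbT xpair_eqE eqxx /= neq_ltn lt.
move=> G' HG'; apply: HL => -[a b]; rewrite HG' inE xpair_eqE /= ltnS (leq_eqVlt b K).
by case: (a == k) => //=; case: (b == K); rewrite ?orbT.
Qed.

Lemma nest_wf_cuts G k K L : vN \in G -> (forall i, i <= K -> (k, i) \notin G) ->
  (forall G', (forall x, (x \in G') = (x.1 == k) && (x.2 <= K) || (x \in G)) -> nest_wf G' L) ->
  nest_wf G (cuts k K L).
Proof.
move=> NG iG HL; rewrite /= NG iG //=; apply: nest_wf_chain; first exact: mem_head.
  by move=> i lt; rewrite inE negb_or iG ?(ltnW lt) // andbT xpair_eqE eqxx /= neq_ltn lt.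
move=> G' HG'; apply: HL => -[a b]; rewrite HG' inE xpair_eqE /= (leq_eqVlt b K).
by case: (a == k) => //=; case: (b == K); rewrite ?orbT.
Qed.

Lemma nest_wf_sizes G K L : vN \in G -> (forall i, i < K -> (5, i) \notin G) ->
  (forall G', (forall x, (x \in G') = (x.1 == 5) && (x.2 < K) || (x \in G)) -> nest_wf G' L) ->
  nest_wf G (sizes K L).
Proof.
elim: K G => [|K IH] G NG iG HL /=; first by apply: HL => x; rewrite ltn0 andbF.
rewrite NG iG //=; apply: IH; first by rewrite inE NG orbT.
  by move=> i lt; rewrite inE negb_or iG ?leqW // andbT xpair_eqE eqxx /= neq_ltn lt.
move=> G' HG'; apply: HL => -[a b]; rewrite HG' inE xpair_eqE /= ltnS (leq_eqVlt b K).
by case: (a == 5) => //=; case: (b == K); rewrite ?orbT.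
Qed.

Lemma nest_wf_join K : nest_wf [:: vr; vN; vZ] (join_loops K).
Proof.
apply: nest_wf_cuts => // G1 H1; apply: nest_wf_cuts => [|i _|G2 H2]; rewrite ?H1 //.
apply: nest_wf_cuts => [|i _|G3 H3]; rewrite ?H2 ?H1 //.
apply: nest_wf_cuts => [|i _|G4 H4]; rewrite ?H3 ?H2 ?H1 //.
apply: nest_wf_sizes => [|i _|G5 H5]; rewrite ?H4 ?H3 ?H2 ?H1 //.
by rewrite /= !H5 !H4 !H3 !H2 !H1 !inE.
Qed.

Lemma cwf_join_body (G : seq lvar) K rho : (forall i, i < K -> rho i < K) ->
  (forall k i, 0 < k < 5 -> i <= K -> (k, i) \in G) -> (forall i, i < K -> (5, i) \in G) ->
  vv \in G -> vN \in G -> vm \notin G -> vt \notin G -> cwf G (join_body K rho).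
Proof.
move=> rK cG sG vG NG mG tG.
have keyG (G' : seq lvar) i : {subset G <= G'} -> i < K -> all [in G'] ((5, i) :: box_key rho i).
  by move=> sub iK; have rKi := rK i iK; rewrite /= !sub ?sG // ?cG // ltnW.
have whenG l c : all (ltn^~ K) l -> cwf G c -> cwf G (when_all rho l c).
  move=> + wc; elim: l => // i l IH /andP[iK li].
  by apply: (introT and4P); split=> //; [apply: keyG|apply: IH].
apply: whenG; first by apply/allP => i; rewrite mem_iota.
have hullG : all [in G] (vv :: hull_key K) by rewrite /= vG !cG.
have anyG l c1 c2 : all (ltn^~ K) l -> cwf (vm :: G) c1 -> cwf (vm :: G) c2 ->
    cwf (vm :: G) (any_mask rho l c1 c2).
  move=> + w1 w2; elim: l => // i l IH /andP[iK li].
  apply: (introT and4P); split=> //; last exact: IH.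
  apply: (introT andP); split; first exact: mem_head.
  by apply: keyG => // x xG; rewrite inE xG orbT.
have sumG : cwf G (size_sum K).
  rewrite [cwf _ _]/=; have : all (ltn^~ K) (iota 0 K) by apply/allP => i; rewrite mem_iota.
  elim: (iota 0 K) => // i l IH /andP[iK /IH li]; apply: (introT andP); split=> //.
  by rewrite /= (sG i iK) tG !inE (sG i iK) ?orbT.
have maskG : all [in vm :: G] (vm :: vv :: hull_key K).
  by rewrite /= !inE vG !cG ?orbT.
have claimG : cwf G (claim (vv :: hull_key K) (any_mask rho (iota 0 K))).
  apply: (introT and4P); split=> //; apply: (introT andP); split.
    apply: (introT and3P); split=> //; apply: anyG => //.
    by apply/allP => i; rewrite mem_iota.
  exact: (introT andP).
by apply: (introT andP); split=> //; apply: (introT and3P).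
Qed.

Lemma cwf_lcp_program K : cwf [:: vN; vZ] (lcp_program K).
Proof.
have joinG rho : inj_below K rho -> cwf [:: vr; vN; vZ] (join K rho).
  move=> [rK _]; rewrite /join cwf_nest nest_wf_join.
  apply: cwf_join_body; rewrite ?mem_nest_scope ?mem_join_loops ?inE //.
  - by move=> k i k5 iK; rewrite mem_nest_scope mem_join_loops k5 iK.
  - by move=> i iK; rewrite mem_nest_scope mem_join_loops /= iK.
have roundG : cwf [:: vr; vN; vZ] (round K).
  rewrite /round; have : {subset enum [pred f : {ffun 'I_K -> 'I_K} | injectiveb f] <=
      [pred f : {ffun 'I_K -> 'I_K} | injectiveb f]} by move=> f; rewrite mem_enum.
  elim: (enum _) => // f l IH sub.
  rewrite -[cwf _ _]/(cwf [:: vr; vN; vZ] (join K (fun_below f)) &&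
    cwf [:: vr; vN; vZ] (foldr Seq Skip [seq join K (fun_below f) | f <- l])).
  rewrite joinG; last exact/fun_below_inj/sub/mem_head.
  by apply: IH => g gl; apply: sub; rewrite inE gl orbT.
by rewrite -[cwf _ _]/(cwf [:: vr; vN; vZ] (round K) && true) roundG.
Qed.

(** Soundness of the table makes the selected mask a common pattern. Any other common pattern is a
    matching that fits the range of all positions, hence is derivable, hence has its size in the
    table, and the selected size is the largest there. *)
Theorem theorem2 (d : nat) :
  exists (M : TM) (c k : nat),
    forall sigma tau : seq nat,
      in_R d sigma -> is_perm tau ->
      exists (t : nat) (pi : seq nat),
        t <= c * (size (enc_pair sigma tau)) ^ k + c /\
        halts_with M (enc_pair sigma tau) t (enc_perm pi) /\
        longest_common_pattern sigma tau pi.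
Proof.
set K := maxn d 2; have [M [c [k HM]]] := cmd_machine (cwf_lcp_program K).
exists M, c, k => sg ta Rs pt; have ps := Rs.1.
set w := enc_pair sg ta; have [t le_t ht] := HM w.
set N := (size w).+1; set r := init_env w; set s0 := init_store w.
have rN : r vN = N by [].
have rZ : r vZ = 0 by [].
have size_enc s : size s <= size (enc_perm s).
  elim: s => //= x s IH; rewrite /enc_perm /= size_cat -add1n leq_add //.
  by rewrite /enc_nat size_rcons.
have wE : size w = size (enc_perm sg) + (size (enc_perm ta)).+1 by rewrite size_cat.
have sN : size sg <= N by have := size_enc sg; rewrite /N; lia.
have tN : size ta <= N by have := size_enc ta; rewrite /N; lia.
pose s1 := sem (Inc 2) r s0; pose s2 := sem read_input r s1.
pose s3 := sem base_empty r s2; pose s4 := sem base_point r s3.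
pose s5 := sem (For vr vN (round K)) r s4; pose s6 := sem select r s5.
have out0 t' xs : 2 < t' -> arr s0 t' xs = false.
  move=> t3; rewrite /s0 /=; case: (addr _ _) => // i.
  by have := code_lt3 (nth I1 w i); case: (code _) => [|[|[|?]]] //; rewrite ?andbF //; lia.
have rd : reads w (read_all w) s2.
  apply: read_input_spec => //; split=> // [a b|a b|t' x t3].
  - exact: out0.
  - exact: out0.
  - by rewrite /s1 /= muln0 addn0.
have [i [v [f [l [E [l1 l2]]]]]] := read_pair sg ta.
rewrite E in rd; case: rd => _ _ r6 r7 _.
have iv2 : dp_inv sg ta N s2.
  split=> [a b|a b|key]; rewrite ?r6 ?r7 //.
  by rewrite [arr s2 8]sem_frame // out0.
have s2P key : arr s2 9 key = false by rewrite [arr s2 9]sem_frame // out0.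
have [iv3 s3P F0] := base_empty_inv rN rZ iv2 s2P.
have c2 : cnt s3 2 = 1 by rewrite /s3 sem_cnt // /s2 sem_cnt.
have [iv4 F1] := @base_point_inv sg ta N r s3 isT rN c2 iv3.
have fd : found sg ta N K 0 s4.
  suff H l0 key : derivable sg ta N K l0 key -> l0 = 0 -> arr s4 8 key by move=> key /H; apply.
  case=> // [l' B sB BN|l' B e BN Be] _.
  - by apply: sem_keep => //; apply: F0.
  - exact: F1 Be.
have [iv5 fd5] := rounds_found rN iv4 fd.
have full0 : arr s5 8 (0 :: full_box N) by apply: fd5; constructor; rewrite //= leqnn.
have [X mX [RX maxX]] := select_spec rN rZ iv5 full0.
have iS : forall a b, arr s6 6 [:: a; b] = (a < size sg) && (nth 0 sg a == b).
  by move=> a b; rewrite [arr s6 6]sem_frame //; case: iv5.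
have XS m : m \in unzip1 X -> m < size sg.
  by have [bX _ _] := mX; case/mapP=> e eX ->; have /andP[] := in_box_size (bX e eX).
have [p1 p2 zp] := matching_patterns ps sN mX.
have prt := print_spec ps sN iS RX XS rN (erefl (arr s6)).
set pi := standardize _ in p1 p2 zp prt.
exists t, pi; split=> //; split.
  suff <- : out (sem (lcp_program K) r s0) = enc_perm pi by [].
  rewrite -[sem (lcp_program K) r s0]/(sem print r s6) prt.
  suff -> : out s6 = [::] by [].
  rewrite !sem_out //; exact: prints_round.
split=> //; split=> // pi' q1 q2; rewrite zp.
have [Y mY <-] := common_pattern_matching ps pt sN tN q1 q2.
apply: maxX; first exact: leq_trans (matching_size mY) tN.
(* An empty [sg] has no range of positions to decompose; every matching is then empty. *)
case: (posnP (size sg)) => [sg0|sg_gt0].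
  suff -> : size Y = 0 by [].
  have [bY _ _] := mY; case: (Y) bY => // e Y' /(_ e (mem_head _ _))/in_box_size.
  by rewrite sg0.
have cI : convex_rng sg (0, (size sg).-1).
  split=> //=; first by rewrite prednK.
  by move=> k1 k2 k' _ _ lt _; rewrite /in_rng /= -ltnS prednK.
apply: fd5; apply: fits_derivable Rs cI _ tN _ => /=; first by rewrite /N; lia.
have [bY cY uY] := mY; split=> //.
- move=> e /bY/in_box_size/andP[lt _]; rewrite /in_rng /=; lia.
- split=> //=; first by rewrite /N; lia.
  move=> k'; rewrite /in_rng /= -ltnS prednK // => lt; apply: leq_trans sN.
  by rewrite -mem_perm // mem_nth.
- by rewrite /= !leqnn.
Qed.
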